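(* Let $\hat\tau^2_N$ be the cosine series estimator of $\tau^2$ defined in the context. Let $\beta>1$, $Q,\bar Q>0$, and let $N=N_n$ be a sequence of positive integers with $N_n=o(n^{1/2}/\log n)$. Assume either Model (I) and $\alpha>1/2$, or Model (II) and $\alpha>3/4$. Then, as $n\to\infty$, $$\sup_{\sigma^2\in\Theta_s^b(\alpha,Q),\ \tau^2\in\Theta_s^b(\beta,\bar Q)}\operatorname{MISE}(\hat\tau_N^2)=O\left(N^{-2\beta}+Nn^{-1}\right).$$ Consequently, if $N^*=N^*_n$ is a sequence of positive integers of exact order $n^{1/(2\beta+1)}$ (i.e. $c_1n^{1/(2\beta+1)}\le N^*_n\le c_2n^{1/(2\beta+1)}$ for some constants $0<c_1\le c_2<\infty$ and all $n$ large enough), then $$\sup_{\sigma^2\in\Theta_s^b(\alpha,Q),\ \tau^2\in\Theta_s^b(\beta,\bar Q)}\operatorname{MISE}(\hat\tau_{N^*}^2)=O\left(n^{-2\beta/(2\beta+1)}\right).$$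
   Context: **Models.** Let $n>16$, let $(W_t)_{t\in[0,1]}$ be a standard Brownian motion and $\epsilon_{1,n},\dots,\epsilon_{n,n}$ i.i.d. random variables, independent of $W$, with $E\epsilon_{i,n}=0$, $E\epsilon_{i,n}^2=1$, $E\epsilon_{i,n}^4<\infty$, whose law does not depend on $n$. Let $\sigma,\tau:[0,1]\to(0,\infty)$ be unknown deterministic functions. The observations are, for $i=1,\dots,n$: - Model (I): $Y_{i,n}=\int_0^{i/n}\sigma(s)\,dW_s+\tau(i/n)\epsilon_{i,n}$; - Model (II): $Y_{i,n}=\sigma(i/n)W_{i/n}+\tau(i/n)\epsilon_{i,n}$. **Smoothness classes.** For $\alpha,C>0$, $\Theta_s(\alpha,C)$ is the set of $f\in L^2[0,1]$ of the form $f(x)=\theta_0+2\sum_{i\ge1}\theta_i\cos(i\pi x)$ with $\sum_{i\ge1}i^{2\alpha}\theta_i^2\le C$. For $0<l<u<\infty$, $\Theta_s^b(\alpha,C)=\Theta_s^b(\alpha,C,[l,u])=\{f\in\Theta_s(\alpha,C): l\le f\le u\}$. For $\sigma^2$ the bounds are fixed constants $l=\sigma_{\min}$, $u=\sigma_{\max}$; for $\tau^2$ they are fixed constants $l=\tau_{\min}$, $u=\tau_{\max}$. (For smoothness index $>1/2$ such functions have a continuous representative, which is used; $\sigma,\tau$ are the positive square roots.) **Estimator.** $\log$ is the binary logarithm and $[x]$ the integer part of $x$. Let $f_0=1$ and $f_k(x)=\sqrt2\cos(k\pi x/2)$ for $k\ge1$. Let $\Delta Y^k\in\mathbb R^{n-1}$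 have components $(Y_{i+1,n}-Y_{i,n})f_k(i/n)$, $i=1,\dots,n-1$. Let $D$ be the $(n-1)\times(n-1)$ matrix with $D_{i,j}=\sqrt{2/n}\,\sin(ij\pi/n)$ and $\lambda_i=4\sin^2(i\pi/(2n))$. Let $J_n^\tau$ be the $(n-1)\times(n-1)$ diagonal matrix with $(J_n^\tau)_{i,i}=(n-n/\log n)^{-1}\lambda_i^{-1}$ for $[n/\log n]\le i\le n-1$ and $0$ otherwise. Put $\hat t_{k,0}=(\Delta Y^k)^tDJ_n^\tau D^t\Delta Y^k$ and $$\hat\tau_N^2(t)=\hat t_{0,0}+2\sum_{i=1}^N(\hat t_{i,0}-\hat t_{0,0})\cos(i\pi t).$$ $\operatorname{MISE}(\hat\tau^2_N)=E\int_0^1(\hat\tau_N^2(t)-\tau^2(t))^2dt$, the expectation being under the parameters $(\sigma,\tau)$. *)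

(* Defs.v *)
From mathcomp Require Import all_boot all_order all_algebra.
From mathcomp Require Import all_classical all_reals all_analysis.
Import Order.TTheory GRing.Theory Num.Theory.
Import numFieldNormedType.Exports.

Set Implicit Arguments.
Unset Strict Implicit.
Unset Printing Implicit Defensive.

Local Open Scope classical_set_scope.
Local Open Scope ring_scope.

Definition log2 {R : realType} (x : R) : R := ln x / ln 2.

(** * Independence *)

(* The product rule for every subfamily is included: take B j = setT for the
   indices j to be left out. *)
Definition mutually_independent {d} {T : measurableType d} {R : realType}
    (P : probability T R) (m : nat) (X : 'I_m -> T -> R) : Prop :=
  forall B : 'I_m -> set R, (forall j, measurable (B j)) ->
    P (\bigcap_(j in [set: 'I_m]) (X j @^-1` B j)) =
    (\prod_(j < m) P (X j @^-1` B j))%E.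

Definition sigma_of {d} {T : measurableType d} {R : realType} {I : Type}
    (D : set I) (X : I -> T -> R) : set (set T) :=
  <<s \bigcup_(i in D) preimage_set_system [set: T] (X i) measurable >>.

Definition independent_systems {d} {T : measurableType d} {R : realType}
    (P : probability T R) (F G : set (set T)) : Prop :=
  forall A B, F A -> G B -> P (A `&` B) = (P A * P B)%E.

(** * Brownian motion on [0, 1] and the noise *)

(* Only the values W t with t in [0, 1] are constrained.  The second parameter
   of normal_prob is the standard deviation. *)
Record brownian_motion {d} {T : measurableType d} {R : realType}
    (P : probability T R) (W : R -> {RV P >-> R}) : Prop := BrownianMotion {
  bm_start : {ae P, forall w, W 0 w = 0} ;
  bm_normal : forall s t : R, 0 <= s -> s < t -> t <= 1 ->
    forall B : set R, measurable B ->
      P ((fun w => W t w - W s w) @^-1` B) = normal_prob 0 (Num.sqrt (t - s)) B ;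
  bm_indep : forall (m : nat) (p : nat -> R),
    0 <= p 0%N -> (forall j, (j < m)%N -> p j <= p j.+1) -> p m <= 1 ->
    mutually_independent P (fun (j : 'I_m) w => W (p j.+1) w - W (p j) w) ;
  bm_continuous :
    {ae P, forall w, {within `[0, 1], continuous (fun t : R => W t w)}} }.

(* eps n i stands for the i-th noise variable at sample size n, 1 <= i <= n;
   nothing is assumed on the joint law of the rows of this triangular array. *)
Record noise {d} {T : measurableType d} {R : realType} (P : probability T R)
    (W : R -> {RV P >-> R}) (eps : nat -> nat -> {RV P >-> R}) : Prop := Noise {
  noise_indep : forall n, (16 < n)%N ->
    mutually_independent P (fun (j : 'I_n) => eps n j.+1) ;
  noise_law : forall n m i j, (16 < n)%N -> (16 < m)%N ->
    (0 < i <= n)%N -> (0 < j <= m)%N ->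
    forall B : set R, measurable B ->
      distribution P (eps n i) B = distribution P (eps m j) B ;
  noise_mean : forall n i, (16 < n)%N -> (0 < i <= n)%N ->
    ('E_P[eps n i] = 0)%E ;
  noise_var : forall n i, (16 < n)%N -> (0 < i <= n)%N ->
    ('E_P[fun w => (eps n i w ^+ 2)%R] = 1)%E ;
  noise_fourth : forall n i, (16 < n)%N -> (0 < i <= n)%N ->
    ('E_P[fun w => (eps n i w ^+ 4)%R] < +oo)%E ;
  noise_indep_bm : forall n, (16 < n)%N ->
    independent_systems P
      (sigma_of `[0, 1]%classic (fun t : R => W t : T -> R))
      (sigma_of [set i | (0 < i <= n)%N] (fun i => eps n i : T -> R)) }.

(** * Wiener integral of a deterministic function *)

(* The step function equal to coef j on ]knot j, knot (j + 1)], j < pieces. *)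
Record step_fun (R : realType) := StepFun {
  pieces : nat ;
  knot : nat -> R ;
  coef : nat -> R }.

Definition step_on {R : realType} (t : R) (e : step_fun R) : Prop :=
  [/\ 0 <= knot e 0%N,
      forall j, (j < pieces e)%N -> knot e j <= knot e j.+1
    & knot e (pieces e) <= t].

Definition step_eval {R : realType} (e : step_fun R) (x : R) : R :=
  \sum_(j < pieces e) coef e j * \1_(`]knot e j, knot e j.+1]%classic) x.

Definition step_integral {R : realType} {T : Type} (W : R -> T -> R)
    (e : step_fun R) (w : T) : R :=
  \sum_(j < pieces e) coef e j * (W (knot e j.+1) w - W (knot e j) w).

(* X is a version of the integral of f dW over [0, t]: the L^2(P)-limit of the
   integrals of step functions that converge to f in L^2[0, t]. *)
Definition wiener_integral {d} {T : measurableType d} {R : realType}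
    (P : probability T R) (W : R -> {RV P >-> R}) (f : R -> R) (t : R)
    (X : {RV P >-> R}) : Prop :=
  exists e : nat -> step_fun R,
  [/\ forall k, step_on t (e k),
      (\int[lebesgue_measure]_(x in `[0%R, t])
         ((f x - step_eval (e k) x) ^+ 2)%:E)%E @[k --> \oo] --> 0%E
    & ('E_P[fun w =>
         ((X w - step_integral (fun s => W s : T -> R) (e k) w) ^+ 2)%R])%E
         @[k --> \oo] --> 0%E].

(** * Observations *)

Inductive model := ModelI | ModelII.

(* Y i is the i-th observation, 1 <= i <= n; s2 and t2 are sigma^2, tau^2. *)
Definition observations {d} {T : measurableType d} {R : realType}
    (P : probability T R) (W : R -> {RV P >-> R})
    (eps : nat -> nat -> {RV P >-> R}) (M : model) (n : nat) (s2 t2 : R -> R)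
    (Y : nat -> T -> R) : Prop :=
  let sigma x := Num.sqrt (s2 x) in
  let tau x := Num.sqrt (t2 x) in
  forall i, (0 < i <= n)%N ->
  let x : R := i%:R / n%:R in
  match M with
  | ModelI => exists2 X : {RV P >-> R}, wiener_integral W sigma x X
      & forall w, Y i w = X w + tau x * eps n i w
  | ModelII => forall w, Y i w = sigma x * W x w + tau x * eps n i w
  end.

(** * Smoothness classes *)

Definition cosine_sum {R : realType} (theta : nat -> R) (m : nat) (x : R) : R :=
  theta 0%N + 2 * \sum_(1 <= i < m.+1) theta i * cos (i%:R * pi * x).

(* The cosine series is understood in L^2[0, 1]. *)
Definition smooth_class {R : realType} (a C : R) : set (R -> R) :=
  [set f : R -> R | [/\ measurable_fun (`[0, 1]%classic : set R) f,
      (\int[lebesgue_measure]_(x in `[0%R, 1%R]) (f x ^+ 2)%:E < +oo)%E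
    & exists theta : nat -> R,
      (\int[lebesgue_measure]_(x in `[0%R, 1%R])
         ((f x - cosine_sum theta m x) ^+ 2)%:E)%E @[m --> \oo] --> 0%E /\
      (\sum_(1 <= i <oo) (i%:R `^ (2 * a) * theta i ^+ 2)%:E <= C%:E)%E]].

(* For smoothness index a > 1/2: f is the continuous representative. *)
Definition smooth_class_b {R : realType} (a C l u : R) : set (R -> R) :=
  [set f : R -> R | [/\ smooth_class a C f,
      {within `[0, 1], continuous f}
    & forall x, 0 <= x <= 1 -> l <= f x <= u]].

(** * The estimator *)

(* Vectors and matrices are indexed from 0 in 'I_(n.-1): the index i of the
   usual notation is i.+1 below. *)

Definition basis_fun {R : realType} (k : nat) (x : R) : R :=
  if k == 0%N then 1 else Num.sqrt 2 * cos (k%:R * pi * x / 2).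

Definition increments {R : realType} (n : nat) (Y : nat -> R) (k : nat) :
    'cV[R]_(n.-1) :=
  \col_i ((Y i.+2 - Y i.+1) * basis_fun k (i.+1%:R / n%:R)).

Definition sine_mx {R : realType} (n : nat) : 'M[R]_(n.-1) :=
  \matrix_(i, j) (Num.sqrt (2 / n%:R) * sin (i.+1%:R * j.+1%:R * pi / n%:R)).

Definition eigval {R : realType} (n i : nat) : R :=
  4 * sin (i%:R * pi / (2 * n%:R)) ^+ 2.

Definition weight_mx {R : realType} (n : nat) : 'M[R]_(n.-1) :=
  diag_mx (\row_i
    if (Num.truncn ((n%:R : R) / log2 n%:R) <= i.+1)%N
    then (n%:R - n%:R / log2 n%:R)^-1 * (eigval n i.+1)^-1 else 0).

Definition t_hat {R : realType} (n : nat) (Y : nat -> R) (k : nat) : R :=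
  ((increments n Y k)^T *m sine_mx n *m weight_mx n *m (sine_mx n)^T
     *m increments n Y k) 0 0.

Definition tau2hat {R : realType} (n : nat) (Y : nat -> R) (N : nat) (t : R) : R :=
  t_hat n Y 0%N +
  2 * \sum_(1 <= i < N.+1) (t_hat n Y i - t_hat n Y 0%N) * cos (i%:R * pi * t).

Definition mise {d} {T : measurableType d} {R : realType} (P : probability T R)
    (n : nat) (Y : nat -> T -> R) (N : nat) (t2 : R -> R) : \bar R :=
  (\int[P]_w \int[lebesgue_measure]_(t in `[0%R, 1%R])
     ((tau2hat n (fun i => Y i w) N t - t2 t) ^+ 2)%:E)%E.

(* In Model (I) the supremum also runs over the versions of the Wiener
   integrals; they are almost surely equal, so mise does not depend on them. *)
Definition sup_mise {d} {T : measurableType d} {R : realType}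
    (P : probability T R) (W : R -> {RV P >-> R})
    (eps : nat -> nat -> {RV P >-> R}) (M : model) (S U : set (R -> R))
    (n N : nat) : \bar R :=
  ereal_sup [set r | exists s2 t2 Y,
    [/\ S s2, U t2, observations W eps M n s2 t2 Y & r = mise P n Y N t2]].

(* r = O(g) for a nonnegative extended-real sequence r, which is in particular
   finite for n large. *)
Definition ebigO {R : realType} (r : nat -> \bar R) (g : nat -> R) : Prop :=
  exists C : R, \forall n \near \oo, (r n <= (C * g n)%:E)%E.

(* Main.v *)
(* Writing f_k for the k-th basis function, the sine transform of the weighted
   increments splits into a signal part x_p and a noise part, linear in the
   noise variables with coefficients G_pc, so that t_hat_k is the sum over
   p >= n / log n of J_p (x_p + sum_c G_pc eps_c)^2.
   - The rows of G have energy of order lambda_p, by summation by parts, and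
     J_p lambda_p is of order 1 / n; hence the pure noise term has variance
     O(1 / n), and its mean differs from the integral of tau^2 f_k^2 by
     O(n^(-1/2)) (a Riemann sum, and orthogonality of the sines).
   - J_p = O(log^2 n / n), while the increments of the signal have fourth moments
     o(1 / (n log^4 n)) (through the Hoelder exponent > 1/4 of sigma^2 in Model
     (II)); so the pure signal term has second moment O(1 / n) by the crude bound
     J_p <= max J and Parseval.  The cross term is conditionally centred given W.
   So each Fourier coefficient of tau^2 is estimated with mean squared error
   O(1 / n), uniformly in k log n <= sqrt n, and Parseval adds N such errors to
   the tail O(N^(-2 beta)) of the cosine series. *)

Require Import Defs.
From HB Require Import structures.
From mathcomp Require Import all_boot all_order all_algebra.
From mathcomp Require Import all_classical all_reals all_analysis.
From mathcomp Require Import measurable_realfun ring lra zify.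
Import Order.TTheory GRing.Theory Num.Theory.
Import numFieldNormedType.Exports.
Set Implicit Arguments.
Unset Strict Implicit.
Unset Printing Implicit Defensive.
Local Open Scope classical_set_scope.
Local Open Scope ring_scope.

(** * The sine transform *)

(** The weights [J_p] are inverse to [lambda_p], so that all retained frequencies carry the same
    noise energy; the cut-off at n / log n keeps [J_p] below a multiple of log^2 n / n. This
    logarithm is what the increments of the signal have to beat, and k log n <= sqrt n is what makes
    the variation of f_k along the grid negligible, since it enters as k^2 / n^2 times max J. Two
    obstacles shape the probabilistic part. Only fourth moments of the noise are assumed finite, so
    the variance of the noise term is controlled by the Frobenius norm of its matrix. In Model (I)
    the Wiener integral is an L^2 limit, known up to null sets, and need not be measurable for the
    sigma-algebra of W; independence and fourth-moment bounds are therefore put in a form that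
    survives L^2 limits. Since f_k^2 = 1 + cos(k pi x), the target of t_hat_k is theta_0 + theta_k
    for k >= 1 and theta_0 for k = 0, theta being the cosine coefficients of tau^2; hence the
    subtraction of t_hat_0. The bias is squared in the risk, so for tau^2 the Hoelder exponent 1/2,
    granted by beta > 1, suffices. *)

Section TrigSums.
Context {R : realType}.
Implicit Types (x y : R) (n p q r : nat).

Lemma sin_natpi n : sin (n%:R * pi) = 0 :> R.
Proof.
elim: n => [|n IH]; first by rewrite mul0r sin0.
by rewrite -natr1 mulrDl mul1r sinDpi IH oppr0.
Qed.

Lemma cos_natpi n : cos (n%:R * pi) = (-1) ^+ n :> R.
Proof.
elim: n => [|n IH]; first by rewrite mul0r cos0.
by rewrite -natr1 mulrDl mul1r cosDpi IH exprS mulN1r.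
Qed.

Lemma sin_sin x y : sin x * sin y = (cos (x - y) - cos (x + y)) / 2.
Proof. by rewrite cosB cosD; field. Qed.

Lemma cos_cos x y : cos x * cos y = (cos (x - y) + cos (x + y)) / 2.
Proof. by rewrite cosB cosD; field. Qed.

Lemma sinB_cos x y : sin (x + y) - sin (x - y) = 2 * sin y * cos x.
Proof. by rewrite sinB sinD; ring. Qed.

Lemma cosD1 x : 1 + cos (2 * x) = 2 * cos x ^+ 2.
Proof. by rewrite mulr_natl cos_mulr2n -(mulr_natl (_ ^+ 2) 2); ring. Qed.

Lemma cosB1 x : 1 - cos (2 * x) = 2 * sin x ^+ 2.
Proof. by rewrite mulr_natl cos_mulr2n sin2cos2 -(mulr_natl (_ ^+ 2) 2); ring. Qed.

(** By [sinB_cos] each term times [2 * sin x] is a difference of consecutive sines, and the sum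
    telescopes. The identity is kept free of division because [sin x] may vanish. *)
Lemma sum_cos_odd n x :
  2 * sin x * \sum_(c < n) cos ((2 * c%:R + 1) * x) = sin (2 * n%:R * x).
Proof.
elim: n => [|n IH]; first by rewrite big_ord0 !mulr0 mul0r sin0.
rewrite big_ord_recr /= mulrDr IH -sinB_cos.
rewrite (_ : (2 * n%:R + 1) * x - x = 2 * n%:R * x); last by ring.
rewrite (_ : (2 * n%:R + 1) * x + x = 2 * n.+1%:R * x); last first.
  by rewrite -natr1; ring.
by ring.
Qed.

Lemma sum_cos n x :
  2 * sin (x / 2) * \sum_(c < n) cos (c%:R * x) =
  sin ((n%:R - 1 / 2) * x) + sin (x / 2).
Proof.
elim: n => [|n IH].
  rewrite big_ord0 mulr0 (_ : (0 - 1 / 2) * x = - (x / 2)) ?sinN ?addNr//.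
  by field.
rewrite big_ord_recr /= mulrDr IH -sinB_cos.
rewrite (_ : n%:R * x - x / 2 = (n%:R - 1 / 2) * x); last by field.
rewrite (_ : n%:R * x + x / 2 = (n.+1%:R - 1 / 2) * x); last first.
  by rewrite -natr1; field.
by ring.
Qed.

Lemma sin_frac_gt0 n r : (0 < r < n)%N -> 0 < sin (r%:R * pi / n%:R : R).
Proof.
move=> /andP[r0 rn]; have n0 : (0 < n)%N by exact: leq_ltn_trans rn.
apply: sin_gt0_pi; apply/andP; split.
  by rewrite divr_gt0 ?mulr_gt0 ?ltr0n ?pi_gt0.
by rewrite ltr_pdivrMr ?ltr0n// mulrC ltr_pM2l ?pi_gt0// ltr_nat.
Qed.

Lemma sum_cos_frac n r : (0 < r < 2 * n)%N ->
  \sum_(c < n) cos (c%:R * (r%:R * pi / n%:R)) = (1 - (-1) ^+ r) / 2 :> R.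
Proof.
move=> rn; have n0 : (0 < n)%N by case: n rn => //; lia.
have nn0 : n%:R != 0 :> R by rewrite pnatr_eq0 -lt0n.
have e : r%:R * pi / n%:R / 2 = r%:R * pi / (2 * n)%:R :> R.
  by rewrite natrM; field.
have s0 : sin (r%:R * pi / n%:R / 2) != 0 :> R.
  by rewrite e; apply/lt0r_neq0/sin_frac_gt0.
have := sum_cos n (r%:R * pi / n%:R).
rewrite (_ : (n%:R - 1 / 2) * _ = r%:R * pi - r%:R * pi / n%:R / 2); last first.
  by field.
rewrite sinB sin_natpi cos_natpi => H.
apply: (@mulfI _ (2 * sin (r%:R * pi / n%:R / 2))); first by rewrite mulf_neq0.
by rewrite H; field.
Qed.

(** The closed form [sin (2 * n * x)] vanishes at [x = r * pi / n], and dividing by [sin x] is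
    allowed except at [r = n], where instead every cosine equals -1. *)
Lemma sum_cos_odd_frac n r : (0 < r < 2 * n)%N -> r != n ->
  \sum_(c < n) cos ((2 * c%:R + 1) * (r%:R * pi / n%:R)) = 0 :> R.
Proof.
move=> rn rNn; have n0 : (0 < n)%N by case: n rn rNn => //; lia.
have nn0 : n%:R != 0 :> R by rewrite pnatr_eq0 -lt0n.
have s0 : sin (r%:R * pi / n%:R) != 0 :> R.
  have [rn'|nr|nr] := ltngtP r n.
  - by apply/lt0r_neq0/sin_frac_gt0; lia.
  - have -> : r%:R * pi / n%:R = (r - n)%:R * pi / n%:R + pi :> R.
      by rewrite natrB 1?ltnW//; field.
    rewrite sinDpi oppr_eq0; apply/lt0r_neq0/sin_frac_gt0; lia.
  - by move: rNn; rewrite nr eqxx.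
have := sum_cos_odd n (r%:R * pi / n%:R).
rewrite (_ : 2 * n%:R * _ = (2 * r)%:R * pi); last by rewrite natrM; field.
by rewrite sin_natpi => /eqP; rewrite !mulf_eq0 pnatr_eq0 (negbTE s0) /= => /eqP.
Qed.

Lemma sum_cos_odd_mid n : (0 < n)%N ->
  \sum_(c < n) cos ((2 * c%:R + 1) * (n%:R * pi / n%:R)) = - n%:R :> R.
Proof.
move=> n0; have nn0 : n%:R != 0 :> R by rewrite pnatr_eq0 -lt0n.
rewrite (eq_bigr (fun=> -1)) ?sumr_const ?card_ord ?mulNrn// => c _.
rewrite (_ : _ * _ = (2 * c)%:R * pi + pi); last by rewrite natrM; field.
by rewrite cosDpi cos_natpi mulnC exprM sqrr_sign.
Qed.

(** The product formula leaves the cosine sums at the frequencies [p - q] and [p + q]. These have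
    the same parity, so by [sum_cos_frac] they cancel unless [p = q]. *)
Lemma sum_sin_sin n p q : (0 < p < n)%N -> (0 < q < n)%N ->
  \sum_(i < n) sin (i%:R * (p%:R * pi / n%:R)) * sin (i%:R * (q%:R * pi / n%:R))
  = n%:R / 2 * (p == q)%:R :> R.
Proof.
wlog pq : p q / (q <= p)%N.
  move=> H hp hq; have [qp|pq] := leqP q p; first exact: H.
  by rewrite eq_sym -H//; [apply: eq_bigr => i _; rewrite mulrC|exact: ltnW].
move=> hp hq; have n0 : (0 < n)%N by lia.
have nn0 : n%:R != 0 :> R by rewrite pnatr_eq0 -lt0n.
under eq_bigr => i _ do rewrite sin_sin -mulrBr -mulrDr.
rewrite -mulr_suml big_split /= sumrN.
have -> : p%:R * pi / n%:R + q%:R * pi / n%:R = (p + q)%:R * pi / n%:R :> R.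
  by rewrite natrD; field.
have -> : p%:R * pi / n%:R - q%:R * pi / n%:R = (p - q)%:R * pi / n%:R :> R.
  by rewrite natrB//; field.
rewrite [X in _ - X]sum_cos_frac; last lia.
have [->|neq] := eqVneq p q.
  rewrite subnn (eq_bigr (fun=> 1)); last by move=> i _; rewrite !mul0r mulr0 cos0.
  by rewrite sumr_const card_ord addnn -muln2 exprM sqrr_sign mulr1; field.
rewrite sum_cos_frac; last by move: neq; lia.
have -> : (-1) ^+ (p + q) = (-1) ^+ (p - q) :> R.
  rewrite (_ : p + q = p - q + (2 * q))%N; last lia.
  by rewrite exprD exprM sqrrN !expr1n mulr1.
by rewrite mulr0; field.
Qed.

(** The Gram matrix of these cosines has diagonal entries at most [n / 2] and off-diagonal entries
    0, or [- n / 2] when the two frequencies add up to [n]. All coefficients are 1, so an upper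
    bound on the entries is enough, for any set [A] of frequencies. *)
Lemma sum_sq_sum_cos n (A : pred nat) :
  \sum_(c < n) (\sum_(p < n.-1 | A p) cos ((2 * c%:R + 1) * (p.+1%:R * pi / n%:R))) ^+ 2
  <= n%:R ^+ 2 / 2 :> R.
Proof.
case: n => [|n] /=.
  by rewrite !big_ord0 expr0n mul0r.
pose S p q : R := \sum_(c < n.+1) cos ((2 * c%:R + 1) * (p%:R * pi / n.+1%:R)) *
   cos ((2 * c%:R + 1) * (q%:R * pi / n.+1%:R)).
have nn0 : n.+1%:R != 0 :> R by rewrite pnatr_eq0.
have SE p q : (q <= p)%N -> (0 < p < n.+1)%N -> (0 < q < n.+1)%N ->
    S p q <= n.+1%:R / 2 * (p == q)%:R.
  move=> pq hp hq; rewrite /S.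
  under eq_bigr => i _ do rewrite cos_cos -mulrBr -mulrDr.
  rewrite -mulr_suml big_split /=.
  have -> : p%:R * pi / n.+1%:R + q%:R * pi / n.+1%:R = (p + q)%:R * pi / n.+1%:R :> R.
    by rewrite natrD; field.
  have -> : p%:R * pi / n.+1%:R - q%:R * pi / n.+1%:R = (p - q)%:R * pi / n.+1%:R :> R.
    by rewrite natrB//; field.
  set X := (X in _ + X); have X0 : X <= 0.
    rewrite /X; have [->|pqn] := eqVneq (p + q)%N n.+1.
      by rewrite sum_cos_odd_mid// oppr_le0.
    by rewrite sum_cos_odd_frac//; lia.
  have [->|neq] := eqVneq p q.
    rewrite subnn (eq_bigr (fun=> 1)); last by move=> i _; rewrite !mul0r mulr0 cos0.
    rewrite sumr_const card_ord mulr1 ler_pM2r ?invr_gt0//.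
    by rewrite gerDl.
  rewrite sum_cos_odd_frac; [|by move: neq; lia|by lia].
  by rewrite add0r mulr0 pmulr_lle0 ?invr_gt0.
have {}SE p q : (0 < p < n.+1)%N -> (0 < q < n.+1)%N ->
    S p q <= n.+1%:R / 2 * (p == q)%:R.
  move=> hp hq; have [qp|pq] := leqP q p; first exact: SE.
  rewrite (_ : S p q = S q p); last by apply: eq_bigr => i _; rewrite mulrC.
  by rewrite eq_sym; apply: SE => //; exact: ltnW.
under eq_bigr => c _ do rewrite expr2 big_distrlr /=.
rewrite exchange_big /=.
under eq_bigr => p _ do rewrite exchange_big /=.
apply: (@le_trans _ _ (\sum_(p < n | A p) \sum_(q < n | A q)
   n.+1%:R / 2 * (p == q)%:R)).
  by apply: ler_sum => p _; apply: ler_sum => q _; apply: (SE p.+1 q.+1); apply/andP; split => //; exact: ltn_ord.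
apply: (@le_trans _ _ (\sum_(p < n | A p) n.+1%:R / 2)).
  apply: ler_sum => p Ap; rewrite -mulr_sumr ler_piMr ?divr_ge0//.
  rewrite (bigD1 p)//= eqxx big1 ?addr0// => q /andP[_ qp].
  by rewrite eq_sym (negbTE qp).
apply: (@le_trans _ _ (\sum_(p < n) n.+1%:R / 2)).
  by rewrite [leRHS](bigID (fun p : 'I_n => A p)) /= lerDl sumr_ge0.
rewrite sumr_const card_ord -[_ / 2 *+ n]mulr_natl.
have : n%:R <= n.+1%:R :> R by rewrite ler_nat.
have : 0 <= n%:R :> R by [].
nra.
Qed.

End TrigSums.

(** The indices are the unshifted mathematical ones, so that [i = 0] and [i = n] make sense: the
    entry vanishes there, which removes the boundary terms in every summation by parts. *)
Definition sine_entry {R : realType} (n i p : nat) : R :=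
  Num.sqrt (2 / n%:R) * sin (i%:R * p%:R * pi / n%:R).

Section SineTransform.
Context {R : realType}.
Variable n : nat.
Hypothesis n1 : (1 < n)%N.
Local Notation D := (@sine_entry R n).
Local Notation lam := (@eigval R n).

Let n0 : n%:R != 0 :> R. Proof. by rewrite pnatr_eq0; lia. Qed.
Let n0' : 0 < n%:R :> R. Proof. by rewrite ltr0n; lia. Qed.

Lemma sine_entryC i p : D i p = D p i.
Proof. by rewrite /sine_entry (mulrC i%:R). Qed.

Lemma sine_entry0 p : D 0 p = 0.
Proof. by rewrite /sine_entry !mul0r sin0 mulr0. Qed.

Lemma sine_entryn p : D n p = 0.
Proof.
rewrite /sine_entry (_ : n%:R * p%:R * pi / n%:R = p%:R * pi); last by field.
by rewrite sin_natpi mulr0.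
Qed.

Lemma sum_ord_shift (F : nat -> R) : F 0%N = 0 ->
  \sum_(i < n) F i = \sum_(i < n.-1) F i.+1.
Proof. by move=> F0; case: n n1 => // m _; rewrite big_ord_recl F0 add0r. Qed.

Lemma sine_orth (p q : 'I_(n.-1)) :
  \sum_(i < n.-1) D i.+1 p.+1 * D i.+1 q.+1 = (p == q)%:R.
Proof.
rewrite -(@sum_ord_shift (fun i => D i p.+1 * D i q.+1)); last first.
  by rewrite sine_entry0 mul0r.
have E i r : D i r = Num.sqrt (2 / n%:R) * sin (i%:R * (r%:R * pi / n%:R)).
  by rewrite /sine_entry; congr (_ * sin _); field.
under eq_bigr => i _ do rewrite !E mulrACA -expr2 sqr_sqrtr ?divr_ge0//.
have hp := ltn_ord p; have hq := ltn_ord q.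
rewrite -mulr_sumr sum_sin_sin ?eqSS; [|lia|lia].
by rewrite mulrA (_ : _ / _ * _ = 1) ?mul1r//; field.
Qed.

Lemma sum_mul_delta (m : nat) (p : 'I_m) (b : 'I_m -> R) :
  \sum_(q < m) b q * (p == q)%:R = b p.
Proof.
rewrite (bigD1 p)//= eqxx mulr1 big1 ?addr0// => q qp.
by rewrite eq_sym (negbTE qp) mulr0.
Qed.

Lemma sine_parseval (b : 'I_(n.-1) -> R) :
  \sum_(i < n.-1) (\sum_(p < n.-1) b p * D i.+1 p.+1) ^+ 2 = \sum_p b p ^+ 2.
Proof.
under eq_bigr => i _ do rewrite expr2 big_distrlr /=.
rewrite exchange_big /=; apply: eq_bigr => p _.
rewrite exchange_big /= expr2 -[X in _ = X * _](sum_mul_delta p b) mulr_suml.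
apply: eq_bigr => q _; rewrite -sine_orth mulr_sumr mulr_suml.
by apply: eq_bigr => i _; ring.
Qed.

Lemma sine_parsevalC (u : 'I_(n.-1) -> R) :
  \sum_(p < n.-1) (\sum_(i < n.-1) D i.+1 p.+1 * u i) ^+ 2 = \sum_i u i ^+ 2.
Proof.
rewrite -sine_parseval; apply: eq_bigr => p _; congr (_ ^+ 2).
by apply: eq_bigr => i _; rewrite sine_entryC mulrC.
Qed.

Lemma sum_by_parts (s : nat -> R) m :
  \sum_(c < m.+1) (s c.+1 - s c) ^+ 2 =
  \sum_(i < m) s i.+1 * (2 * s i.+1 - s i - s i.+2)
  + s m.+1 * (s m.+1 - s m) - s 0%N * (s 1%N - s 0%N).
Proof.
elim: m => [|m IH]; first by rewrite big_ord_recr !big_ord0 /=; ring.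
by rewrite big_ord_recr /= IH [in RHS]big_ord_recr /=; ring.
Qed.

Lemma eigvalE p : lam p = 2 - 2 * cos (p%:R * pi / n%:R).
Proof.
rewrite /eigval (_ : p%:R * pi / n%:R = 2 * (p%:R * pi / (2 * n%:R))).
  by have := @cosB1 R (p%:R * pi / (2 * n%:R)); lra.
by field.
Qed.

Lemma eigval_ge0 p : 0 <= lam p.
Proof. by rewrite mulr_ge0// sqr_ge0. Qed.

(** The columns of the sine matrix are eigenvectors of the discrete Laplacian with zero boundary
    values, with the eigenvalues of the estimator. *)
Lemma sine_eigen i p : 2 * D i.+1 p - D i p - D i.+2 p = lam p * D i.+1 p.
Proof.
rewrite eigvalE /sine_entry.
set t := p%:R * pi / n%:R.
have E j : j%:R * p%:R * pi / n%:R = j%:R * t by rewrite /t; field.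
rewrite !E -[i.+2%:R]natr1.
set x := i.+1%:R * t.
have -> : i%:R * t = x - t by rewrite /x -natr1; ring.
have -> : (i.+1%:R + 1) * t = x + t by rewrite /x; ring.
by rewrite sinB sinD; ring.
Qed.

(** Summation by parts turns the energy of the differences into the quadratic form of the discrete
    Laplacian, which the sine basis diagonalizes. *)
Lemma sine_diff_energy (b : 'I_(n.-1) -> R) :
  \sum_(c < n) (\sum_(p < n.-1) b p * D c.+1 p.+1 - \sum_(p < n.-1) b p * D c p.+1) ^+ 2
  = \sum_(p < n.-1) lam p.+1 * b p ^+ 2.
Proof.
pose s c := \sum_(p < n.-1) b p * D c p.+1.
have s0 : s 0%N = 0 by rewrite /s big1// => p _; rewrite sine_entry0 mulr0.
have sn : s n = 0 by rewrite /s big1// => p _; rewrite sine_entryn mulr0.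
have : \sum_(c < n) (s c.+1 - s c) ^+ 2 =
    \sum_(i < n.-1) s i.+1 * (2 * s i.+1 - s i - s i.+2).
  have -> : n = n.-1.+1 by lia.
  rewrite sum_by_parts /=.
  by rewrite s0 -[n.-1.+1](_ : n = _)?sn; [ring|lia].
rewrite /s => ->.
transitivity (\sum_(i < n.-1) \sum_(p < n.-1)
    s i.+1 * (lam p.+1 * b p * D i.+1 p.+1)).
  apply: eq_bigr => i _; rewrite -mulr_sumr; congr (_ * _).
  rewrite /s mulr_sumr -!sumrB; apply: eq_bigr => p _.
  by rewrite mulrAC -sine_eigen; ring.
rewrite exchange_big /=; apply: eq_bigr => p _.
have sb : \sum_(i < n.-1) s i.+1 * D i.+1 p.+1 = b p.
  rewrite -[RHS](sum_mul_delta p b).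
  under eq_bigr => i _ do rewrite /s mulr_suml.
  rewrite exchange_big /=; apply: eq_bigr => q _.
  by rewrite -sine_orth !mulr_sumr; apply: eq_bigr => i _; ring.
rewrite expr2 mulrA -[X in _ = _ * X]sb mulr_sumr; apply: eq_bigr => i _; ring.
Qed.

(** With [y = p * pi / (2 * n)] the difference is proportional to [sin y * cos ((2 * c + 1) * y)].
    Its square is the mean level [lam p / n], the same at each grid point [c], plus an oscillation
    that averages out. *)
Lemma sine_diff_sq c p :
  (D c.+1 p - D c p) ^+ 2 =
  lam p / n%:R * (1 + cos ((2 * c%:R + 1) * (p%:R * pi / n%:R))).
Proof.
rewrite /sine_entry -mulrBr exprMn sqr_sqrtr ?divr_ge0//.
rewrite /eigval; set y := p%:R * pi / (2 * n%:R).
rewrite (_ : p%:R * pi / n%:R = 2 * y); last by rewrite /y; field.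
rewrite [_ * (2 * y)]mulrCA cosD1.
rewrite (_ : c.+1%:R * p%:R * pi / n%:R = (2 * c%:R + 1) * y + y); last first.
  by rewrite -natr1 /y; field.
rewrite (_ : c%:R * p%:R * pi / n%:R = (2 * c%:R + 1) * y - y); last first.
  by rewrite /y; field.
by rewrite sinB_cos; field.
Qed.

End SineTransform.

(** * The noise part of the transformed increments *)

Lemma abel_sum {R : comRingType} (a z : nat -> R) m :
  \sum_(i < m) a i.+1 * (z i.+2 - z i.+1) =
  \sum_(c < m.+1) (a c - a c.+1) * z c.+1 + a m.+1 * z m.+1 - a 0%N * z 1%N.
Proof.
elim: m => [|m IH]; first by rewrite big_ord_recr !big_ord0 /=; ring.
by rewrite big_ord_recr /= IH [in RHS]big_ord_recr /=; ring.
Qed.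

(* Column c holds the coefficient of the noise variable of index c + 1 in the
   sine transform of the weighted noise increments. *)
Definition noise_mx {R : realType} (n : nat) (f tau : nat -> R) (p c : nat) : R :=
  tau c.+1 * (f c * sine_entry n c p.+1 - f c.+1 * sine_entry n c.+1 p.+1).

Section NoiseOperator.
Context {R : realType}.
Variable n : nat.
Hypothesis n1 : (1 < n)%N.
Variables f tau : nat -> R.
Variables (L2 tmax kappa : R) (J : 'I_(n.-1) -> R).
Local Notation D := (@sine_entry R n).
Local Notation lam := (@eigval R n).
Local Notation G := (noise_mx n f tau).

(** Abel summation moves the difference from the noise to the product of [f] and the sine; the
    boundary terms contain the sine at 0 and at [n]. *)
Lemma sine_transform_noise (e : nat -> R) (p : 'I_(n.-1)) :
  \sum_(i < n.-1) D i.+1 p.+1 *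
     ((tau i.+2 * e i.+2 - tau i.+1 * e i.+1) * f i.+1) =
  \sum_(c < n) G p c * e c.+1.
Proof.
have -> : \sum_(c < n) G p c * e c.+1 = \sum_(c < n.-1.+1)
   (f c * D c p.+1 - f c.+1 * D c.+1 p.+1) * (tau c.+1 * e c.+1).
  have -> : n.-1.+1 = n by lia.
  by apply: eq_bigr => c _; rewrite /noise_mx; ring.
have := abel_sum (fun c => f c * D c p.+1) (fun c => tau c * e c) n.-1.
rewrite sine_entry0 (_ : D n.-1.+1 p.+1 = 0); last first.
  by have -> : n.-1.+1 = n; [lia|exact: sine_entryn].
rewrite !(mulr0, mul0r) addr0 subr0 => <-.
by apply: eq_bigr => i _; ring.
Qed.

Hypothesis f2 : forall c, (c <= n)%N -> f c ^+ 2 <= 2.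
Hypothesis df2 : forall c, (c < n)%N -> (f c.+1 - f c) ^+ 2 <= L2.
Hypothesis tau2 : forall c, (0 < c <= n)%N -> tau c ^+ 2 <= tmax.

Let tmax0 : 0 <= tmax.
Proof. by apply: le_trans (tau2 (c := n) _); [exact: sqr_ge0|lia]. Qed.

(** Up to sign, [f c * s c - f c.+1 * s c.+1] is [f c.+1 * (s c.+1 - s c) + (f c.+1 - f c) * s c].
    The first summand is measured by [sine_diff_energy], the second by Parseval; the factor 4 is 2
    from the square of a sum times the bound 2 on [f ^ 2]. *)
Lemma noise_mx_bound (b : 'I_(n.-1) -> R) :
  \sum_(c < n) (\sum_(p < n.-1) b p * G p c) ^+ 2 <=
  tmax * \sum_(p < n.-1) b p ^+ 2 * (4 * lam p.+1 + 2 * L2).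
Proof.
pose s c := \sum_(p < n.-1) b p * D c p.+1.
have GE c : \sum_(p < n.-1) b p * G p c = tau c.+1 * (f c * s c - f c.+1 * s c.+1).
  rewrite /s !mulr_sumr -sumrB mulr_sumr; apply: eq_bigr => p _.
  by rewrite /noise_mx; ring.
have H c : (c < n)%N -> (tau c.+1 * (f c * s c - f c.+1 * s c.+1)) ^+ 2 <=
    tmax * (4 * (s c.+1 - s c) ^+ 2 + 2 * L2 * s c ^+ 2).
  move=> cn; rewrite exprMn ler_pM ?sqr_ge0//; first by apply: tau2; lia.
  have A : f c.+1 ^+ 2 * (s c.+1 - s c) ^+ 2 <= 2 * (s c.+1 - s c) ^+ 2.
    by rewrite ler_wpM2r ?sqr_ge0// f2.
  have B : (f c.+1 - f c) ^+ 2 * s c ^+ 2 <= L2 * s c ^+ 2.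
    by rewrite ler_wpM2r ?sqr_ge0// df2.
  have : 0 <= (f c.+1 * (s c.+1 - s c) - (f c.+1 - f c) * s c) ^+ 2 by exact: sqr_ge0.
  nra.
apply: (@le_trans _ _ (\sum_(c < n) tmax * (4 * (s c.+1 - s c) ^+ 2 + 2 * L2 * s c ^+ 2))).
  by apply: ler_sum => c _; rewrite GE H.
rewrite -mulr_sumr ler_wpM2l// big_split /= -!mulr_sumr.
rewrite (sine_diff_energy n1) (@sum_ord_shift _ _ n1 (fun c => s c ^+ 2)); last first.
  by rewrite /s big1 ?expr0n// => p _; rewrite sine_entry0 mulr0.
rewrite (sine_parseval n1) !mulr_sumr -big_split /=.
by apply: ler_sum => p _; rewrite le_eqVlt; apply/orP; left; apply/eqP; ring.
Qed.

Hypothesis J0 : forall p, 0 <= J p.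
Hypothesis Jk : forall p, J p * (4 * lam p.+1 + 2 * L2) <= kappa.

(** The coefficients [J p * a p] enter squared: one factor [J p] is absorbed by the energy into
    [kappa], the other stays as a weight. *)
Lemma noise_mx_weighted_bound (a : 'I_(n.-1) -> R) :
  \sum_(c < n) (\sum_(p < n.-1) J p * a p * G p c) ^+ 2 <=
  tmax * kappa * \sum_p J p * a p ^+ 2.
Proof.
apply: le_trans (noise_mx_bound (fun p => J p * a p)) _.
rewrite -mulrA ler_wpM2l// mulr_sumr; apply: ler_sum => p _.
rewrite (_ : _ * _ = J p * (4 * lam p.+1 + 2 * L2) * (J p * a p ^+ 2)); last by ring.
by rewrite ler_wpM2r// mulr_ge0// sqr_ge0.
Qed.

Lemma noise_mx_row (p : 'I_(n.-1)) :
  \sum_(c < n) G p c ^+ 2 <= tmax * (4 * lam p.+1 + 2 * L2).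
Proof.
have := noise_mx_bound (fun q => (p == q)%:R).
rewrite (bigD1 p)//= eqxx expr1n mul1r [X in _ + X]big1 ?addr0; last first.
  by move=> q qp; rewrite eq_sym (negbTE qp) expr0n mul0r.
apply: le_trans; apply: ler_sum => c _.
under [in leRHS]eq_bigr => q _ do rewrite mulrC.
by rewrite (sum_mul_delta p (fun q => G q c)).
Qed.

(** Column [d] of the matrix is handled by [noise_mx_weighted_bound] with [a] the column [d] of [G];
    summing over [d] leaves the weighted row energies of [G], again at most [tmax * kappa] each.
    With [kappa] of order 1 / n the total is of order 1 / n. *)
Lemma noise_form_frobenius :
  \sum_(c < n) \sum_(d < n) (\sum_(p < n.-1) J p * G p c * G p d) ^+ 2 <=
  (tmax * kappa) ^+ 2 * n%:R.
Proof.
have k0 : 0 <= kappa.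
  case: n n1 J J0 Jk => [//|[//|m]] _ J' J0' Jk'.
  have L20 : 0 <= L2.
    apply: le_trans (sqr_ge0 (f 1 - f 0)) (df2 _); lia.
  apply: le_trans (Jk' ord0); rewrite mulr_ge0// addr_ge0// mulr_ge0//.
  exact: eigval_ge0.
rewrite exchange_big /=.
apply: (@le_trans _ _ (\sum_(d < n) tmax * kappa * \sum_p J p * G p d ^+ 2)).
  apply: ler_sum => d _; apply: le_trans (noise_mx_weighted_bound (fun p => G p d)).
  by apply: ler_sum => c _; rewrite le_eqVlt; apply/orP; left; apply/eqP;
    congr (_ ^+ 2); apply: eq_bigr => p _; ring.
have K0 : 0 <= tmax * kappa by exact: mulr_ge0.
rewrite -mulr_sumr exchange_big /= expr2 -[leRHS]mulrA ler_wpM2l//.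
apply: (@le_trans _ _ (\sum_(p < n.-1) tmax * kappa)).
  apply: ler_sum => p _; rewrite -mulr_sumr.
  apply: le_trans (ler_wpM2l (J0 p) (noise_mx_row p)) _.
  by rewrite mulrCA ler_wpM2l.
rewrite sumr_const card_ord -[_ *+ n.-1]mulr_natr ler_wpM2l//.
by rewrite ler_nat leq_pred.
Qed.

End NoiseOperator.

(** * Bias of the noise part *)

Lemma sqrD_sub_bound {R : realFieldType} (eta x y : R) : 0 < eta ->
  `|(x + y) ^+ 2 - x ^+ 2| <= eta * x ^+ 2 + (1 + eta^-1) * y ^+ 2.
Proof.
move=> e0; have ei0 : 0 < eta^-1 by rewrite invr_gt0.
have H s : s ^+ 2 = 1 -> 2 * (s * x * y) <= eta * x ^+ 2 + eta^-1 * y ^+ 2.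
  move=> s1.
  have : 0 <= eta^-1 * (s * eta * x - y) ^+ 2 by rewrite mulr_ge0 ?sqr_ge0// ltW.
  rewrite (_ : eta^-1 * _ = eta * (s ^+ 2 * x ^+ 2) - 2 * (s * x * y) + eta^-1 * y ^+ 2).
    by rewrite s1; lra.
  by field; rewrite gt_eqF.
have := H 1 (expr1n _ _); have := H (-1) (sqrr_sign _ 1).
have := sqr_ge0 y; rewrite ler_norml => ? ? ?; apply/andP; split; nra.
Qed.

Lemma sum_const_tail {R : pzRingType} m p0 (x : R) : (0 < p0)%N ->
  \sum_(p < m | (p0 <= p.+1)%N) x = (m.+1 - p0)%:R * x.
Proof.
move=> p0_gt0; elim: m => [|m IH].
  by rewrite big_ord0 (_ : 1 - p0 = 0)%N ?mul0r//; lia.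
rewrite big_mkcond big_ord_recr /= -big_mkcond /= IH; case: ifPn => h.
  by rewrite (_ : m.+2 - p0 = (m.+1 - p0).+1)%N -?natr1 ?mulrDl ?mul1r//; lia.
by rewrite addr0; congr (_%:R * _); lia.
Qed.

Section NoiseBias.
Context {R : realType}.
Variable n : nat.
Hypothesis n1 : (1 < n)%N.
Variables f tau : nat -> R.
Variables (L2 tmax w Jmax : R) (p0 : nat) (J : 'I_(n.-1) -> R).
Local Notation D := (@sine_entry R n).
Local Notation lam := (@eigval R n).
Local Notation G := (noise_mx n f tau).
Hypothesis f2 : forall c, (c <= n)%N -> f c ^+ 2 <= 2.
Hypothesis df2 : forall c, (c < n)%N -> (f c.+1 - f c) ^+ 2 <= L2.
Hypothesis tau2 : forall c, (0 < c <= n)%N -> tau c ^+ 2 <= tmax.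
Hypothesis p0n : (0 < p0 <= n)%N.
Hypothesis w0 : 0 <= w.
Hypothesis J0 : forall p, 0 <= J p <= Jmax.
Hypothesis Jw : forall p : 'I_(n.-1), J p * lam p.+1 = if (p0 <= p.+1)%N then w else 0.

Let n0 : n%:R != 0 :> R. Proof. by rewrite pnatr_eq0; lia. Qed.
Let n0' : 0 < n%:R :> R. Proof. by rewrite ltr0n; lia. Qed.
Let tmax0 : 0 <= tmax.
Proof. by apply: le_trans (tau2 (c := n) _); [exact: sqr_ge0|lia]. Qed.
Let L20 : 0 <= L2.
Proof. apply: le_trans (sqr_ge0 (f 1 - f 0)) (df2 _); lia. Qed.

Let g c := tau c.+1 ^+ 2 * f c.+1 ^+ 2.

Let g_bound c : (c < n)%N -> 0 <= g c <= 2 * tmax.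
Proof.
move=> cn; rewrite /g mulr_ge0 ?sqr_ge0//= mulrC ler_pM ?sqr_ge0//.
  exact: f2.
by apply: tau2.
Qed.

(** Replaces [f c] by [f c.+1] in row [p] of [G], after which the row is [tau * f] times a
    difference of sines. Young's inequality with the free parameter [eta] trades the leading energy
    against the increments of [f]. *)
Let noise_bias_lead eta : 0 < eta ->
  `|\sum_(p < n.-1) J p * \sum_(c < n) G p c ^+ 2
    - \sum_(p < n.-1) J p * \sum_(c < n) g c * (D c.+1 p.+1 - D c p.+1) ^+ 2|
  <= tmax * (n%:R * (2 * eta * w + (1 + eta^-1) * L2 * Jmax)).
Proof.
move=> e0; have ei0 : 0 < eta^-1 by rewrite invr_gt0.
rewrite -sumrB; apply: le_trans (ler_norm_sum _ _ _) _.
apply: (@le_trans _ _ (\sum_(p < n.-1) tmax * (2 * eta * w + (1 + eta^-1) * L2 * Jmax))).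
  apply: ler_sum => p _; have /andP[Jp0 JpM] := J0 p.
  rewrite -mulrBr normrM ger0_norm// -sumrB.
  have lam0 : 0 <= lam p.+1 by exact: eigval_ge0.
  have : `|\sum_(c < n) (G p c ^+ 2 - g c * (D c.+1 p.+1 - D c p.+1) ^+ 2)| <=
      tmax * (2 * eta * lam p.+1 + (1 + eta^-1) * L2).
    have dE : \sum_(c < n) (D c.+1 p.+1 - D c p.+1) ^+ 2 = lam p.+1.
      have := sine_diff_energy n1 (fun q => (p == q)%:R : R).
      rewrite (bigD1 p)//= eqxx expr1n mulr1 [X in _ = _ + X]big1 ?addr0; last first.
        by move=> q qp; rewrite eq_sym (negbTE qp) expr0n mulr0.
      have dD i : \sum_(q < n.-1) (p == q)%:R * D i q.+1 = D i p.+1.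
        by under eq_bigr => q _ do rewrite mulrC; rewrite (sum_mul_delta p (fun q => D i q.+1)).
      by move=> <-; apply: eq_bigr => c _; rewrite !dD.
    have DE : \sum_(c < n) D c p.+1 ^+ 2 = 1.
      rewrite (@sum_ord_shift _ _ n1 (fun c => D c p.+1 ^+ 2)).
        transitivity (\sum_(i < n.-1) D i.+1 p.+1 * D i.+1 p.+1).
          by apply: eq_bigr => i _; rewrite expr2.
        by rewrite (sine_orth n1) eqxx.
      by rewrite sine_entry0 expr0n.
    apply: le_trans (ler_norm_sum _ _ _) _.
    apply: (@le_trans _ _ (\sum_(c < n) tmax * (2 * eta * (D c.+1 p.+1 - D c p.+1) ^+ 2
        + (1 + eta^-1) * L2 * D c p.+1 ^+ 2))).
      apply: ler_sum => c _; rewrite /g /noise_mx.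
      set d := D c.+1 p.+1 - D c p.+1.
      rewrite (_ : _ - _ = tau c.+1 ^+ 2 *
        ((f c.+1 * d + (f c.+1 - f c) * D c p.+1) ^+ 2 - (f c.+1 * d) ^+ 2)); last first.
        by rewrite /d; ring.
      rewrite normrM ger0_norm ?sqr_ge0// ler_pM ?sqr_ge0//.
        by apply: tau2; exact: ltn_ord.
      apply: le_trans (sqrD_sub_bound _ _ e0) _; rewrite !exprMn lerD//.
        rewrite mulrA [2 * eta]mulrC ler_wpM2r ?sqr_ge0// ler_wpM2l//; first exact: ltW.
        by rewrite f2//; exact: ltn_ord.
      rewrite -[_ * L2 * _]mulrA ler_wpM2l ?addr_ge0//; first exact: ltW.
      have Hd := df2 (ltn_ord c); apply: ler_wpM2r => //; rewrite mulr_ge0 ?sqr_ge0//.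
    by rewrite -mulr_sumr big_split /= -!mulr_sumr dE DE mulr1.
  move=> /(ler_wpM2l Jp0)/le_trans; apply.
  have Jw' : J p * lam p.+1 <= w by rewrite Jw; case: ifP.
  rewrite mulrCA ler_wpM2l// mulrDr lerD//.
    by rewrite mulrCA ler_wpM2l// mulr_ge0// ltW.
  by rewrite mulrC ler_wpM2l// mulr_ge0// addr_ge0// ltW.
have Jm0 : 0 <= Jmax.
  have h : (0 < n.-1)%N by lia.
  by have /andP[] := J0 (Ordinal h); exact: le_trans.
rewrite sumr_const card_ord -[_ *+ n.-1]mulr_natr -mulrA ler_wpM2l// mulrC.
rewrite ler_wpM2r ?ler_nat ?leq_pred//.
by rewrite addr_ge0 ?mulr_ge0// ?addr_ge0// ltW.
Qed.

(** [sine_diff_sq] splits the sum into a mean level, where [w] times the number [n - p0] of retained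
    frequencies is close to 1, and an oscillating part in which the sums [S c] over frequencies
    appear. *)
Let noise_bias_main :
  `|\sum_(p < n.-1) J p * \sum_(c < n) g c * (D c.+1 p.+1 - D c p.+1) ^+ 2
   - n%:R^-1 * \sum_(c < n) g c|
  <= 2 * tmax * (w * Num.sqrt n%:R + `|w * (n - p0)%:R - 1|).
Proof.
pose S c : R := \sum_(p < n.-1 | (p0 <= p.+1)%N)
  cos ((2 * c%:R + 1) * (p.+1%:R * pi / n%:R)).
have -> : \sum_(p < n.-1) J p * \sum_(c < n) g c * (D c.+1 p.+1 - D c p.+1) ^+ 2 =
    w / n%:R * ((n - p0)%:R * \sum_(c < n) g c + \sum_(c < n) g c * S c).
  transitivity (\sum_(p < n.-1 | (p0 <= p.+1)%N) w / n%:R *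
     \sum_(c < n) g c * (1 + cos ((2 * c%:R + 1) * (p.+1%:R * pi / n%:R)))).
    rewrite [RHS]big_mkcond /=; apply: eq_bigr => p _.
    transitivity (J p * lam p.+1 / n%:R *
        \sum_(c < n) g c * (1 + cos ((2 * c%:R + 1) * (p.+1%:R * pi / n%:R)))).
      rewrite -mulrA -mulrA; congr (_ * _); rewrite mulrA mulr_sumr.
      by apply: eq_bigr => c _; rewrite sine_diff_sq//; ring.
    by rewrite Jw; case: ifP => _; rewrite ?mul0r.
  rewrite -mulr_sumr; congr (_ * _).
  under eq_bigr => p _ do (under eq_bigr => c _ do rewrite mulrDr mulr1; rewrite big_split /=).
  rewrite big_split /=; congr (_ + _).
    by rewrite sum_const_tail; [congr (_%:R * _); lia|lia].
  rewrite exchange_big /=; apply: eq_bigr => c _.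
  by rewrite /S mulr_sumr.
have -> : w / n%:R * ((n - p0)%:R * \sum_(c < n) g c + \sum_(c < n) g c * S c)
   - n%:R^-1 * \sum_(c < n) g c =
   w / n%:R * (\sum_(c < n) g c * S c) +
   (w * (n - p0)%:R - 1) * (n%:R^-1 * \sum_(c < n) g c) by ring.
apply: le_trans (ler_normD _ _) _; rewrite mulrDr lerD//.
  rewrite normrM ger0_norm ?divr_ge0//.
  set r := Num.sqrt n%:R.
  have r2 : r ^+ 2 = n%:R by rewrite sqr_sqrtr.
  have r0 : 0 < r by rewrite sqrtr_gt0.
  have : `|\sum_(c < n) g c * S c| <= 2 * tmax * (n%:R * r).
    apply: le_trans (ler_norm_sum _ _ _) _.
    (* Young's inequality with weight [r = sqrt n], the typical size of [S c] according to
       [sum_sq_sum_cos]. This gains a factor [sqrt n] over the trivial bound. *)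
    apply: (@le_trans _ _ (\sum_(c < n) 2 * tmax * ((S c ^+ 2 / r + r) / 2))).
      apply: ler_sum => c _; have /andP[g0 gM] := g_bound (ltn_ord c).
      rewrite normrM (ger0_norm g0) ler_pM//.
      have : 0 <= (`|S c| - r) ^+ 2 / r by rewrite divr_ge0 ?sqr_ge0// ltW.
      rewrite (_ : _ / r = `|S c| ^+ 2 / r + r - 2 * `|S c|); last first.
        by field; rewrite gt_eqF.
      by rewrite real_normK ?num_real//; lra.
    rewrite -mulr_sumr ler_wpM2l ?mulr_ge0// -mulr_suml big_split /=.
    rewrite -mulr_suml sumr_const card_ord -[r *+ n]mulr_natl.
    have := @sum_sq_sum_cos R n (fun p => p0 <= p.+1)%N.
    rewrite -/(S _) => HS.
    have : (\sum_(c < n) S c ^+ 2) / r <= n%:R ^+ 2 / 2 / r.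
      by rewrite ler_wpM2r// invr_ge0 ltW.
    have -> : n%:R ^+ 2 / 2 / r = n%:R * r / 2.
      by rewrite -[n%:R ^+ 2]/(n%:R * n%:R) -{2}r2; field; rewrite gt_eqF.
    have : 0 <= n%:R * r by rewrite mulr_ge0// ltW.
    lra.
  move=> H; apply: (@le_trans _ _ (w / n%:R * (2 * tmax * (n%:R * r)))).
    by rewrite ler_wpM2l// divr_ge0.
  by rewrite le_eqVlt; apply/orP; left; apply/eqP; field.
rewrite normrM mulrC ler_wpM2r// ger0_norm.
  rewrite ler_pdivrMl//.
  apply: (@le_trans _ _ (\sum_(c < n) 2 * tmax)).
    by apply: ler_sum => c _; have /andP[] := g_bound (ltn_ord c).
  by rewrite sumr_const card_ord -[_ *+ n]mulr_natl.
rewrite mulr_ge0 ?invr_ge0// sumr_ge0// => c _.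
by have /andP[] := g_bound (ltn_ord c).
Qed.

Lemma noise_bias eta : 0 < eta ->
  `|\sum_(p < n.-1) J p * \sum_(c < n) G p c ^+ 2
    - n%:R^-1 * \sum_(c < n) tau c.+1 ^+ 2 * f c.+1 ^+ 2|
  <= tmax * (n%:R * (2 * eta * w + (1 + eta^-1) * L2 * Jmax)
     + 2 * (w * Num.sqrt n%:R + `|w * (n - p0)%:R - 1|)).
Proof.
move=> e0; have := lerD (noise_bias_lead e0) noise_bias_main.
move/(le_trans (ler_normD _ _)); rewrite addrA subrK => /le_trans; apply.
by rewrite le_eqVlt; apply/orP; left; apply/eqP; ring.
Qed.

End NoiseBias.

(** * Change of variables under a weight *)

Section WeightedTransfer.
Context d1 d2 (T1 : measurableType d1) (T2 : measurableType d2) (R : realType).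
Variables (mu1 : {measure set T1 -> \bar R}) (mu2 : {measure set T2 -> \bar R}).
Variables (X : T1 -> T2) (Psi : T1 -> R) (c : R).
Hypothesis mX : measurable_fun setT X.
Hypothesis mPsi : measurable_fun setT Psi.
Hypothesis Psi0 : forall x, 0 <= Psi x.
Hypothesis c0 : 0 <= c.
Hypothesis H : forall B, measurable B ->
  (\int[mu1]_x (Psi x * \1_B (X x))%:E = c%:E * mu2 B)%E.
Import HBNNSimple.

Let transfer_nnsfun (h : {nnsfun T2 >-> R}) :
  (\int[mu1]_x (Psi x * h (X x))%:E = \int[mu2]_y (c * h y)%:E)%E.
Proof.
have mh r : measurable (h @^-1` [set r]) by exact: measurable_funPTI.
transitivity (\int[mu1]_x (\sum_(r \in range h)
    (r * (Psi x * \1_(h @^-1` [set r]) (X x)))%:E))%E.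
  apply: eq_integral => x _; rewrite [in LHS]fimfunE/= mulr_fsumr -fsumEFin//.
  by apply: eq_fsbigr => r _; congr EFin; ring.
rewrite ge0_integral_fsum//; last 2 first.
- move=> r; apply/measurable_EFinP; apply: measurable_funM => //.
  apply: measurable_funM => //.
  exact: (measurableT_comp (measurable_indic _)).
- move=> r x _; rewrite lee_fin mulrCA mulr_ge0// -lee_fin.
  exact: nnfun_muleindic_ge0.
transitivity (\sum_(r \in range h) \int[mu2]_y (r * (c * \1_(h @^-1` [set r]) y))%:E)%E.
  apply: eq_fsbigr => r rh.
  have r0 : 0 <= r by move: rh => /[!inE] -[y _ <-].
  under eq_integral do rewrite EFinM.
  under [RHS]eq_integral do rewrite EFinM.
  rewrite !ge0_integralZl ?lee_fin//; last 4 first.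
  - by apply/measurable_EFinP; apply: measurable_funM.
  - by move=> y _; rewrite lee_fin mulr_ge0.
  - apply/measurable_EFinP/measurable_funM => //.
    exact: (measurableT_comp (measurable_indic _)).
  - by move=> y _; rewrite lee_fin mulr_ge0.
  congr (_ * _)%E; rewrite H//.
  under [RHS]eq_integral do rewrite EFinM.
  by rewrite ge0_integralZl ?lee_fin// ?integral_indic ?setIT//; exact/measurable_EFinP.
rewrite -ge0_integral_fsum//; last 2 first.
- by move=> r; apply/measurable_EFinP; apply: measurable_funM => //; apply: measurable_funM.
- move=> r x _; rewrite lee_fin mulrCA mulr_ge0// -lee_fin.
  exact: nnfun_muleindic_ge0.
apply: eq_integral => y _; rewrite [in RHS]fimfunE/= mulr_fsumr -fsumEFin//.
by apply: eq_fsbigr => r _; congr EFin; ring.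
Qed.

(** The usual passage from indicators through simple functions to monotone limits. The weight [Psi]
    is later a product of functions of other independent variables, the indicator of an event of the
    noise, or a Gaussian density. *)
Lemma ge0_integral_weighted_transfer (g : T2 -> R) :
  measurable_fun setT g -> (forall y, 0 <= g y) ->
  (\int[mu1]_x (Psi x * g (X x))%:E = c%:E * \int[mu2]_y (g y)%:E)%E.
Proof.
move=> mg g0; have mEg : measurable_fun setT (EFin \o g) by exact/measurable_EFinP.
pose f_ := nnsfun_approx measurableT mEg.
rewrite -ge0_integralZl ?lee_fin//; last by move=> y _; rewrite lee_fin.
have cvf y : (f_ n y)%:E @[n --> \oo] --> (g y)%:E.
  by apply: (cvg_nnsfun_approx measurableT mEg) => // z _; rewrite lee_fin.
transitivity (limn (fun n => \int[mu1]_x (Psi x * f_ n (X x))%:E))%E.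
  rewrite -monotone_convergence//.
  - apply: eq_integral => x _; apply/esym/cvg_lim => //.
    under eq_fun do rewrite EFinM.
    rewrite EFinM; apply: cvgeMl; last exact: cvf.
    by [].
  - move=> n; apply/measurable_EFinP; apply: measurable_funM => //.
    exact: (measurableT_comp _ mX).
  - by move=> n x _; rewrite lee_fin mulr_ge0.
  - move=> x _ m n mn; rewrite lee_fin ler_wpM2l//.
    exact/lefP/nd_nnsfun_approx.
transitivity (limn (fun n => \int[mu2]_y (c * f_ n y)%:E))%E.
  by congr (limn _); apply/funext => n; exact: transfer_nnsfun.
rewrite -monotone_convergence//.
- apply: eq_integral => y _; apply/cvg_lim => //.
  under eq_fun do rewrite EFinM.
  by apply: cvgeMl; last exact: cvf.
- by move=> n; apply/measurable_EFinP; exact: measurable_funM.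
- by move=> n x _; rewrite lee_fin mulr_ge0.
- by move=> x _ m n mn; rewrite lee_fin ler_wpM2l//; exact/lefP/nd_nnsfun_approx.
Qed.

End WeightedTransfer.

(** * Expectations of real random variables *)

(** An infinite integral has [mean] equal to 0, so bounds on means carry information only together
    with [integ]. *)
HB.lock Definition mean {d} {T : measurableType d} {R : realType}
  (P : probability T R) (f : T -> R) : R := Rintegral P setT f.
Canonical mean_unlockable := Unlockable mean.unlock.

Section Expectation.
Context d (T : measurableType d) (R : realType) (P : probability T R).

Local Notation mean := (mean P).

Definition integ (f : T -> R) : Prop := P.-integrable setT (EFin \o f).

Lemma integ_measurable f : integ f -> measurable_fun setT f.
Proof. by move=> /(measurable_int P)/measurable_EFinP. Qed.

Lemma integ_mean f : integ f -> (\int[P]_w (f w)%:E = (mean f)%:E)%E.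
Proof. by move=> If; rewrite unlock /Rintegral fineK//; exact: integrable_fin_num. Qed.

Lemma eq_mean f g : f =1 g -> mean f = mean g.
Proof. by move=> fg; rewrite unlock; apply: eq_Rintegral => w _. Qed.

Lemma eq_integ f g : f =1 g -> integ f -> integ g.
Proof. by move=> /funext ->. Qed.

Lemma integ_cst c : integ (fun=> c).
Proof. exact: finite_measure_integrable_cst. Qed.

Lemma integD f g : integ f -> integ g -> integ (fun w => f w + g w).
Proof. by move=> If Ig; exact: (integrableD measurableT If Ig). Qed.

Lemma integZ c f : integ f -> integ (fun w => c * f w).
Proof. by move=> If; exact: (integrableZl measurableT c If). Qed.

Lemma integN f : integ f -> integ (fun w => - f w).
Proof. by move=> If; apply: eq_integ (integZ (-1) If) => w; rewrite mulN1r. Qed.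

Lemma integB f g : integ f -> integ g -> integ (fun w => f w - g w).
Proof. by move=> If Ig; apply: integD => //; exact: integN. Qed.

Lemma integ_sum (I : Type) (r : seq I) (Q : pred I) (f : I -> T -> R) :
  (forall i, Q i -> integ (f i)) -> integ (fun w => \sum_(i <- r | Q i) f i w).
Proof.
move=> If; elim: r => [|i r IH].
  by apply: eq_integ (integ_cst 0) => w; rewrite big_nil.
case Qi : (Q i); last first.
  by apply: eq_integ IH => w; rewrite big_cons Qi.
by apply: eq_integ (integD (If i Qi) IH) => w; rewrite big_cons Qi.
Qed.

Lemma integ_le (f g : T -> R) : measurable_fun setT f -> (forall w, `|f w| <= g w) ->
  integ g -> integ f.
Proof.
move=> mf fg Ig; apply: (le_integrable measurableT _ _ Ig).
  exact/measurable_EFinP.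
by move=> w _; rewrite /= lee_fin (le_trans (fg w))// ler_norm.
Qed.

Lemma integ_norm f : integ f -> integ (fun w => `|f w|).
Proof. by move=> If; apply: integrable_norm. Qed.

Lemma integ_lty (f : T -> R) : measurable_fun setT f -> (forall w, 0 <= f w) ->
  (\int[P]_w (f w)%:E < +oo)%E -> integ f.
Proof.
move=> mf f0 fy; apply/integrableP; split; first exact/measurable_EFinP.
by under eq_integral do rewrite /= ger0_norm//.
Qed.

Lemma mean_cst c : mean (fun=> c) = c.
Proof. by rewrite unlock Rintegral_cst//= probability_setT mulr1. Qed.

Lemma meanD f g : integ f -> integ g ->
  mean (fun w => f w + g w) = mean f + mean g.
Proof. by move=> *; rewrite unlock; exact: RintegralD. Qed.

Lemma meanZ c f : integ f -> mean (fun w => c * f w) = c * mean f.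
Proof. by move=> *; rewrite unlock; exact: RintegralZl. Qed.

Lemma meanB f g : integ f -> integ g ->
  mean (fun w => f w - g w) = mean f - mean g.
Proof. by move=> *; rewrite unlock; exact: RintegralB. Qed.

Lemma mean_sum (I : Type) (r : seq I) (Q : pred I) (f : I -> T -> R) :
  (forall i, Q i -> integ (f i)) ->
  mean (fun w => \sum_(i <- r | Q i) f i w) = \sum_(i <- r | Q i) mean (f i).
Proof.
move=> If; elim: r => [|i r IH].
  by rewrite big_nil -[RHS](mean_cst 0); apply: eq_mean => w; rewrite big_nil.
rewrite big_cons; case: ifP => Qi; last first.
  by rewrite -IH; apply: eq_mean => w; rewrite big_cons Qi.
rewrite -IH -meanD; [|exact: If|exact: integ_sum].
by apply: eq_mean => w; rewrite big_cons Qi.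
Qed.

Lemma mean_ge0 (f : T -> R) : (forall w, 0 <= f w) -> 0 <= mean f.
Proof. by move=> f0; rewrite unlock; exact: Rintegral_ge0. Qed.

Lemma le_mean (f g : T -> R) : integ f -> integ g -> (forall w, f w <= g w) ->
  mean f <= mean g.
Proof. by move=> If Ig fg; rewrite unlock; apply: le_Rintegral. Qed.

(** * Variables with a finite fourth moment *)

Definition L4 (f : T -> R) : Prop :=
  measurable_fun setT f /\ integ (fun w => f w ^+ 4).

Lemma L4_measurable f : L4 f -> measurable_fun setT f. Proof. by case. Qed.

(** A dominating function for any product of at most four variables with finite fourth moment, which
    replaces Hoelder's inequality in all integrability arguments. *)
Lemma norm_prod4_le (x y z t : R) :
  `|x * y * z * t| <= x ^+ 4 + y ^+ 4 + z ^+ 4 + t ^+ 4.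
Proof.
have H (u v : R) : `|u * v| <= u ^+ 2 / 2 + v ^+ 2 / 2.
  have := sqr_ge0 (u + v); have := sqr_ge0 (u - v).
  by rewrite ler_norml => ? ?; apply/andP; split; nra.
have S u : (u ^+ 2) ^+ 2 = u ^+ 4 :> R by rewrite -exprM.
have := H (x * y) (z * t); rewrite mulrA => /le_trans; apply.
have := H (x ^+ 2) (y ^+ 2); have := H (z ^+ 2) (t ^+ 2).
rewrite !S -!exprMn !ger0_norm ?sqr_ge0//.
have p4 u : 0 <= u ^+ 4 :> R by rewrite -S sqr_ge0.
have := p4 x; have := p4 y; have := p4 z; have := p4 t; lra.
Qed.

Lemma L4_prod4 f g h k : L4 f -> L4 g -> L4 h -> L4 k ->
  integ (fun w => f w * g w * h w * k w).
Proof.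
move=> [mf If] [mg Ig] [mh Ih] [mk Ik].
apply: (integ_le _ (fun w => norm_prod4_le _ _ _ _)).
  by do 3 (apply: measurable_funM => //).
by do 3 (apply: integD => //).
Qed.

Lemma L4_cst c : L4 (fun=> c).
Proof. by split => //; exact: integ_cst. Qed.

Lemma L4_prod3 f g h : L4 f -> L4 g -> L4 h -> integ (fun w => f w * g w * h w).
Proof.
move=> Lf Lg Lh; apply: eq_integ (L4_prod4 Lf Lg Lh (L4_cst 1)) => w.
by rewrite mulr1.
Qed.

Lemma L4_prod2 f g : L4 f -> L4 g -> integ (fun w => f w * g w).
Proof.
move=> Lf Lg; apply: eq_integ (L4_prod3 Lf Lg (L4_cst 1)) => w.
by rewrite mulr1.
Qed.

Lemma L4_integ f : L4 f -> integ f.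
Proof. by move=> Lf; apply: eq_integ (L4_prod2 Lf (L4_cst 1)) => w; rewrite mulr1. Qed.

Lemma L4_sq f : L4 f -> integ (fun w => f w ^+ 2).
Proof. by move=> Lf; apply: eq_integ (L4_prod2 Lf Lf) => w; rewrite expr2. Qed.

Lemma L4_pow f (a : nat) : (a <= 4)%N -> L4 f -> integ (fun w => f w ^+ a).
Proof.
move=> + Lf; move: a => [|[|[|[|[|//]]]]] _.
- exact: integ_cst.
- by apply: eq_integ (L4_integ Lf) => w; rewrite expr1.
- exact: L4_sq.
- by apply: eq_integ (L4_prod3 Lf Lf Lf) => w; ring.
- by case: Lf.
Qed.

Lemma pow4D_le (x y : R) : (x + y) ^+ 4 <= 8 * (x ^+ 4 + y ^+ 4).
Proof.
have S u : (u ^+ 2) ^+ 2 = u ^+ 4 :> R by rewrite -exprM.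
have H u v : (u + v) ^+ 2 <= 2 * (u ^+ 2 + v ^+ 2) :> R.
  by have := sqr_ge0 (u - v); nra.
rewrite -S; apply: (@le_trans _ _ ((2 * (x ^+ 2 + y ^+ 2)) ^+ 2)).
  by rewrite ler_sqr ?nnegrE ?sqr_ge0// mulr_ge0// addr_ge0// sqr_ge0.
by have := H (x ^+ 2) (y ^+ 2); rewrite !S exprMn; lra.
Qed.

Lemma pow4_ge0 (x : R) : 0 <= x ^+ 4.
Proof. by rewrite exprn_even_ge0. Qed.

Lemma L4D f g : L4 f -> L4 g -> L4 (fun w => f w + g w).
Proof.
move=> [mf If] [mg Ig]; split; first exact: measurable_funD.
apply: (@integ_le _ (fun w => 8 * (f w ^+ 4 + g w ^+ 4))).
- exact/measurable_funX/measurable_funD.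
- by move=> w; rewrite ger0_norm ?pow4_ge0// pow4D_le.
- by apply: integZ; exact: integD.
Qed.

Lemma L4Z c f : L4 f -> L4 (fun w => c * f w).
Proof.
move=> [mf If]; split; first exact: measurable_funM.
by apply: eq_integ (integZ (c ^+ 4) If) => w; rewrite exprMn.
Qed.

Lemma eq_L4 f g : f =1 g -> L4 f -> L4 g.
Proof. by move=> /funext ->. Qed.

Lemma L4B f g : L4 f -> L4 g -> L4 (fun w => f w - g w).
Proof.
move=> Lf Lg; apply: eq_L4 (L4D Lf (L4Z (-1) Lg)) => w.
by rewrite mulN1r.
Qed.

Lemma L4_sum (I : Type) (r : seq I) (Q : pred I) (f : I -> T -> R) :
  (forall i, Q i -> L4 (f i)) -> L4 (fun w => \sum_(i <- r | Q i) f i w).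
Proof.
move=> If; elim: r => [|i r IH].
  by apply: eq_L4 (L4_cst 0) => w; rewrite big_nil.
case Qi : (Q i); last first.
  by apply: eq_L4 IH => w; rewrite big_cons Qi.
by apply: eq_L4 (L4D (If i Qi) IH) => w; rewrite big_cons Qi.
Qed.

End Expectation.

Lemma measurable_prod_fun {R : realType} d (T : measurableType d)
    (I : Type) (r : seq I) (Q : pred I) (f : I -> T -> R) :
  (forall i, measurable_fun setT (f i)) ->
  measurable_fun setT (fun w => \prod_(i <- r | Q i) f i w).
Proof.
move=> mf; elim: r => [|i r IH].
  by under eq_fun do rewrite big_nil; exact: measurable_cst.
under eq_fun do rewrite big_cons; case: (Q i) => //.
exact: measurable_funM.
Qed.

(** * Independence *)

Section Independence.
Context d (T : measurableType d) (R : realType) (P : probability T R).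
Local Notation mean := (mean P).
Local Notation integ := (integ P).
Local Notation L4 := (L4 P).
Variables (m : nat) (X : 'I_m -> T -> R) (Phi : T -> R).
Hypothesis mX : forall j, measurable_fun setT (X j).
Hypothesis Phi0 : forall w, 0 <= Phi w.
Hypothesis IPhi : integ Phi.

(* For Phi = 1 this is the product rule defining mutual independence. *)
Definition weighted_independence : Prop :=
  forall B : 'I_m -> set R, (forall j, measurable (B j)) ->
  mean (fun w => Phi w * \prod_j \1_(B j) (X j w)) =
  mean Phi * \prod_j mean (fun w => \1_(B j) (X j w)).

Hypothesis wi : weighted_independence.

Let meas_comp (g : R -> R) j : measurable_fun setT g ->
  measurable_fun setT (fun w => g (X j w)).
Proof. by move=> mg; exact: (measurableT_comp mg). Qed.

Let integ_bounded (f h : T -> R) : integ f -> measurable_fun setT h ->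
  (forall w, 0 <= h w <= 1) -> integ (fun w => f w * h w).
Proof.
move=> If mh h01; apply: (integ_le _ _ (integ_norm If)).
  by apply: measurable_funM => //; exact: integ_measurable If.
move=> w; have /andP[h0 h1] := h01 w.
by rewrite normrM (ger0_norm h0) ler_piMr.
Qed.

Let nonneg_family (g : 'I_m -> R -> R) :=
  forall j, [/\ measurable_fun setT (g j), forall x, 0 <= g j x &
    integ (fun w => g j (X j w))].

(** Induction on the number [k] of leading coordinates with an arbitrary nonnegative test function,
    the remaining ones being indicators. For the next coordinate all other factors form the weight
    [Psi]; the induction hypothesis tests [Psi] against indicators, and
    [ge0_integral_weighted_transfer] extends this to [g jk]. *)
Let indep_step k : (k <= m)%N -> forall g, nonneg_family g ->
  (forall j : 'I_m, (k <= j)%N -> exists2 B, measurable B & g j = \1_B) ->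
  integ (fun w => Phi w * \prod_j g j (X j w)) /\
  mean (fun w => Phi w * \prod_j g j (X j w)) =
  mean Phi * \prod_j mean (fun w => g j (X j w)).
Proof.
elim: k => [_ g gp gB|k IH km g gp gB].
  have [B HB] : exists B : 'I_m -> set R, forall j, measurable (B j) /\ g j = \1_(B j).
    suff : forall j, exists B : set R, measurable B /\ g j = \1_B by move=> /choice[B HB]; exists B.
    by move=> j; have [B mB gjB] := gB j isT; exists B.
  have gE j : g j = \1_(B j) by case: (HB j).
  split.
    apply: integ_bounded => //.
      by apply: measurable_prod_fun => j; apply: meas_comp; case: (gp j).
    move=> w; apply/andP; split.
      by apply: prodr_ge0 => j _; case: (gp j).
    apply: Num.Theory.prodr_ile1 => j _; rewrite gE indicE.
    by case: (_ \in _); rewrite /= ?lexx ?ler01.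
  have -> : (fun w => Phi w * \prod_j g j (X j w)) =
      (fun w => Phi w * \prod_j \1_(B j) (X j w)).
    by apply/funext => w; congr (_ * _); apply: eq_bigr => j _; rewrite gE.
  rewrite wi; last by move=> j; case: (HB j).
  by congr (_ * _); apply: eq_bigr => j _; apply: eq_mean => w; rewrite gE.
pose jk := Ordinal km.
pose Psi w := Phi w * \prod_(j | j != jk) g j (X j w).
pose c := mean Phi * \prod_(j | j != jk) mean (fun w => g j (X j w)).
have PsiE g' (h : R -> R) : (forall j, j != jk -> g' j = g j) -> g' jk = h ->
    (fun w => Phi w * \prod_j g' j (X j w)) = (fun w => Psi w * h (X jk w)).
  move=> g'g g'h; apply/funext => w; rewrite /Psi (bigD1 jk)//= g'h mulrCA mulrC.
  by congr (_ * _); congr (_ * _); apply: eq_bigr => j jjk; rewrite g'g.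
have cE g' h : (forall j, j != jk -> g' j = g j) -> g' jk = h ->
    mean Phi * \prod_j mean (fun w => g' j (X j w)) = c * mean (fun w => h (X jk w)).
  move=> g'g g'h; rewrite /c (bigD1 jk)//= g'h mulrCA mulrC.
  by congr (_ * _); congr (_ * _); apply: eq_bigr => j jjk; rewrite g'g.
pose Xm := isMeasurableFun.Build _ _ _ _ _ (mX jk).
pose Xk : {mfun T >-> R} := HB.pack (X jk) Xm.
have mPsi : measurable_fun setT Psi.
  apply: measurable_funM; first exact: integ_measurable IPhi.
  by apply: measurable_prod_fun => j; apply: meas_comp; case: (gp j).
have Psi0 w : 0 <= Psi w.
  by rewrite /Psi mulr_ge0//; apply: prodr_ge0 => j _; case: (gp j).
have c0 : 0 <= c.
  rewrite /c mulr_ge0 ?mean_ge0//; apply: prodr_ge0 => j _; apply: mean_ge0 => w.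
  by case: (gp j).
have [mg g0 Ig] := gp jk.
have H (B : set R) : measurable B ->
    (\int[P]_w (Psi w * \1_B (X jk w))%:E = c%:E * distribution P Xk B)%E.
  move=> mB; pose g' j := if j == jk then \1_B else g j.
  have g'g j : j != jk -> g' j = g j by rewrite /g' => /negbTE ->.
  have g'k : g' jk = \1_B by rewrite /g' eqxx.
  have iB : integ (fun w => \1_B (X jk w)).
    apply: (@integ_le _ _ _ _ _ (fun=> 1)); last exact: integ_cst.
      exact/meas_comp/measurable_indic.
    by move=> w; rewrite indicE; case: (_ \in _); rewrite /= ?normr0 ?normr1.
  have [] := IH (ltnW km) g'.
  - move=> j; have [->|jjk] := eqVneq j jk; last by rewrite g'g.
    rewrite g'k; split => //; exact: measurable_indic.
  - move=> j; rewrite leq_eqVlt => /orP[/eqP kj|kj].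
      by exists B => //; rewrite (_ : j = jk)//; exact: val_inj.
    rewrite g'g; first exact: gB.
    by rewrite -val_eqE /= gtn_eqF.
  - rewrite (PsiE _ _ g'g g'k) (cE _ _ g'g g'k) => I M.
    rewrite integ_mean// M EFinM; congr (_ * _)%E.
    rewrite -integ_mean//.
    transitivity (\int[P]_w (\1_(X jk @^-1` B) w)%:E)%E; first by [].
    rewrite integral_indic ?setIT//.
    by rewrite -[X in measurable X]setTI; exact: mX.
have E : (\int[P]_w (Psi w * g jk (X jk w))%:E =
    (c * mean (fun w => g jk (X jk w)))%:E)%E.
  rewrite (ge0_integral_weighted_transfer (mX jk) mPsi Psi0 c0 H mg g0).
  rewrite ge0_integral_distribution//.
  - by rewrite (EFinM c) -(integ_mean Ig).
  - exact/measurable_EFinP.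
have IE : integ (fun w => Psi w * g jk (X jk w)).
  apply: integ_lty; last by rewrite E ltry.
    by apply: measurable_funM => //; exact: meas_comp.
  by move=> w; rewrite mulr_ge0.
rewrite (PsiE g (g jk))// (cE g (g jk))//; split => //.
by apply: EFin_inj; rewrite -integ_mean.
Qed.

Lemma mean_prod_ge0 (g : 'I_m -> R -> R) :
  (forall j, [/\ measurable_fun setT (g j), forall x, 0 <= g j x &
    integ (fun w => g j (X j w))]) ->
  integ (fun w => Phi w * \prod_j g j (X j w)) /\
  mean (fun w => Phi w * \prod_j g j (X j w)) =
  mean Phi * \prod_j mean (fun w => g j (X j w)).
Proof.
move=> gp; apply: (indep_step (leqnn m) gp) => j mj.
by have := ltn_ord j; rewrite ltnNge mj.
Qed.

Lemma integ_prod (g : 'I_m -> R -> R) :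
  (forall j, measurable_fun setT (g j)) ->
  (forall j, integ (fun w => g j (X j w))) ->
  integ (fun w => Phi w * \prod_j g j (X j w)).
Proof.
move=> mg Ig.
have [I _] := @mean_prod_ge0 (fun j x => `|g j x|)
  (fun j => And3 (measurableT_comp (@normr_measurable _ setT) (mg j))
     (fun x => normr_ge0 _) (integ_norm (Ig j))).
apply: integ_le I; last by move=> w; rewrite normrM normr_prod ger0_norm.
apply: measurable_funM; first exact: integ_measurable IPhi.
by apply: measurable_prod_fun => j; exact: meas_comp.
Qed.

(** The same induction for signed functions: the first [k] coordinates may change sign, and the next
    one is split into its positive and negative parts. *)
Let mean_prod_step k : (k <= m)%N -> forall g : 'I_m -> R -> R,
  (forall j, measurable_fun setT (g j)) ->
  (forall j, integ (fun w => g j (X j w))) ->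
  (forall j : 'I_m, (k <= j)%N -> forall x, 0 <= g j x) ->
  mean (fun w => Phi w * \prod_j g j (X j w)) =
  mean Phi * \prod_j mean (fun w => g j (X j w)).
Proof.
elim: k => [_ g mg Ig g0|k IH km g mg Ig g0].
  by have [] := @mean_prod_ge0 g (fun j => And3 (mg j) (g0 j isT) (Ig j)).
pose jk := Ordinal km.
pose gp : 'I_m -> R -> R := fun j => if j == jk then (g jk)^\+ else g j.
pose gn : 'I_m -> R -> R := fun j => if j == jk then (g jk)^\- else g j.
have gpk : gp jk = (g jk)^\+ by rewrite /gp eqxx.
have gnk : gn jk = (g jk)^\- by rewrite /gn eqxx.
have gpj j : j != jk -> gp j = g j by rewrite /gp => /negbTE ->.
have gnj j : j != jk -> gn j = g j by rewrite /gn => /negbTE ->.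
have mgp j : measurable_fun setT (gp j).
  have [->|jjk] := eqVneq j jk; last by rewrite gpj.
  by rewrite gpk; exact: measurable_funrpos.
have mgn j : measurable_fun setT (gn j).
  have [->|jjk] := eqVneq j jk; last by rewrite gnj.
  by rewrite gnk; exact: measurable_funrneg.
have Igp j : integ (fun w => gp j (X j w)).
  have [->|jjk] := eqVneq j jk; last by rewrite gpj.
  by rewrite gpk; exact: (integrable_funrpos measurableT (Ig jk)).
have Ign j : integ (fun w => gn j (X j w)).
  have [->|jjk] := eqVneq j jk; last by rewrite gnj.
  by rewrite gnk; exact: (integrable_funrneg measurableT (Ig jk)).
have ge0 (h : 'I_m -> R -> R) : (forall x, 0 <= h jk x) -> (forall j, j != jk -> h j = g j) ->
    forall j : 'I_m, (k <= j)%N -> forall x, 0 <= h j x.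
  move=> hk hg j; rewrite leq_eqVlt => /orP[/eqP kj|kj].
    by rewrite (_ : j = jk)//; exact: val_inj.
  rewrite hg; first exact: g0.
  by rewrite -val_eqE /= gtn_eqF.
have Hp := IH (ltnW km) gp mgp Igp (ge0 gp _ gpj).
have Hn := IH (ltnW km) gn mgn Ign (ge0 gn _ gnj).
have {Hp} := Hp (fun x => _); have {Hn} := Hn (fun x => _).
rewrite gpk gnk => /(_ (fun x => funrneg_ge0 _ x)) Hn /(_ (fun x => funrpos_ge0 _ x)) Hp.
have gE x : g jk x = gp jk x - gn jk x.
  by have /(congr1 (fun h => h x)) /= := funrposBneg (g jk); rewrite gpk gnk => <-.
have spl (h : 'I_m -> R -> R) w :
    \prod_j h j (X j w) = h jk (X jk w) * \prod_(j | j != jk) h j (X j w).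
  by rewrite (bigD1 jk).
have eqp w : \prod_(j | j != jk) gp j (X j w) = \prod_(j | j != jk) g j (X j w).
  by apply: eq_bigr => j jjk; rewrite gpj.
have eqn w : \prod_(j | j != jk) gn j (X j w) = \prod_(j | j != jk) g j (X j w).
  by apply: eq_bigr => j jjk; rewrite gnj.
transitivity (mean (fun w => Phi w * \prod_j gp j (X j w) - Phi w * \prod_j gn j (X j w))).
  apply: eq_mean => w.
  by rewrite (spl g) (spl gp) (spl gn) eqp eqn gE mulrBl mulrBr.
rewrite meanB; [|exact: integ_prod|exact: integ_prod].
have splM (h : 'I_m -> R -> R) : (forall j, j != jk -> h j = g j) ->
    \prod_j mean (fun w => h j (X j w)) =
    mean (fun w => h jk (X jk w)) * \prod_(j | j != jk) mean (fun w => g j (X j w)).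
  by move=> hg; rewrite (bigD1 jk)//; congr (_ * _); apply: eq_bigr => j /hg ->.
rewrite Hp Hn -mulrBr (splM g)// (splM gp gpj) (splM gn gnj) -mulrBl.
congr (_ * (_ * _)); rewrite -(meanB (Igp jk) (Ign jk)).
exact: eq_mean.
Qed.

Lemma mean_prod (g : 'I_m -> R -> R) :
  (forall j, measurable_fun setT (g j)) ->
  (forall j, integ (fun w => g j (X j w))) ->
  mean (fun w => Phi w * \prod_j g j (X j w)) =
  mean Phi * \prod_j mean (fun w => g j (X j w)).
Proof.
move=> mg Ig; apply: (mean_prod_step (leqnn m) mg Ig) => j mj.
by have := ltn_ord j; rewrite ltnNge mj.
Qed.

Hypothesis LX : forall j, L4 (X j).

Lemma mean_monomial (a : 'I_m -> nat) : (forall j, (a j <= 4)%N) ->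
  mean (fun w => Phi w * \prod_j X j w ^+ a j) =
  mean Phi * \prod_j mean (fun w => X j w ^+ a j).
Proof.
move=> a4; apply: (mean_prod (g := fun j x => x ^+ a j)) => j.
  exact: measurable_funX.
exact: L4_pow.
Qed.

End Independence.

Lemma prod_expr_delta {R : comRingType} m (F : 'I_m -> R) i :
  \prod_t F t ^+ (t == i)%N = F i.
Proof.
by rewrite (bigD1 i)//= eqxx expr1 big1 ?mulr1// => t /negbTE ->; rewrite expr0.
Qed.

(** * Quadratic forms in independent variables *)

Section WeightedCovariance.
Context d (T : measurableType d) (R : realType) (P : probability T R).
Local Notation mean := (mean P).
Local Notation integ := (integ P).
Variables (m : nat) (X : 'I_m -> T -> R) (Phi : T -> R).
Hypothesis LX : forall j, L4 P (X j).
Hypothesis Phi0 : forall w, 0 <= Phi w.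
Hypothesis IPhi : integ Phi.
Hypothesis wi : weighted_independence P X Phi.
Hypothesis X0 : forall j, mean (X j) = 0.

Let mX j : measurable_fun setT (X j) := L4_measurable (LX j).

Lemma mean_monomial_single (a : 'I_m -> nat) i : (forall j, (a j <= 4)%N) ->
  a i = 1%N -> mean (fun w => Phi w * \prod_j X j w ^+ a j) = 0.
Proof.
move=> a4 ai; rewrite (mean_monomial mX Phi0 IPhi wi LX a4) (bigD1 i)//= ai.
rewrite (_ : mean (fun w => X i w ^+ 1) = 0) ?mul0r ?mulr0//.
by rewrite -[RHS](X0 i); apply: eq_mean => w; rewrite expr1.
Qed.

Lemma mean_weighted_cov i j : i != j ->
  mean (fun w => Phi w * (X i w * X j w)) = 0.
Proof.
move=> ij.
rewrite -(@mean_monomial_single (fun t => (t == i) + (t == j))%N i).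
- apply: eq_mean => w; congr (_ * _).
  by under eq_bigr do rewrite exprD; rewrite big_split/= !prod_expr_delta.
- by move=> t; case: (t == i); case: (t == j).
- by rewrite eqxx (negbTE ij).
Qed.

Lemma mean_weighted_sq i :
  mean (fun w => Phi w * X i w ^+ 2) = mean Phi * mean (fun w => X i w ^+ 2).
Proof.
have := @mean_monomial _ _ _ _ _ _ _ mX Phi0 IPhi wi LX (fun t => 2 * (t == i))%N.
rewrite [in RHS](bigD1 i)//= eqxx muln1 [in RHS]big1; last first.
  move=> t /negbTE ->; rewrite muln0.
  by under eq_mean do rewrite expr0; rewrite mean_cst.
rewrite mulr1 => <-; last by move=> t; case: (t == i).
apply: eq_mean => w; congr (_ * _).
by under eq_bigr do rewrite mulnC exprM; rewrite prodrXl prod_expr_delta.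
Qed.

End WeightedCovariance.

Section QuadraticForm.
Context d (T : measurableType d) (R : realType) (P : probability T R).
Local Notation mean := (mean P).
Local Notation integ := (integ P).
Variables (m : nat) (X : 'I_m -> T -> R).
Hypothesis LX : forall j, L4 P (X j).
Hypothesis wi : weighted_independence P X (fun=> 1).
Hypothesis X0 : forall j, mean (X j) = 0.

Let mX j : measurable_fun setT (X j) := L4_measurable (LX j).
Let one0 (w : T) : 0 <= 1 :> R. Proof. exact: ler01. Qed.
Let I1 : integ (fun=> 1). Proof. exact: integ_cst. Qed.

Local Notation s j := (mean (fun w => X j w ^+ 2)).

Lemma mean_cov i j : mean (fun w => X i w * X j w) = (i == j)%:R * s i.
Proof.
have [<-|ij] := eqVneq i j.
  by rewrite mul1r; apply: eq_mean => w; rewrite expr2.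
rewrite mul0r -(mean_weighted_cov LX one0 I1 wi X0 ij).
by apply: eq_mean => w; rewrite mul1r.
Qed.

Lemma mean_lincomb_sq (b : 'I_m -> R) :
  mean (fun w => (\sum_j b j * X j w) ^+ 2) = \sum_j b j ^+ 2 * s j.
Proof.
transitivity (mean (fun w => \sum_i \sum_j b i * b j * (X i w * X j w))).
  apply: eq_mean => w; rewrite expr2 big_distrlr /=.
  by apply: eq_bigr => i _; apply: eq_bigr => j _; ring.
have I i j : integ (fun w => b i * b j * (X i w * X j w)).
  exact/integZ/L4_prod2.
rewrite mean_sum; last by move=> i _; exact: integ_sum.
apply: eq_bigr => i _; rewrite mean_sum//.
rewrite (bigD1 i)//= big1 ?addr0; last first.
  move=> j ji; rewrite meanZ; last exact: L4_prod2.
  by rewrite mean_cov eq_sym (negbTE ji) mul0r mulr0.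
rewrite meanZ; last exact: L4_prod2.
by rewrite mean_cov eqxx mul1r expr2.
Qed.

Let prod4 i j k l w : X i w * X j w * X k w * X l w =
  1 * \prod_t X t w ^+ ((t == i) + (t == j) + (t == k) + (t == l))%N.
Proof.
rewrite mul1r; under eq_bigr do rewrite !exprD.
by rewrite !big_split/= !prod_expr_delta.
Qed.

Let count4 i j k l (t : 'I_m) : ((t == i) + (t == j) + (t == k) + (t == l) <= 4)%N.
Proof. by case: (t == i); case: (t == j); case: (t == k); case: (t == l). Qed.

Let mean4_single i j k l (t : 'I_m) :
  ((t == i) + (t == j) + (t == k) + (t == l) = 1)%N ->
  mean (fun w => X i w * X j w * X k w * X l w) = 0.
Proof.
move=> h; rewrite -(mean_monomial_single LX one0 I1 wi X0 (count4 i j k l) h).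
exact/eq_mean/prod4.
Qed.

Let mean4_pair i k : i != k ->
  mean (fun w => X i w ^+ 2 * X k w ^+ 2) = s i * s k.
Proof.
move=> ik; transitivity (mean (fun w => 1 * \prod_t X t w ^+ (2 * (t == i) + 2 * (t == k))%N)).
  apply: eq_mean => w; rewrite mul1r; under eq_bigr do rewrite exprD.
  rewrite big_split/=; under eq_bigr do rewrite mulnC exprM.
  under [X in _ = _ * X]eq_bigr do rewrite mulnC exprM.
  by rewrite !prodrXl !prod_expr_delta.
rewrite (mean_monomial mX one0 I1 wi LX); last first.
  by move=> t; have [->|] := eqVneq t i; [rewrite (negbTE ik)|case: (t == k)].
rewrite mean_cst mul1r (bigD1 i)//= eqxx (negbTE ik) (bigD1 k)/=; last by rewrite eq_sym.
rewrite eqxx eq_sym (negbTE ik) big1 ?mulr1//.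
by move=> t /andP[/negbTE -> /negbTE ->]; under eq_mean do rewrite expr0; rewrite mean_cst.
Qed.

Variables (v : 'I_m -> R) (kappa : R).
Hypothesis v0 : forall j, 0 <= v j.
Hypothesis sv : forall j, s j <= v j.
Hypothesis k1 : 1 <= kappa.
Hypothesis qv : forall j, mean (fun w => X j w ^+ 4) <= kappa * v j ^+ 2.

Let s0 j : 0 <= s j. Proof. by apply: mean_ge0 => w; exact: sqr_ge0. Qed.

(** An index that occurs once makes the moment vanish, so only pairings remain. The pairing of [i]
    with [j] and [k] with [l] is the subtracted product of variances; the two other pairings are on
    the right, and [kappa] covers the case of four equal indices. *)
Let mean4_bound i j k l :
  `|mean (fun w => X i w * X j w * X k w * X l w)
    - (i == j)%:R * s i * ((k == l)%:R * s k)| <=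
  kappa * (((i == k) && (j == l))%:R + ((i == l) && (j == k))%:R) * (v i * v j).
Proof.
have rhs0 : 0 <= kappa * (((i == k) && (j == l))%:R + ((i == l) && (j == k))%:R) * (v i * v j).
  by rewrite !mulr_ge0// ?addr_ge0// (le_trans _ k1).
have ssvv a b : s a * s b <= v a * v b by rewrite ler_pM.
have single t : ((t == i) + (t == j) + (t == k) + (t == l) = 1)%N ->
    (i == j)%:R * s i * ((k == l)%:R * s k) = 0 ->
    `|mean (fun w => X i w * X j w * X k w * X l w)
    - (i == j)%:R * s i * ((k == l)%:R * s k)| <=
    kappa * (((i == k) && (j == l))%:R + ((i == l) && (j == k))%:R) * (v i * v j).
  by move=> /mean4_single -> ->; rewrite subr0 normr0.
have [ij|/eqP ij] := pselect (i = j).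
  subst j; have [kl|/eqP kl] := pselect (k = l).
    subst l; have [ik|/eqP ik] := pselect (i = k).
      subst k; rewrite !eqxx !mul1r (_ : mean _ = mean (fun w => X i w ^+ 4)).
        have := qv i; have q0 : 0 <= mean (fun w => X i w ^+ 4).
          by apply: mean_ge0 => w; exact: pow4_ge0.
        have ss0 : 0 <= s i * s i by rewrite mulr_ge0.
        have vv0 : 0 <= v i * v i by rewrite mulr_ge0.
        have := ssvv i i; rewrite expr2 /=.
        move: (s i * s i) (v i * v i) ss0 vv0 => S V S0 V0 SV qV.
        have : V <= kappa * V by rewrite ler_peMl.
        by rewrite ler_norml => ?; apply/andP; split; lra.
      by apply: eq_mean => w; ring.
    rewrite !eqxx !mul1r (_ : mean _ = mean (fun w => X i w ^+ 2 * X k w ^+ 2)).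
      by rewrite mean4_pair// subrr normr0 (negbTE ik) /= addr0 mulr0 mul0r.
    by apply: eq_mean => w; ring.
  have [ki|/eqP ki] := pselect (k = i).
    subst k; apply: (single l); last by rewrite (negbTE kl) mul0r mulr0.
    by rewrite [l == i]eq_sym (negbTE kl) eqxx.
  apply: (single k); last by rewrite (negbTE kl) mul0r mulr0.
  by rewrite (negbTE ki) (negbTE kl) eqxx.
have e0 : (i == j)%:R * s i * ((k == l)%:R * s k) = 0 by rewrite (negbTE ij) !mul0r.
have ji : (j == i) = false by rewrite eq_sym (negbTE ij).
have [ik|/eqP ik] := pselect (i = k).
  subst k; have [jl|/eqP jl] := pselect (j = l).
    subst l; rewrite e0 subr0 (_ : mean _ = mean (fun w => X i w ^+ 2 * X j w ^+ 2)).
      rewrite mean4_pair// ger0_norm ?mulr_ge0//.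
      apply: (le_trans (ssvv _ _)); rewrite ler_peMl ?mulr_ge0//.
      by rewrite !eqxx (negbTE ij) /= addr0 mulr1.
    by apply: eq_mean => w; ring.
  by apply: (single j) => //; rewrite eqxx ji (negbTE jl).
have [il|/eqP il] := pselect (i = l).
  subst l; have [jk|/eqP jk] := pselect (j = k).
    subst k; rewrite e0 subr0 (_ : mean _ = mean (fun w => X i w ^+ 2 * X j w ^+ 2)).
      rewrite mean4_pair// ger0_norm ?mulr_ge0//.
      apply: (le_trans (ssvv _ _)); rewrite ler_peMl ?mulr_ge0//.
      by rewrite !eqxx (negbTE ij) /= add0r mulr1.
    by apply: eq_mean => w; ring.
  by apply: (single j) => //; rewrite eqxx ji (negbTE jk).
by apply: (single i) => //; rewrite eqxx (negbTE ij) (negbTE ik) (negbTE il).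
Qed.

Lemma integ_quad_form_sq (B : 'I_m -> 'I_m -> R) (c : R) :
  integ (fun w => (\sum_i \sum_j B i j * (X i w * X j w) - c) ^+ 2).
Proof.
have I2 i j : integ (fun w => B i j * (X i w * X j w)) by exact/integZ/L4_prod2.
have IQ : integ (fun w => \sum_i \sum_j B i j * (X i w * X j w)).
  by apply: integ_sum => i _; exact: integ_sum.
apply: (@eq_integ _ _ _ _ (fun w =>
  (\sum_i \sum_j \sum_k \sum_l B i j * B k l * (X i w * X j w * X k w * X l w))
  - 2 * c * (\sum_i \sum_j B i j * (X i w * X j w)) + c ^+ 2)).
  move=> w.
  have -> : \sum_i \sum_j \sum_k \sum_l B i j * B k l * (X i w * X j w * X k w * X l w)
      = (\sum_i \sum_j B i j * (X i w * X j w)) ^+ 2.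
    rewrite expr2 mulr_suml; apply: eq_bigr => i _.
    rewrite mulr_suml; apply: eq_bigr => j _.
    rewrite mulr_sumr; apply: eq_bigr => k _.
    by rewrite mulr_sumr; apply: eq_bigr => l _; ring.
  by ring.
apply: integD; last exact: integ_cst.
apply: integB; last exact: integZ.
by do 4 (apply: integ_sum => ? _); apply/integZ/L4_prod4.
Qed.

(** The centred form is the sum of [B i j * zeta i j], and [mean4_bound] bounds the covariances of
    the [zeta]. The two pairings produce [B i j * B i j] and [B i j * B j i], whence the symmetry
    and the factor 2. Bounds [v] in place of the variances admit Gaussian variables with crude
    moment bounds. *)
Lemma quad_form_variance (B : 'I_m -> 'I_m -> R) : (forall i j, B i j = B j i) ->
  mean (fun w => (\sum_i \sum_j B i j * (X i w * X j w) - \sum_i B i i * s i) ^+ 2) <=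
  2 * kappa * \sum_i \sum_j B i j ^+ 2 * (v i * v j).
Proof.
move=> Bsym.
pose zeta i j w := X i w * X j w - (i == j)%:R * s i.
have Iz i j k l : integ (fun w => zeta i j w * zeta k l w).
  apply: (@eq_integ _ _ _ _ (fun w => X i w * X j w * X k w * X l w
    - ((k == l)%:R * s k) * (X i w * X j w) - ((i == j)%:R * s i) * (X k w * X l w)
    + (i == j)%:R * s i * ((k == l)%:R * s k))).
    by move=> w; rewrite /zeta; ring.
  apply: integD; last exact: integ_cst.
  apply: integB; last exact/integZ/L4_prod2.
  by apply: integB; [exact: L4_prod4|exact/integZ/L4_prod2].
have Mz i j k l : mean (fun w => zeta i j w * zeta k l w) =
    mean (fun w => X i w * X j w * X k w * X l w)
    - (i == j)%:R * s i * ((k == l)%:R * s k).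
  transitivity (mean (fun w => X i w * X j w * X k w * X l w
    - ((k == l)%:R * s k) * (X i w * X j w) - ((i == j)%:R * s i) * (X k w * X l w)
    + (i == j)%:R * s i * ((k == l)%:R * s k))).
    by apply: eq_mean => w; rewrite /zeta; ring.
  have Ia := L4_prod4 (LX i) (LX j) (LX k) (LX l).
  have Ib := integZ ((k == l)%:R * s k) (L4_prod2 (LX i) (LX j)).
  have Ic := integZ ((i == j)%:R * s i) (L4_prod2 (LX k) (LX l)).
  rewrite meanD; [|exact: integB (integB Ia Ib) Ic|exact: integ_cst].
  rewrite (meanB (integB Ia Ib) Ic) (meanB Ia Ib) mean_cst.
  rewrite (meanZ _ (L4_prod2 (LX i) (LX j))) (meanZ _ (L4_prod2 (LX k) (LX l))).
  have A (x y z : R) : x - y * z - z * y + z * y = x - z * y by ring.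
  by rewrite (mean_cov i j) (mean_cov k l); exact: A.
pose Q w := \sum_i \sum_j B i j * (X i w * X j w) - \sum_i B i i * s i.
pose mz i j k l : R := mean (fun w => zeta i j w * zeta k l w).
have E : mean (fun w => Q w ^+ 2) = \sum_i \sum_j \sum_k \sum_l B i j * B k l * mz i j k l.
  transitivity (mean (fun w => \sum_i \sum_j \sum_k \sum_l
      B i j * B k l * (zeta i j w * zeta k l w))).
    apply: eq_mean => w.
    have -> : Q w = \sum_i \sum_j B i j * zeta i j w.
      rewrite /Q -sumrB; apply: eq_bigr => i _.
      under [RHS]eq_bigr do rewrite /zeta mulrBr.
      rewrite sumrB; congr (_ - _).
      rewrite (bigD1 i)//= eqxx mul1r big1 ?addr0// => j ji.
      by rewrite eq_sym (negbTE ji) mul0r mulr0.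
    rewrite expr2 mulr_suml; apply: eq_bigr => i _.
    rewrite mulr_suml; apply: eq_bigr => j _.
    rewrite mulr_sumr; apply: eq_bigr => k _.
    by rewrite mulr_sumr; apply: eq_bigr => l _; ring.
  rewrite mean_sum => [|i _]; last by do 3 (apply: integ_sum => ? _); exact: integZ.
  apply: eq_bigr => i _; rewrite mean_sum => [|j _]; last first.
    by do 2 (apply: integ_sum => ? _); exact: integZ.
  apply: eq_bigr => j _; rewrite mean_sum => [|k _]; last first.
    by apply: integ_sum => ? _; exact: integZ.
  apply: eq_bigr => k _; rewrite mean_sum => [|l _]; last exact: integZ.
  by apply: eq_bigr => l _; rewrite meanZ.
rewrite -[leLHS]/(mean (fun w => Q w ^+ 2)).
rewrite E mulr_sumr; apply: ler_sum => i _; rewrite mulr_sumr; apply: ler_sum => j _.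
apply: (@le_trans _ _ (\sum_k \sum_l `|B i j| * `|B k l| *
   (kappa * (((i == k) && (j == l))%:R + ((i == l) && (j == k))%:R) * (v i * v j)))).
  apply: ler_sum => k _; apply: ler_sum => l _.
  apply: le_trans (ler_norm _) _; rewrite !normrM /mz Mz ler_wpM2l ?mulr_ge0//.
have D (a b : 'I_m) (F : 'I_m -> 'I_m -> R) :
    \sum_k \sum_l F k l * ((a == k) && (b == l))%:R = F a b.
  rewrite (bigD1 a)//= eqxx [X in _ + X]big1 ?addr0; last first.
    by move=> k ka; rewrite big1// => l _; rewrite eq_sym (negbTE ka) mulr0.
  rewrite (bigD1 b)//= eqxx [X in _ + X]big1 ?addr0 ?mulr1// => l lb.
  by rewrite eq_sym (negbTE lb) mulr0.
pose F k l := `|B i j| * `|B k l| * (kappa * (v i * v j)).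
have -> : \sum_k \sum_l `|B i j| * `|B k l| *
   (kappa * (((i == k) && (j == l))%:R + ((i == l) && (j == k))%:R) * (v i * v j)) =
   \sum_k \sum_l F k l * ((i == k) && (j == l))%:R +
   \sum_k \sum_l F k l * ((j == k) && (i == l))%:R.
  rewrite -big_split; apply: eq_bigr => k _; rewrite -big_split; apply: eq_bigr => l _.
  rewrite /= /F [in RHS](andbC (j == k)). ring.
rewrite !D /F [B j i]Bsym -normrM -expr2 ger0_norm ?sqr_ge0//.
by rewrite le_eqVlt; apply/orP; left; apply/eqP; ring.
Qed.

(** The square of the combination is the quadratic form with matrix [b i * b j]; its fourth power is
    at most twice the squared deviation from the mean [M] plus [2 * M ^ 2], which gives
    [2 * (2 * kappa) + 2]. *)
Lemma lincomb_pow4 (b : 'I_m -> R) :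
  mean (fun w => (\sum_j b j * X j w) ^+ 4) <=
  (4 * kappa + 2) * (\sum_j b j ^+ 2 * v j) ^+ 2.
Proof.
pose Z w := \sum_j b j * X j w.
have LZ : L4 P Z by apply: L4_sum => j _; exact: L4Z.
have ZE w : Z w ^+ 2 = \sum_i \sum_j b i * b j * (X i w * X j w).
  rewrite expr2 big_distrlr /=.
  by apply: eq_bigr => i _; apply: eq_bigr => j _; ring.
pose M := \sum_i b i * b i * s i.
have := @quad_form_variance (fun i j => b i * b j) (fun i j => mulrC _ _).
rewrite -/M => HV.
have HV' : mean (fun w => (Z w ^+ 2 - M) ^+ 2) <= 2 * kappa * (\sum_j b j ^+ 2 * v j) ^+ 2.
  rewrite (_ : (fun w => _) = (fun w => (\sum_i \sum_j b i * b j * (X i w * X j w) - M) ^+ 2)).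
    apply: le_trans HV _; rewrite ler_wpM2l ?mulr_ge0//; first exact: le_trans k1.
    rewrite expr2 big_distrlr /=; apply: ler_sum => i _; apply: ler_sum => j _.
    by rewrite le_eqVlt; apply/orP; left; apply/eqP; ring.
  by apply/funext => w; rewrite ZE.
have M0 : 0 <= M.
  by apply: sumr_ge0 => i _; rewrite -expr2 mulr_ge0// sqr_ge0.
have MV : M <= \sum_j b j ^+ 2 * v j.
  by apply: ler_sum => i _; rewrite -expr2 ler_wpM2l// sqr_ge0.
have I2 : integ (fun w => (Z w ^+ 2 - M) ^+ 2).
  apply: eq_integ (integ_quad_form_sq (fun i j => b i * b j) M) => w.
  by rewrite ZE.
apply: (@le_trans _ _ (mean (fun w => 2 * (Z w ^+ 2 - M) ^+ 2 + 2 * M ^+ 2))).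
  apply: le_mean; first by case: LZ.
    by apply: integD; [exact: integZ|exact: integ_cst].
  move=> w; rewrite -/(Z w) -[4%N]/(2 * 2)%N exprM.
  by have := sqr_ge0 (Z w ^+ 2 - 2 * M); nra.
rewrite meanD; [|exact: integZ|exact: integ_cst].
rewrite meanZ// mean_cst.
have : M ^+ 2 <= (\sum_j b j ^+ 2 * v j) ^+ 2.
  by rewrite ler_sqr ?nnegrE//; exact: le_trans MV.
by move: HV'; lra.
Qed.

End QuadraticForm.

(** * Independence of signal and noise, and its stability under L^2 limits *)

Lemma prod_indic_preimage {T : Type} {R : realType} m (X : 'I_m -> T -> R)
    (B : 'I_m -> set R) w :
  \prod_j \1_(B j) (X j w) =
  \1_(\bigcap_(j in [set: 'I_m]) (X j @^-1` B j)) w :> R.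
Proof.
rewrite [RHS]indicE; case: (boolP (w \in _)) => [|].
  rewrite inE => h; rewrite big1// => j _.
  by rewrite indicE mem_set//; exact: h.
rewrite notin_setE => h.
have [j hj] : exists j, ~ B j (X j w).
  by apply: contrapT => H; apply: h => j _; apply: contrapT => hj; apply: H; exists j.
by rewrite (bigD1 j)//= indicE memNset// mul0r.
Qed.

Section IndependenceInterface.
Context d (T : measurableType d) (R : realType) (P : probability T R).
Local Notation mean := (mean P).
Local Notation integ := (integ P).
Local Notation L4 := (L4 P).

Lemma integ_indic (A : set T) : measurable A -> integ \1_A.
Proof. by move=> mA; exact: integrable_indic. Qed.

Lemma mean_indic (A : set T) : measurable A -> (P A = (mean \1_A)%:E)%E.
Proof.
move=> mA; rewrite -integ_mean; last exact: integ_indic.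
by rewrite integral_indic// setIT.
Qed.

Section Family.
Variables (m : nat) (X : 'I_m -> T -> R).
Hypothesis mX : forall j, measurable_fun setT (X j).

Let mpre j (B : set R) : measurable B -> measurable (X j @^-1` B).
Proof. by move=> mB; rewrite -[X in measurable X]setTI; exact: mX. Qed.

Let mcap (B : 'I_m -> set R) : (forall j, measurable (B j)) ->
  measurable (\bigcap_(j in [set: 'I_m]) (X j @^-1` B j)).
Proof.
by move=> mB; apply: fin_bigcap_measurable => // j _; exact: mpre.
Qed.

Lemma mutually_independent_weighted : mutually_independent P X ->
  weighted_independence P X (fun=> 1).
Proof.
move=> H B mB; rewrite mean_cst mul1r.
under eq_mean do rewrite mul1r prod_indic_preimage.
have := H B mB; rewrite mean_indic; last exact: mcap.
have -> : (\prod_(j < m) P (X j @^-1` B j) =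
   (\prod_j mean (fun w => \1_(B j) (X j w)))%:E)%E.
  rewrite -prodEFin; apply: eq_bigr => j _.
  by rewrite mean_indic//; exact: mpre.
by case=> ->.
Qed.

(* Only V ^+ 2 is tested: this is all that the cross term needs, and it passes to
   the L^2 limits of step integrals that define the Wiener integral. *)
Definition sq_indep (V : T -> R) : Prop := forall B : 'I_m -> set R,
  (forall j, measurable (B j)) ->
  mean (fun w => V w ^+ 2 * \prod_j \1_(B j) (X j w)) =
  mean (fun w => V w ^+ 2) * mean (fun w => \prod_j \1_(B j) (X j w)).

Lemma sq_indep_weighted V : mutually_independent P X -> sq_indep V ->
  weighted_independence P X (fun w => V w ^+ 2).
Proof.
move=> /mutually_independent_weighted wi VX B mB; rewrite VX//; congr (_ * _).
have := wi B mB; rewrite mean_cst mul1r => <-.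
by apply: eq_mean => w; rewrite mul1r.
Qed.

(** With the indicator of the event [E] of [X] as weight, independence of the two systems says that
    the weighted law of [V] is a multiple of its law; the square is then integrated against both. *)
Lemma indep_systems_sq_indep (F G : set (set T)) (V : T -> R) :
  measurable_fun setT V ->
  independent_systems P F G ->
  (forall B, measurable B -> F (V @^-1` B)) ->
  (forall B : 'I_m -> set R, (forall j, measurable (B j)) ->
    G (\bigcap_(j in [set: 'I_m]) (X j @^-1` B j))) ->
  sq_indep V.
Proof.
move=> mV FG FV GX B mB.
set E := \bigcap_(j in [set: 'I_m]) (X j @^-1` B j).
have mE : measurable E by exact: mcap.
under eq_mean do rewrite prod_indic_preimage -/E.
under [X in _ = _ * X]eq_mean do rewrite prod_indic_preimage -/E.
pose Vm := isMeasurableFun.Build _ _ _ _ _ mV.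
pose Vk : {mfun T >-> R} := HB.pack V Vm.
have H (C : set R) : measurable C ->
    (\int[P]_x (\1_E x * \1_C (V x))%:E = (mean \1_E)%:E * distribution P Vk C)%E.
  move=> mC; have mVC : measurable (V @^-1` C).
    by rewrite -[X in measurable X]setTI; exact: (mV).
  rewrite -mean_indic// muleC -[distribution _ _ _]/(P (V @^-1` C)).
  rewrite -FG//; [|exact: FV|exact: GX].
  have mVE : measurable (V @^-1` C `&` E) by exact: measurableI.
  rewrite mean_indic// -integ_mean; last exact: integ_indic.
  by apply: eq_integral => x _; rewrite indicI mulrC.
have mE1 : measurable_fun setT (\1_E : T -> R) by exact: measurable_indic.
have E0 x : 0 <= \1_E x :> R by [].
have ME0 : 0 <= mean \1_E by exact: mean_ge0.
have msq : measurable_fun setT (fun x : R => x ^+ 2) by exact: measurable_funX.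
have := ge0_integral_weighted_transfer mV mE1 E0 ME0 H msq (fun x => sqr_ge0 x).
rewrite ge0_integral_distribution; [|exact/measurable_EFinP|by move=> y; rewrite lee_fin sqr_ge0].
move=> Q; rewrite [RHS]mulrC.
have [I|NI] := pselect (integ (fun w => V w ^+ 2)).
  have : (\int[P]_x (\1_E x * V x ^+ 2)%:E = (mean \1_E * mean (fun w => V w ^+ 2))%:E)%E.
    by rewrite Q EFinM -(integ_mean I).
  rewrite integ_mean; first by case=> <-; apply: eq_mean => w; rewrite mulrC.
  apply: (@integ_le _ _ _ _ _ (fun w => V w ^+ 2)) => //.
    by apply: measurable_funM => //; exact: measurable_funX.
  move=> w; rewrite normrM (ger0_norm (sqr_ge0 _)) ler_piMl ?sqr_ge0//.
  by rewrite indicE; case: (_ \in _); rewrite /= ?normr0 ?normr1.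
(* Without integrability both sides are 0: the integral on the left is 0 or infinite according to
   whether [E] is null, and [mean] sends either value to 0. *)
have Ioo : (\int[P]_x (V x ^+ 2)%:E = +oo)%E.
  apply/eqP; rewrite -leye_eq leNgt; apply/negP => h; apply: NI.
  apply: integ_lty => //; [exact: measurable_funX|by move=> w; exact: sqr_ge0].
have -> : mean (fun w => V w ^+ 2) = 0 by rewrite unlock /Rintegral Ioo.
rewrite mulr0; have [e0|e0] := eqVneq (mean \1_E) 0.
  rewrite unlock /Rintegral; under eq_integral do rewrite mulrC.
  by rewrite Q e0 mul0e.
rewrite unlock /Rintegral; under eq_integral do rewrite mulrC.
rewrite Q -[X in fine (_ * X)]/(\int[P]_x (V x ^+ 2)%:E)%E Ioo.
by rewrite gt0_muley// lte_fin lt0r e0.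
Qed.

Let h01 (B : 'I_m -> set R) w : 0 <= (\prod_j \1_(B j) (X j w) : R) <= 1.
Proof.
rewrite prod_indic_preimage indicE; case: (_ \in _); rewrite /= ?lexx ?ler01//.
Qed.

Let mh (B : 'I_m -> set R) : (forall j, measurable (B j)) ->
  measurable_fun setT (fun w => \prod_j \1_(B j) (X j w) : R).
Proof.
move=> mB; under eq_fun do rewrite prod_indic_preimage.
exact/measurable_indic/mcap.
Qed.

Lemma sq_diff_le (del x y : R) : 0 < del ->
  `|x ^+ 2 - y ^+ 2| <= (1 + del^-1) * (x - y) ^+ 2 + del * x ^+ 2.
Proof.
move=> d0; have di0 : 0 < del^-1 by rewrite invr_gt0.
have H e : e ^+ 2 = 1 -> 2 * (e * x * (x - y)) <= del * x ^+ 2 + del^-1 * (x - y) ^+ 2.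
  move=> e1.
  have : 0 <= del^-1 * (e * del * x - (x - y)) ^+ 2 by rewrite mulr_ge0 ?sqr_ge0// ltW.
  rewrite (_ : del^-1 * _ = del * (e ^+ 2 * x ^+ 2) - 2 * (e * x * (x - y))
     + del^-1 * (x - y) ^+ 2).
    by rewrite e1; lra.
  by field; rewrite gt_eqF.
have := H 1 (expr1n _ _); have := H (-1) (sqrr_sign _ 1).
have := sqr_ge0 (x - y); rewrite ler_norml => ? ? ?; apply/andP; split; nra.
Qed.

(** Both sides of the product rule are continuous in [V] for the L^2 distance, because the test
    function lies between 0 and 1 and [sq_diff_le] bounds the L^1 distance of the squares. *)
Lemma sq_indep_limit (V : T -> R) (Vn : nat -> T -> R) :
  measurable_fun setT V ->
  integ (fun w => V w ^+ 2) ->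
  (forall n, integ (fun w => Vn n w ^+ 2)) ->
  (forall n, measurable_fun setT (Vn n)) ->
  (forall e, 0 < e -> exists n, integ (fun w => (V w - Vn n w) ^+ 2) /\
     mean (fun w => (V w - Vn n w) ^+ 2) <= e) ->
  (forall n, sq_indep (Vn n)) -> sq_indep V.
Proof.
move=> mV IV IVn mVn cvgV iVn B mB.
set h := fun w => \prod_j \1_(B j) (X j w) : R.
have Ih (f : T -> R) : integ f -> integ (fun w => f w * h w).
  move=> If; apply: (integ_le _ _ (integ_norm If)).
    by apply: measurable_funM; [exact: integ_measurable If|exact: mh].
  move=> w; have /andP[h0 h1] := h01 B w.
  by rewrite normrM (ger0_norm h0) ler_piMr.
have Iq : integ h.
  apply: (@integ_le _ _ _ _ _ (fun=> 1)); [exact: mh| |exact: integ_cst].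
  by move=> w; have /andP[h0 h1] := h01 B w; rewrite ger0_norm.
set b := mean (fun w => V w ^+ 2).
have b0 : 0 <= b by apply: mean_ge0 => w; exact: sqr_ge0.
set q := mean h.
have q01 : 0 <= q <= 1.
  apply/andP; split; first by apply: mean_ge0 => w; have /andP[] := h01 B w.
  rewrite -[leRHS](mean_cst P 1); apply: le_mean => //; first exact: integ_cst.
  by move=> w; have /andP[] := h01 B w.
set a := mean (fun w => V w ^+ 2 * h w).
have key del : 0 < del -> `|a - b * q| <= 2 * (del * b + del).
  move=> d0.
  (* With this tolerance the first term of [sq_diff_le] contributes at most [del]. *)
  have c0 : 0 < del / (1 + del^-1) by rewrite divr_gt0// addr_gt0// invr_gt0.
  have [n [In en]] := cvgV _ c0.
  have IVV : integ (fun w => V w ^+ 2 - Vn n w ^+ 2) by exact: integB.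
  have bd : mean (fun w => `|V w ^+ 2 - Vn n w ^+ 2|) <= del * b + del.
    apply: (@le_trans _ _ (mean (fun w => (1 + del^-1) * (V w - Vn n w) ^+ 2 + del * V w ^+ 2))).
      apply: le_mean; first exact: integ_norm.
        by apply: integD; exact: integZ.
      by move=> w; exact: sq_diff_le.
    rewrite meanD; [|exact: integZ|exact: integZ].
    rewrite !meanZ// -/b addrC lerD2l.
    by rewrite mulrC -ler_pdivlMr// addr_gt0// invr_gt0.
  have nm (f : T -> R) : integ f -> `|mean f| <= mean (fun w => `|f w|).
    by move=> If; rewrite unlock; exact: le_normr_Rintegral.
  have A1 : `|a - mean (fun w => Vn n w ^+ 2 * h w)| <= del * b + del.
    rewrite /a -meanB; [|exact: Ih|exact: Ih].
    apply: le_trans (nm _ _) _; first by apply: integB; exact: Ih.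
    apply: le_trans bd; apply: le_mean; [|exact: integ_norm|].
      by apply: integ_norm; apply: integB; exact: Ih.
    move=> w; rewrite -mulrBl normrM ler_piMr//.
    by have /andP[h0 h1] := h01 B w; rewrite ger0_norm.
  have A2 : `|b - mean (fun w => Vn n w ^+ 2)| <= del * b + del.
    by rewrite /b -meanB//; apply: le_trans (nm _ _) _.
  have A3 : `|(b - mean (fun w => Vn n w ^+ 2)) * q| <= del * b + del.
    rewrite normrM; apply: le_trans A2; have /andP[q0 q1] := q01.
    by rewrite (ger0_norm q0) ler_piMr.
  have E := iVn n B mB; rewrite -/h -/q in E.
  have -> : a - b * q = (a - mean (fun w => Vn n w ^+ 2 * h w))
      - (b - mean (fun w => Vn n w ^+ 2)) * q by rewrite E; ring.
  by apply: le_trans (ler_normB _ _) _; lra.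
apply/eqP; rewrite -subr_eq0 -normr_le0 -/h -/a -/b -/q.
apply/ler_addgt0Pr => e e0; rewrite add0r.
have bb : 0 < 2 * (b + 1) by rewrite mulr_gt0// ltr_wpDl.
apply: le_trans (key (e / (2 * (b + 1))) _) _; first by rewrite divr_gt0.
by rewrite le_eqVlt; apply/orP; left; apply/eqP; field; rewrite gt_eqF// ltr_wpDl.
Qed.

(** Independence is available for squares only. The diagonal terms use it for [V c] itself, written
    with [a = 0]; for [c != e] polarization writes [V c * V e] through the squares of [V c + V e]
    and [V c - V e], and under each of these weights [X c] and [X e] are uncorrelated. *)
Lemma cross_term_sq (V : 'I_m -> T -> R) :
  (forall j, L4 (X j)) -> (forall j, L4 (V j)) ->
  (forall j, mean (X j) = 0) -> (forall j, mean (fun w => X j w ^+ 2) = 1) ->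
  mutually_independent P X ->
  (forall c e (a : R), sq_indep (fun w => V c w + a * V e w)) ->
  mean (fun w => (\sum_c V c w * X c w) ^+ 2) = \sum_c mean (fun w => V c w ^+ 2).
Proof.
move=> LX LV X0 X1 iX iV.
have I4 c e : integ (fun w => V c w * X c w * (V e w * X e w)).
  by apply: eq_integ (L4_prod4 (LV c) (LX c) (LV e) (LX e)) => w; ring.
transitivity (mean (fun w => \sum_c \sum_e V c w * X c w * (V e w * X e w))).
  by apply: eq_mean => w; rewrite expr2 big_distrlr.
rewrite mean_sum; last by move=> c _; exact: integ_sum.
apply: eq_bigr => c _; rewrite mean_sum//.
have LVa e (a : R) : L4 (fun w => V c w + a * V e w) by apply: L4D => //; exact: L4Z.
have wi e a := sq_indep_weighted iX (iV c e a).
have sq0 e a w : 0 <= (V c w + a * V e w) ^+ 2 by exact: sqr_ge0.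
rewrite (bigD1 c)//= big1 ?addr0.
  have W := mean_weighted_sq LX (sq0 c 0) (L4_sq (LVa c 0)) (wi c 0) c.
  rewrite X1 mulr1 in W.
  transitivity (mean (fun w => (V c w + 0 * V c w) ^+ 2 * X c w ^+ 2)).
    by apply: eq_mean => w; ring.
  by rewrite W; apply: eq_mean => w; ring.
move=> e ec; have ce : c != e by rewrite eq_sym.
have Wp := mean_weighted_cov LX (sq0 e 1) (L4_sq (LVa e 1)) (wi e 1) X0 ce.
have Wm := mean_weighted_cov LX (sq0 e (-1)) (L4_sq (LVa e (-1))) (wi e (-1)) X0 ce.
have Ip a : integ (fun w => (V c w + a * V e w) ^+ 2 * (X c w * X e w)).
  apply: eq_integ (L4_prod4 (LVa e a) (LVa e a) (LX c) (LX e)) => w; ring.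
transitivity (mean (fun w => 4^-1 * ((V c w + 1 * V e w) ^+ 2 * (X c w * X e w)
  - (V c w + (-1) * V e w) ^+ 2 * (X c w * X e w)))).
  by apply: eq_mean => w; field.
rewrite meanZ; last exact: integB.
by rewrite meanB// Wp Wm subrr mulr0.
Qed.

End Family.

(** A Fatou argument that needs no almost sure convergence. The truncation [g M] of [V ^ 2] is
    bounded, so [g M ^ 2] is at most [Vn ^ 4] plus [2 * M] times an error controlled in L^2;
    monotone convergence in [M] then yields the fourth moment of [V]. *)
Lemma L4_limit (V : T -> R) (Vn : nat -> T -> R) (K : R) :
  measurable_fun setT V ->
  integ (fun w => V w ^+ 2) ->
  (forall n, L4 (Vn n)) ->
  (forall e, 0 < e -> exists n, [/\ integ (fun w => (V w - Vn n w) ^+ 2),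
     mean (fun w => (V w - Vn n w) ^+ 2) <= e & mean (fun w => Vn n w ^+ 4) <= K]) ->
  L4 V /\ mean (fun w => V w ^+ 4) <= K.
Proof.
move=> mV IV LVn cvgV.
pose g (M : nat) w := Num.min (V w ^+ 2) M%:R.
have g0 M w : 0 <= g M w by rewrite le_min sqr_ge0 ler0n.
have gV M w : g M w <= V w ^+ 2 by rewrite ge_min lexx.
have gM M w : g M w <= M%:R by rewrite ge_min lexx orbT.
have mg M : measurable_fun setT (g M).
  apply: measurable_minr => //; exact: measurable_funX.
have Ig M : integ (fun w => g M w ^+ 2).
  apply: (@integ_le _ _ _ _ _ (fun=> M%:R ^+ 2)); last exact: integ_cst.
    exact: measurable_funX.
  by move=> w; rewrite ger0_norm ?sqr_ge0// ler_sqr ?nnegrE.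
have b0 : 0 <= mean (fun w => V w ^+ 2) by apply: mean_ge0 => w; exact: sqr_ge0.
set b := mean (fun w => V w ^+ 2) in b0.
have key M : mean (fun w => g M w ^+ 2) <= K.
  apply/ler_addgt0Pr => e e0.
  (* Both terms of [sq_diff_le] are then at most [e / (4 * (M + 1))] in mean, and [2 * M] times
     their sum is at most [e]. *)
  pose del := e / (4 * (M%:R + 1) * (b + 1)).
  have M1 : 0 < M%:R + 1 :> R by rewrite ltr_wpDl.
  have b1 : 0 < b + 1 by rewrite ltr_wpDl.
  have d0 : 0 < del by rewrite divr_gt0// !mulr_gt0.
  have di0 : 0 < 1 + del^-1 by rewrite addr_gt0// invr_gt0.
  have c0 : 0 < e / (4 * (M%:R + 1) * (1 + del^-1)) by rewrite divr_gt0// !mulr_gt0.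
  have [n [In en Kn]] := cvgV _ c0.
  have In4 : integ (fun w => Vn n w ^+ 4) by case: (LVn n).
  have IR : integ (fun w => (1 + del^-1) * (V w - Vn n w) ^+ 2 + del * V w ^+ 2).
    by apply: integD; exact: integZ.
  apply: (@le_trans _ _ (mean (fun w => Vn n w ^+ 4 +
      2 * M%:R * ((1 + del^-1) * (V w - Vn n w) ^+ 2 + del * V w ^+ 2)))).
    apply: le_mean => //; first by apply: integD => //; exact: integZ.
    move=> w; have D := sq_diff_le (V w) (Vn n w) d0.
    set r := (1 + del^-1) * _ + _ in D *.
    have r0 : 0 <= r by exact: le_trans D.
    have gr : g M w <= Vn n w ^+ 2 + r.
      apply: le_trans (gV M w) _; move: D; rewrite ler_norml => /andP[_]; lra.
    have A : g M w * g M w <= g M w * Vn n w ^+ 2 + M%:R * r.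
      apply: (@le_trans _ _ (g M w * (Vn n w ^+ 2 + r))); first by rewrite ler_wpM2l.
      by rewrite mulrDr lerD2l ler_wpM2r.
    have B : 0 <= (g M w - Vn n w ^+ 2) ^+ 2 by exact: sqr_ge0.
    have -> : Vn n w ^+ 4 = Vn n w ^+ 2 * Vn n w ^+ 2 by ring.
    by move: A B; rewrite !expr2; lra.
  rewrite meanD//; last exact: integZ.
  rewrite meanZ// meanD; [|exact: integZ|exact: integZ].
  rewrite !meanZ// -/b lerD//.
  have A : (1 + del^-1) * mean (fun w => (V w - Vn n w) ^+ 2) <= e / (4 * (M%:R + 1)).
    apply: (@le_trans _ _ ((1 + del^-1) * (e / (4 * (M%:R + 1) * (1 + del^-1))))).
      by rewrite ler_wpM2l// ltW.
    rewrite le_eqVlt; apply/orP; left; apply/eqP.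
    move: (1 + del^-1) di0 => u u0.
    by field; rewrite !gt_eqF.
  have B : del * b <= e / (4 * (M%:R + 1)).
    apply: (@le_trans _ _ (del * (b + 1))); first by rewrite ler_wpM2l ?lerDl// ltW.
    rewrite /del le_eqVlt; apply/orP; left; apply/eqP.
    by field; rewrite !gt_eqF.
  have C : 2 * M%:R * (e / (4 * (M%:R + 1)) + e / (4 * (M%:R + 1))) <= e.
    rewrite (_ : _ * _ = e * (M%:R / (M%:R + 1))); last by field; rewrite gt_eqF.
    by apply: ler_piMr; [exact: ltW|rewrite ler_pdivrMr// mul1r lerDl].
  by apply: le_trans C; rewrite ler_wpM2l ?mulr_ge0// lerD.
have mV4 : measurable_fun setT (fun w => V w ^+ 4) by exact: measurable_funX.
have I4 : (\int[P]_w (V w ^+ 4)%:E <= K%:E)%E.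
  have -> : (\int[P]_w (V w ^+ 4)%:E = limn (fun M => \int[P]_w (g M w ^+ 2)%:E))%E.
    rewrite -monotone_convergence//.
    - apply: eq_integral => w _; apply/esym/cvg_lim => //.
      apply: cvg_near_cst; near=> M; rewrite /g min_l -?exprM//.
      near: M; exists (Num.truncn (V w ^+ 2)).+1 => // M /= hM.
      by rewrite (le_trans (ltW (truncnS_gt _)))// ler_nat.
    - by move=> M; apply/measurable_EFinP; exact: measurable_funX.
    - by move=> M w _; rewrite lee_fin sqr_ge0.
    - move=> w _ M N MN; rewrite lee_fin ler_sqr ?nnegrE// le_min gV/=.
      by rewrite (le_trans (gM _ _))// ler_nat.
  apply: lime_le.
    apply: ereal_nondecreasing_is_cvgn => M N MN; apply: ge0_le_integral => //.
    - by move=> w _; rewrite lee_fin sqr_ge0.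
    - by apply/measurable_EFinP; exact: measurable_funX.
    - by apply/measurable_EFinP; exact: measurable_funX.
    - move=> w _; rewrite lee_fin ler_sqr ?nnegrE// le_min gV/=.
      by rewrite (le_trans (gM _ _))// ler_nat.
  by apply: nearW => M; rewrite integ_mean// lee_fin key.
have IV4 : integ (fun w => V w ^+ 4).
  apply: integ_lty => //; first by move=> w; exact: pow4_ge0.
  exact: le_lt_trans I4 (ltry _).
by split; [split|rewrite -lee_fin -integ_mean].
Unshelve. all: by end_near. Qed.

End IndependenceInterface.

(** * Gaussian variables *)

Section NormalMoments.
Context {R : realType}.
Local Notation mu := (@lebesgue_measure R).

Lemma sqr_le_expR (u : R) : 0 <= u -> u ^+ 2 <= 4 * expR u.
Proof.
move=> u0; have := expR_ge1Dx (u / 2).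
have -> : expR u = expR (u / 2) * expR (u / 2) by rewrite -expRD; congr expR; field.
by move=> h; nra.
Qed.

(* [x^4 <= 64 s^4 exp (x^2 / (4 s^2))], and the product of this exponential
   with the density of N(0, s^2) is sqrt 2 times the density of N(0, 2 s^2). *)
Lemma normal_pdf_pow4 (s x : R) : 0 < s ->
  normal_pdf 0 s x * x ^+ 4 <=
  128 * s ^+ 4 * normal_pdf 0 (Num.sqrt 2 * s) x.
Proof.
move=> s0; have r0 : 0 < Num.sqrt 2 :> R by rewrite sqrtr_gt0.
have r2 : Num.sqrt 2 ^+ 2 = 2 :> R by rewrite sqr_sqrtr.
have r2' : Num.sqrt 2 <= 2 :> R by rewrite -{2}r2 ler_eXnr// -(ler_sqr)// ?r2 ?nnegrE// ?expr1n ?ler1n// ltW.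
rewrite !normal_pdfE ?gt_eqF ?mulr_gt0//.
have -> : normal_peak s = Num.sqrt 2 * normal_peak (Num.sqrt 2 * s).
  rewrite /normal_peak exprMn r2.
  rewrite (_ : 2 * s ^+ 2 * pi *+ 2 = 2 * (s ^+ 2 * pi *+ 2)); last by ring.
  by rewrite sqrtrM// invfM mulrA divff ?mul1r ?gt_eqF.
set k := normal_peak _; have k0 : 0 <= k by exact: normal_peak_ge0.
set u := x ^+ 2 / (4 * s ^+ 2).
have u0 : 0 <= u by apply: divr_ge0; rewrite ?sqr_ge0//; apply: mulr_ge0; rewrite ?sqr_ge0.
have sn0 : s != 0 by rewrite gt_eqF.
have E1 : normal_fun 0 s x = expR (- u) * expR (- u).
  rewrite /normal_fun -expRD subr0; congr expR.
  by rewrite -(mulr_natr (s ^+ 2)) /u; field.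
have E2 : normal_fun 0 (Num.sqrt 2 * s) x = expR (- u).
  rewrite /normal_fun subr0 exprMn r2; congr expR.
  by rewrite -(mulr_natr (2 * s ^+ 2)) /u; field.
rewrite E1 E2 expRN; set e := expR u; have e0 : 0 < e by exact: expR_gt0.
have H : x ^+ 4 <= 64 * s ^+ 4 * e.
  have := sqr_le_expR u0; rewrite -/e /u expr_div_n ler_pdivrMr ?exprn_gt0 ?mulr_gt0 ?exprn_gt0//.
  by rewrite -exprM exprMn -exprM; lra.
have -> : Num.sqrt 2 * k * (e^-1 * e^-1) * x ^+ 4 = Num.sqrt 2 * k * e^-1 * (e^-1 * x ^+ 4) by ring.
have -> : 128 * s ^+ 4 * (k * e^-1) = 2 * k * e^-1 * (64 * s ^+ 4) by ring.
apply: ler_pM.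
- by rewrite !mulr_ge0// ?invr_ge0 ltW.
- by rewrite mulr_ge0 ?exprn_even_ge0// invr_ge0 ltW.
- by rewrite ler_wpM2r ?invr_ge0 ?(ltW e0)// ler_wpM2r.
- by rewrite ler_pdivrMl// mulrC.
Qed.

Lemma normal_pdf_even (s x : R) : 0 < s -> normal_pdf 0 s (- x) = normal_pdf 0 s x.
Proof.
by move=> s0; rewrite !normal_pdfE ?gt_eqF// /normal_fun !subr0 sqrrN.
Qed.

Lemma ge0_integral_reflect (f : R -> \bar R) : measurable_fun setT f ->
  (forall x, 0 <= f x)%E ->
  (\int[mu]_x f (- x)%R = \int[mu]_x f x)%E.
Proof.
move=> mf f0.
rewrite [LHS](_ : _ = \int[mu]_(x in (-%R : _ -> measurableTypeR R) @^-1` setT) f (- x)%R)%E.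
  rewrite -ge0_integral_pushforward//=.
  by apply: eq_measure_integral => //= A mA _; exact: lebesgue_measureN.
by rewrite preimage_setT.
Qed.

Section NormalVariable.
Context d (T : measurableType d) (P : probability T R).
Variables (xi : T -> R) (s : R).
Hypothesis mxi : measurable_fun setT xi.
Hypothesis s0 : 0 < s.
Hypothesis law : forall B : set R, measurable B -> P (xi @^-1` B) = normal_prob 0 s B.

Lemma normal_transfer (g : R -> R) : measurable_fun setT g -> (forall x, 0 <= g x) ->
  (\int[P]_w (g (xi w))%:E = \int[mu]_x (normal_pdf 0 s x * g x)%:E)%E.
Proof.
move=> mg g0.
pose Xm := isMeasurableFun.Build _ _ _ _ _ mxi.
pose X : {mfun T >-> R} := HB.pack xi Xm.
have H (B : set R) : measurable B ->
    (\int[mu]_x (normal_pdf 0 s x * \1_B x)%:E = 1%:E * distribution P X B)%E.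
  move=> mB; rewrite mul1e -[distribution _ _ _]/(P (xi @^-1` B)) law// /normal_prob.
  rewrite [RHS]integral_mkcond; apply: eq_integral => x _.
  rewrite patchE indicE; case: ifPn => xB; first by rewrite mulr1.
  by rewrite mulr0.
have := @ge0_integral_weighted_transfer _ _ (measurableTypeR R) _ R
  lebesgue_measure (distribution P X) id (normal_pdf 0 s) 1
  (@measurable_id _ _ setT) (measurable_normal_pdf 0 s) (normal_pdf_ge0 0 s) ler01 H g mg g0.
rewrite mul1e ge0_integral_distribution; [by move=> ->| |].
- exact/measurable_EFinP.
- by move=> y; rewrite lee_fin.
Qed.

(** The density bound [normal_pdf_pow4] is integrated, so no Gaussian moment is computed. The exact
    constant is 3; only the order in [s] matters. *)
Lemma normal_L4 : L4 P xi /\ mean P (fun w => xi w ^+ 4) <= 128 * s ^+ 4.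
Proof.
have m4 : measurable_fun setT (fun x : R => x ^+ 4) by exact: measurable_funX.
have mx4 : measurable_fun setT (fun w => xi w ^+ 4) by exact: measurable_funX.
have B : (\int[P]_w (xi w ^+ 4)%:E <= (128 * s ^+ 4)%:E)%E.
  rewrite (normal_transfer m4 (@pow4_ge0 R)).
  apply: (@le_trans _ _ (\int[mu]_x (128 * s ^+ 4 * normal_pdf 0 (Num.sqrt 2 * s) x)%:E)%E).
    apply: ge0_le_integral => //.
    - by move=> x _; rewrite lee_fin mulr_ge0 ?normal_pdf_ge0 ?pow4_ge0.
    - apply/measurable_EFinP/measurable_funM => //; exact: measurable_normal_pdf.
    - apply/measurable_EFinP/measurable_funM => //; exact: measurable_normal_pdf.
    - by move=> x _; rewrite lee_fin; exact: normal_pdf_pow4.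
  under eq_integral do rewrite EFinM.
  rewrite ge0_integralZl ?lee_fin//.
  - by rewrite integral_normal_pdf mule1.
  - apply/measurable_EFinP; exact: measurable_normal_pdf.
  - by move=> x _; rewrite lee_fin normal_pdf_ge0.
  - by rewrite mulr_ge0 ?pow4_ge0.
have I : integ P (fun w => xi w ^+ 4).
  apply: integ_lty => //; first by move=> w; exact: pow4_ge0.
  exact: le_lt_trans B (ltry _).
by split; [split|rewrite -lee_fin -integ_mean].
Qed.

(** The density is even, so the positive and negative parts have equal means, and both are finite by
    [normal_L4]. *)
Lemma normal_mean0 : mean P xi = 0.
Proof.
have [L _] := normal_L4; have I := L4_integ L.
have Ip : integ P xi^\+ by exact: integrable_funrpos.
have In : integ P xi^\- by exact: integrable_funrneg.
have mp : measurable_fun setT (fun x : R => Num.max x 0) by exact: measurable_maxr.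
have mn : measurable_fun setT (fun x : R => Num.max (- x) 0) by exact: measurable_maxr.
have pos0 (x : R) : 0 <= Num.max x 0 by rewrite le_max lexx orbT.
have E : mean P xi^\+ = mean P xi^\-.
  apply: EFin_inj; rewrite -!integ_mean//.
  transitivity (\int[mu]_x (normal_pdf 0 s x * Num.max x 0)%:E)%E.
    exact: (normal_transfer mp).
  transitivity (\int[mu]_x (normal_pdf 0 s x * Num.max (- x) 0)%:E)%E; last first.
    by symmetry; exact: (normal_transfer mn).
  rewrite -ge0_integral_reflect.
  - by apply: eq_integral => x _; rewrite normal_pdf_even.
  - apply/measurable_EFinP/measurable_funM => //; exact: measurable_normal_pdf.
  - by move=> x; rewrite lee_fin mulr_ge0// normal_pdf_ge0.
transitivity (mean P (fun w => xi^\+ w - xi^\- w)).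
  by apply: eq_mean => w; have /(congr1 (fun h => h w)) /= := funrposBneg xi.
by rewrite meanB// E subrr.
Qed.

End NormalVariable.
End NormalMoments.

(** * Step functions *)

(** With [phi] a path of W this is the step integral, and with [phi s = 1] for [x <= s] and 0
    otherwise it is the value of the step function at [x]. An identity valid for every [phi] thus
    transforms the integral and the integrand simultaneously. *)
Definition step_sum {R : realType} (e : step_fun R) (phi : R -> R) : R :=
  \sum_(j < pieces e) coef e j * (phi (knot e j.+1) - phi (knot e j)).

(** Ordered points of the unit interval, not a partition of unity; the end points need not be 0 and
    1. *)
Definition partition_of_unit {R : realType} (m : nat) (p : nat -> R) : Prop :=
  [/\ 0 <= p 0%N, forall j, (j < m)%N -> p j <= p j.+1 & p m <= 1].

Section StepFunctions.
Context {R : realType}.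
Implicit Types (e : step_fun R) (p b : nat -> R) (phi : R -> R).

Lemma step_integral_sum (T : Type) (W : R -> T -> R) e w :
  step_integral W e w = step_sum e (fun s => W s w).
Proof. by []. Qed.

Lemma step_on_knot t e j : step_on t e -> (j <= pieces e)%N ->
  0 <= knot e j <= t.
Proof.
move=> [k0 km kt] jp.
have mono i k : (i <= k)%N -> (k <= pieces e)%N -> knot e i <= knot e k.
  elim: k => [|k IH]; first by rewrite leqn0 => /eqP ->.
  rewrite leq_eqVlt => /orP[/eqP -> //|ik kp].
  by apply: (le_trans (IH ik (ltnW kp))); exact: km.
by rewrite (le_trans k0 (mono _ _ _ _))//= (le_trans (mono _ _ jp (leqnn _)) kt).
Qed.

Lemma step_eval_sum t e x : step_on t e ->
  step_eval e x = step_sum e (fun s => (x <= s)%R%:R).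
Proof.
move=> [_ km _]; apply: eq_bigr => j _; congr (_ * _).
have := km j (ltn_ord j); rewrite indicE.
case: (boolP (x \in _)) => [|]; rewrite ?notin_setE ?inE /= in_itv/=.
  by move=> /andP[ax xb] _; rewrite xb leNgt ax subr0.
move=> /negP; rewrite negb_and -leNgt -ltNge => /orP[xa|bx] ab.
  by rewrite xa (le_trans xa ab) subrr.
by rewrite !leNgt bx (le_lt_trans ab bx) subrr.
Qed.

Lemma telescope_ltn (f : nat -> R) m k : (k <= m)%N ->
  \sum_(l < m) (l < k)%N%:R * (f l.+1 - f l) = f k - f 0%N.
Proof.
elim: m k => [|m IH] k; first by rewrite leqn0 => /eqP ->; rewrite big_ord0 subrr.
rewrite big_ord_recr /= leq_eqVlt => /orP[/eqP ->|km].
  rewrite ltnSn mul1r (eq_bigr (fun l : 'I_m => (l < m)%N%:R * (f l.+1 - f l))).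
    by rewrite IH// addrC subrKA.
  by move=> l _; rewrite ltn_ord ltnS ltnW// ltn_ord.
by rewrite IH// ltnNge -ltnS km mul0r addr0.
Qed.

(** The coefficient of cell [l] of the finer grid is the sum of the [coef e j] whose interval
    contains this cell; within one interval the increments of [phi] telescope. *)
Lemma step_sum_refine e (s : seq R) : sorted <=%R s ->
  (forall j, (j < pieces e)%N -> knot e j <= knot e j.+1) ->
  (forall j, (j <= pieces e)%N -> knot e j \in s) ->
  exists b, forall phi, step_sum e phi =
    \sum_(l < (size s).-1) b l * (phi (nth 0 s l.+1) - phi (nth 0 s l)).
Proof.
move=> ss km ks.
pose i j := index (knot e j) s.
exists (fun l => \sum_(j < pieces e) coef e j * ((l < i j.+1)%N%:R - (l < i j)%N%:R)).
move=> phi; under [RHS]eq_bigr do rewrite mulr_suml.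
rewrite exchange_big /=; apply: eq_bigr => j _.
have il k : (k <= pieces e)%N -> (i k <= (size s).-1)%N.
  by move=> /ks; rewrite -index_mem => h; rewrite -ltnS (ltn_predK h).
have nthi k : (k <= pieces e)%N -> nth 0 s (i k) = knot e k.
  by move=> /ks; exact: nth_index.
under eq_bigr do rewrite -mulrA mulrBl.
rewrite -mulr_sumr sumrB; congr (_ * _).
rewrite !(telescope_ltn (fun l => phi (nth 0 s l)))//; last 2 first.
- exact/il/ltnW.
- exact/il.
by rewrite !nthi//; [ring|exact: ltnW].
Qed.

(** The merged and sorted knots form a common grid, on which the difference of two step integrals
    becomes a combination of independent Brownian increments. *)
Lemma step_sub_refine e1 e2 t1 t2 : step_on t1 e1 -> step_on t2 e2 ->
  t1 <= 1 -> t2 <= 1 ->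
  exists m p b, partition_of_unit m p /\
    forall phi, step_sum e1 phi - step_sum e2 phi =
      \sum_(l < m) b l * (phi (p l.+1) - phi (p l)).
Proof.
move=> on1 on2 t11 t21.
pose ks e := [seq knot e j | j <- iota 0 (pieces e).+1].
pose s := sort <=%R (ks e1 ++ ks e2).
have kse e j : (j <= pieces e)%N -> knot e j \in ks e.
  by move=> jp; apply/mapP; exists j => //; rewrite mem_iota.
have ss : sorted <=%R s by apply: sort_sorted; exact: le_total.
have s01 x : x \in s -> 0 <= x <= 1.
  have H e t : step_on t e -> t <= 1 -> x \in ks e -> 0 <= x <= 1.
    move=> on tle /mapP[j]; rewrite mem_iota => /andP[_ jp] ->.
    have /andP[-> h] := step_on_knot on (j := j) ltac:(lia).
    exact: le_trans h tle.
  by rewrite mem_sort mem_cat => /orP[]; [exact: H on1 t11|exact: H on2 t21].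
have [b1 H1] := @step_sum_refine e1 s ss (let: And3 _ h _ := on1 in h)
  (fun j h => ltac:(by rewrite mem_sort mem_cat kse)).
have [b2 H2] := @step_sum_refine e2 s ss (let: And3 _ h _ := on2 in h)
  (fun j h => ltac:(by rewrite mem_sort mem_cat orbC kse)).
have s0 : (0 < size s)%N by rewrite size_sort size_cat size_map size_iota.
exists (size s).-1, (nth 0 s), (fun l => b1 l - b2 l); split.
  split.
  - by have /andP[] := s01 _ (mem_nth 0 s0).
  - move=> j js; have jS : (j.+1 < size s)%N by rewrite -(ltn_predK s0) ltnS.
    by apply: (sorted_leq_nth le_trans le_refl) => //; rewrite inE// ltnW.
  - have sl : ((size s).-1 < size s)%N by rewrite ltn_predL.
    by have /andP[] := s01 _ (mem_nth 0 sl).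
move=> phi; rewrite H1 H2 -sumrB; apply: eq_bigr => l _; ring.
Qed.

Local Notation mu := (@lebesgue_measure R).

Lemma partition_energy m p b : partition_of_unit m p ->
  (\int[mu]_(x in `[0%R, 1%R])
    ((\sum_(l < m) b l * ((x <= p l.+1)%R%:R - (x <= p l)%R%:R)) ^+ 2)%:E)%E =
  (\sum_(l < m) b l ^+ 2 * (p l.+1 - p l))%:E.
Proof.
move=> [p0 pm p1].
have mono i k : (i <= k)%N -> (k <= m)%N -> p i <= p k.
  elim: k => [|k IH]; first by rewrite leqn0 => /eqP ->.
  rewrite leq_eqVlt => /orP[/eqP -> //|ik kp].
  by apply: (le_trans (IH ik (ltnW kp))); exact: pm.
pose I l : set R := `]p l, p l.+1]%classic.
have IE l x : (l < m)%N -> (x <= p l.+1)%R%:R - (x <= p l)%R%:R = \1_(I l) x :> R.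
  move=> lm; have ab := pm l lm; rewrite indicE /I.
  case: (boolP (x \in _)) => [|]; rewrite ?notin_setE ?inE /= in_itv/=.
    by move=> /andP[ax xb]; rewrite xb leNgt ax subr0.
  move=> /negP; rewrite negb_and -leNgt -ltNge => /orP[xa|bx].
    by rewrite xa (le_trans xa ab) subrr.
  by rewrite !leNgt bx (le_lt_trans ab bx) subrr.
have disj l k x : (l < m)%N -> (k < m)%N -> l != k -> \1_(I l) x * \1_(I k) x = 0 :> R.
  wlog lk : l k / (l < k)%N.
    move=> H lm km lk; have [h|h|h] := ltngtP l k; first exact: H.
    - by rewrite mulrC; apply: H => //; rewrite eq_sym.
    - by rewrite h eqxx in lk.
  move=> lm km _; rewrite !indicE /I.
  case: (boolP (x \in `]p l, _]%classic)); rewrite ?mul0r// inE /= in_itv/= => /andP[_ xl].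
  case: (boolP (x \in `]p k, _]%classic)); rewrite ?mulr0// inE /= in_itv/= => /andP[kx _].
  by have := lt_le_trans kx (le_trans xl (mono _ _ lk (ltnW km))); rewrite ltxx.
have sq x : (\sum_(l < m) b l * ((x <= p l.+1)%R%:R - (x <= p l)%R%:R)) ^+ 2 =
    \sum_(l < m) b l ^+ 2 * \1_(I l) x.
  under eq_bigr => l _ do rewrite IE//.
  rewrite expr2 big_distrlr /=; apply: eq_bigr => l _.
  rewrite (bigD1 l)//= big1 ?addr0.
    rewrite mulrACA -!expr2; congr (_ * _).
    by rewrite indicE; case: (_ \in _); rewrite ?expr1n ?expr0n.
  by move=> k kl; rewrite mulrACA disj ?mulr0// eq_sym.
under eq_integral do rewrite sq -sumEFin.
rewrite ge0_integral_sum//; last 2 first.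
- move=> l; apply/measurable_EFinP/measurable_funM => //.
  by apply: measurable_indic; exact: measurable_itv.
- by move=> l x _; rewrite lee_fin mulr_ge0// sqr_ge0.
rewrite -sumEFin; apply: eq_bigr => l _.
under eq_integral do rewrite EFinM.
rewrite ge0_integralZl//; last 2 first.
- by apply/measurable_EFinP/measurable_indic; exact: measurable_itv.
- by rewrite lee_fin sqr_ge0.
rewrite [RHS]EFinM integral_indic//; last exact: measurable_itv.
rewrite (_ : I l `&` `[0, 1]%classic = I l); last first.
  apply/setIidPl => x; rewrite /I /= !in_itv/= => /andP[lx xl].
  rewrite (le_trans p0 (le_trans (mono 0%N l _ _) (ltW lx)))//=; last exact: ltnW.
  by rewrite (le_trans xl (le_trans (mono l.+1 m _ _) p1)).
congr (_ * _)%E; rewrite /= /I lebesgue_measure_itv/= lte_fin.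
have := pm l (ltn_ord l); rewrite le_eqVlt => /orP[/eqP ->|->]; last by rewrite EFinB.
by rewrite ltxx subrr.
Qed.

End StepFunctions.

(** * Increments of the signal *)

Section Brownian.
Context d (T : measurableType d) (R : realType) (P : probability T R).
Variable W : R -> {RV P >-> R}.
Hypothesis hW : brownian_motion W.
Local Notation mean := (mean P).
Local Notation integ := (integ P).
Local Notation L4 := (L4 P).
Local Notation mu := (@lebesgue_measure R).

Let mW t : measurable_fun setT (W t : T -> R). Proof. exact: measurable_funP. Qed.

(** With [h = t - s] the fourth moment is at most [128 * h ^ 2], and Young's inequality gives the
    second moment [h / 2 + 64 * h]. The single bound [v = 65 * h], with [v] for the second and
    [v ^ 2] for the fourth moment, fits [lincomb_pow4] with [kappa = 1]. *)
Lemma bm_increment s t : 0 <= s -> s <= t -> t <= 1 ->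
  [/\ L4 (fun w => W t w - W s w), mean (fun w => W t w - W s w) = 0,
      mean (fun w => (W t w - W s w) ^+ 2) <= 65 * (t - s) &
      mean (fun w => (W t w - W s w) ^+ 4) <= (65 * (t - s)) ^+ 2].
Proof.
move=> s0; rewrite le_eqVlt => /orP[/eqP <- _|st t1].
  have E (k : nat) : mean (fun w => (W s w - W s w) ^+ k.+1) = 0.
    rewrite -[RHS](mean_cst P 0); apply: eq_mean => w.
    by rewrite subrr expr0n.
  split; rewrite ?E ?subrr ?mulr0 ?expr0n//.
  - by apply: eq_L4 (L4_cst P 0) => w; rewrite subrr.
  - by rewrite -[RHS](mean_cst P 0); apply: eq_mean => w; rewrite subrr.
set h := t - s; have h0 : 0 < h by rewrite subr_gt0.
have sh : 0 < Num.sqrt h by rewrite sqrtr_gt0.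
have mD : measurable_fun setT (fun w => W t w - W s w) by exact: measurable_funB.
have law := bm_normal hW s0 st t1.
have [L4D M4] := normal_L4 mD sh law.
have M4' : mean (fun w => (W t w - W s w) ^+ 4) <= 128 * h ^+ 2.
  by apply: le_trans M4 _; rewrite -[4%N]/(2 * 2)%N exprM sqr_sqrtr// ltW.
split => //.
- exact: (normal_mean0 mD sh law).
- apply: (@le_trans _ _ (mean (fun w => h / 2 + (2 * h)^-1 * (W t w - W s w) ^+ 4))).
    apply: le_mean; first exact: L4_sq.
      by apply: integD; [exact: integ_cst|apply: integZ; case: L4D].
    move=> w; set x := _ - _.
    have : 0 <= (x ^+ 2 - h) ^+ 2 / (2 * h) by rewrite divr_ge0 ?sqr_ge0// mulr_ge0// ltW.
    rewrite (_ : _ / _ = h / 2 + (2 * h)^-1 * x ^+ 4 - x ^+ 2); first by lra.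
    by field; rewrite gt_eqF.
  rewrite meanD; [|exact: integ_cst|by apply: integZ; case: L4D].
  rewrite mean_cst meanZ; last by case: L4D.
  have : (2 * h)^-1 * mean (fun w => (W t w - W s w) ^+ 4) <= (2 * h)^-1 * (128 * h ^+ 2).
    by rewrite ler_wpM2l// invr_ge0 mulr_ge0// ltW.
  rewrite (_ : (2 * h)^-1 * (128 * h ^+ 2) = 64 * h); last by field; rewrite gt_eqF.
  by lra.
- by apply: le_trans M4' _; rewrite exprMn; have := sqr_ge0 h; lra.
Qed.

Lemma bm_lincomb m (p b : nat -> R) : partition_of_unit m p ->
  [/\ L4 (fun w => \sum_(l < m) b l * (W (p l.+1) w - W (p l) w)),
      mean (fun w => (\sum_(l < m) b l * (W (p l.+1) w - W (p l) w)) ^+ 2) <=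
        65 * \sum_(l < m) b l ^+ 2 * (p l.+1 - p l) &
      mean (fun w => (\sum_(l < m) b l * (W (p l.+1) w - W (p l) w)) ^+ 4) <=
        6 * (65 * \sum_(l < m) b l ^+ 2 * (p l.+1 - p l)) ^+ 2].
Proof.
move=> [p0 pm p1].
have mono i k : (i <= k)%N -> (k <= m)%N -> p i <= p k.
  elim: k => [|k IH]; first by rewrite leqn0 => /eqP ->.
  rewrite leq_eqVlt => /orP[/eqP -> //|ik kp].
  by apply: (le_trans (IH ik (ltnW kp))); exact: pm.
pose X (l : 'I_m) w := W (p l.+1) w - W (p l) w.
have inc (l : 'I_m) := @bm_increment (p l) (p l.+1)
  (le_trans p0 (mono 0%N l isT (ltnW (ltn_ord l)))) (pm l (ltn_ord l))
  (le_trans (mono l.+1 m (ltn_ord l) (leqnn m)) p1).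
have LX l : L4 (X l) by case: (inc l).
have X0 l : mean (X l) = 0 by case: (inc l).
have wi : weighted_independence P X (fun=> 1).
  apply: mutually_independent_weighted; first by move=> j; exact: L4_measurable (LX j).
  exact: (bm_indep hW p0 pm p1).
pose v (l : 'I_m) := 65 * (p l.+1 - p l).
have v0 l : 0 <= v l by rewrite mulr_ge0// subr_ge0 pm.
have sv l : mean (fun w => X l w ^+ 2) <= v l by case: (inc l).
have qv l : mean (fun w => X l w ^+ 4) <= 1 * v l ^+ 2 by rewrite mul1r; case: (inc l).
have vE : \sum_(l < m) b l ^+ 2 * v l = 65 * \sum_(l < m) b l ^+ 2 * (p l.+1 - p l).
  by rewrite mulr_sumr; apply: eq_bigr => l _; rewrite /v; ring.
split.
- by apply: L4_sum => l _; exact/L4Z/LX.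
- rewrite -vE; have -> := mean_lincomb_sq LX wi X0 (fun l => b l).
  by apply: ler_sum => l _; rewrite ler_wpM2l ?sqr_ge0.
- rewrite -vE; apply: le_trans (lincomb_pow4 LX wi X0 v0 sv (lexx 1) qv (fun l => b l)) _.
  by rewrite mulr1 (_ : 4 + 2 = 6 :> R)//; ring.
Qed.

Lemma cvge0_le (u : nat -> \bar R) (e : R) : (u @ \oo --> 0)%E -> 0 < e ->
  exists N, forall k, (N <= k)%N -> (u k <= e%:E)%E.
Proof.
move=> /fine_cvgP[fu cu] e0.
have [N1 _ H1] := fu.
have [N2 _ H2] := cvgr_le _ cu e e0.
exists (maxn N1 N2) => k; rewrite geq_max => /andP[k1 k2].
by rewrite -(fineK (H1 _ k1)) lee_fin; exact: H2.
Qed.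

Lemma measurable_step_eval (e : step_fun R) (D : set R) :
  measurable_fun D (step_eval e : R -> R).
Proof.
apply: measurable_funTS; apply: measurable_sum => j.
by apply: measurable_funM => //; apply: measurable_indic; exact: measurable_itv.
Qed.

(** On [[0, t']] both step functions approximate [f]; on []t', t'']] only [e''] is left, close to
    [f], whose square is at most [M]; beyond [t''] both vanish. So the energy is of the order of
    [t'' - t'] up to the approximation errors. *)
Lemma step_sub_energy (f : R -> R) (M t' t'' : R) (e' e'' : step_fun R) m (p b : nat -> R) :
  measurable_fun (`[0, 1]%classic : set R) f ->
  (forall x, 0 <= x <= 1 -> f x ^+ 2 <= M) ->
  0 <= t' -> t' <= t'' -> t'' <= 1 ->
  step_on t' e' -> step_on t'' e'' -> partition_of_unit m p ->
  (forall phi, step_sum e'' phi - step_sum e' phi =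
      \sum_(l < m) b l * (phi (p l.+1) - phi (p l))) ->
  ((\sum_(l < m) b l ^+ 2 * (p l.+1 - p l))%:E <=
   2%:E * (\int[mu]_(x in `[0%R, t'']) ((f x - step_eval e'' x) ^+ 2)%:E +
   \int[mu]_(x in `[0%R, t']) ((f x - step_eval e' x) ^+ 2)%:E +
   (M * (t'' - t'))%:E))%E.
Proof.
move=> mf fM t'0 t't'' t''1 on' on'' pp bE.
pose D x := step_eval e'' x - step_eval e' x.
have -> : ((\sum_(l < m) b l ^+ 2 * (p l.+1 - p l))%:E =
    \int[mu]_(x in `[0%R, 1%R]) (D x ^+ 2)%:E)%E.
  rewrite -partition_energy//; apply: eq_integral => x _.
  by rewrite /D (step_eval_sum x on'') (step_eval_sum x on') bE.
pose g'' x := ((f x - step_eval e'' x) ^+ 2)%:E.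
pose g' x := ((f x - step_eval e' x) ^+ 2)%:E.
have sub (t : R) : t <= 1 -> `[0, t]%classic `<=` (`[0, 1]%classic : set R).
  by move=> t1; apply: subset_itvl; rewrite bnd_simp.
have sub2 : `]t', t'']%classic `<=` (`[0, 1]%classic : set R).
  by apply: subset_itv; rewrite bnd_simp.
have I01 (t : R) : t <= 1 -> `[0, 1]%classic `&` `[0, t]%classic = (`[0, t]%classic : set R).
  by move=> /sub; rewrite setIC => /setIidPl.
have mg'' : measurable_fun (`[0, 1]%classic : set R) g''.
  apply/measurable_EFinP/measurable_funX/measurable_funB => //.
  exact: measurable_step_eval.
have mg' : measurable_fun (`[0, 1]%classic : set R) g'.
  apply/measurable_EFinP/measurable_funX/measurable_funB => //.
  exact: measurable_step_eval.
have t'1 : t' <= 1 by exact: le_trans t''1.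
have m01 : measurable (`[0, 1]%classic : set R) by exact: measurable_itv.
pose G'' : R -> \bar R := g'' \_ `[0, t'']%classic.
pose G' : R -> \bar R := g' \_ `[0, t']%classic.
have mr'' : measurable_fun (`[0, 1]%classic : set R) G''.
  by apply/measurable_restrict => //; rewrite I01//; apply: measurable_funS mg'' => //; exact: sub.
have mr' : measurable_fun (`[0, 1]%classic : set R) G'.
  by apply/measurable_restrict => //; rewrite I01//; apply: measurable_funS mg' => //; exact: sub.
pose Mc : R -> \bar R := (cst M%:E) \_ `]t', t'']%classic.
have mc : measurable_fun (`[0, 1]%classic : set R) Mc.
  by apply/measurable_restrict.
have M0 : 0 <= M.
  by apply: le_trans (fM 0 _); rewrite ?sqr_ge0// lexx ler01.
have r''0 x : (0 <= G'' x)%E.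
  by rewrite /G'' patchE; case: ifP => // _; rewrite lee_fin sqr_ge0.
have r'0 x : (0 <= G' x)%E.
  by rewrite /G' patchE; case: ifP => // _; rewrite lee_fin sqr_ge0.
have c0 x : (0 <= Mc x)%E.
  by rewrite /Mc patchE; case: ifP.
have -> : (\int[mu]_(x in `[0%R, t'']) ((f x - step_eval e'' x) ^+ 2)%:E =
    \int[mu]_(x in `[0%R, 1%R]) G'' x)%E.
  by rewrite -integral_mkcondr I01.
have -> : (\int[mu]_(x in `[0%R, t']) ((f x - step_eval e' x) ^+ 2)%:E =
    \int[mu]_(x in `[0%R, 1%R]) G' x)%E.
  by rewrite -integral_mkcondr I01.
have -> : ((M * (t'' - t'))%:E =
    \int[mu]_(x in `[0%R, 1%R]) Mc x)%E.
  have I2 : `[0, 1]%classic `&` `]t', t'']%classic = (`]t', t'']%classic : set R).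
    by rewrite setIC; apply/setIidPl.
  rewrite -integral_mkcondr I2 integral_cst//=.
  rewrite lebesgue_measure_itv/= lte_fin EFinM; congr (_ * _)%E.
  move: t't''; rewrite le_eqVlt => /orP[/eqP ->|->]; last by rewrite EFinB.
  by rewrite ltxx subrr.
rewrite -ge0_integralD// -ge0_integralD//; last 2 first.
- by move=> x _; rewrite adde_ge0.
- exact: emeasurable_funD.
rewrite -ge0_integralZl//; last 2 first.
- by apply: emeasurable_funD => //; exact: emeasurable_funD.
- by move=> x _; rewrite !adde_ge0.
apply: ge0_le_integral => //.
- by move=> x _; rewrite lee_fin sqr_ge0.
- apply/measurable_EFinP/measurable_funX/measurable_funB; exact: measurable_step_eval.
- apply: measurable_funeM; apply: emeasurable_funD => //; exact: emeasurable_funD.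
move=> x /=; rewrite in_itv/= => /andP[x0 x1].
have sq (u v : R) : (u - v) ^+ 2 <= 2 * (u ^+ 2 + v ^+ 2).
  by have := sqr_ge0 (u + v); nra.
have outside e t : step_on t e -> t < x -> step_eval e x = 0.
  move=> on tx; rewrite (step_eval_sum x on) /step_sum big1// => j _.
  have /andP[_ h1] := step_on_knot on (ltn_ord j : (j.+1 <= pieces e)%N).
  have /andP[_ h2] := step_on_knot on (ltnW (ltn_ord j)).
  rewrite !leNgt (le_lt_trans h1 tx) (le_lt_trans h2 tx) subrr mulr0//.
rewrite /Mc /G'' /G' !patchE /g'' /g' /D.
have [xt'|t'x] := leP x t'.
  have xt'' := le_trans xt' t't''.
  rewrite !mem_setE !in_itv/= x0 xt' xt'' ltNge xt' /= adde0 -EFinD -EFinM lee_fin.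
  by have := sq (f x - step_eval e'' x) (f x - step_eval e' x); rewrite -sqrrN; congr (_ <= _); ring.
rewrite (outside _ _ on' t'x) subr0.
have [xt''|t''x] := leP x t''.
  have x0t : (t' < x <= t'')%R = true by apply/andP; split.
  have nxt : (x <= t')%R = false by rewrite leNgt t'x.
  rewrite !mem_setE !in_itv/= x0t x0 xt'' nxt /= adde0 -EFinD -EFinM lee_fin.
  have := sq (f x - step_eval e'' x) (f x); have := fM x.
  rewrite x0 x1 => /(_ isT).
  rewrite (_ : f x - step_eval e'' x - f x = - step_eval e'' x) ?sqrrN; last by ring.
  by lra.
rewrite (outside _ _ on'' t''x) expr0n /= mule_ge0// !adde_ge0//.
- by case: ifP => // _; rewrite lee_fin sqr_ge0.
- by case: ifP => // _; rewrite lee_fin sqr_ge0.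
- by case: ifP => // _; rewrite lee_fin.
Qed.

(** What passes to the limit [V]: explicit combinations of values of W, for independence from the
    noise, and an eventual fourth-moment bound of order [(t'' - t') ^ 2]. *)
Definition wiener_step_approx (t' t'' M : R) (V : T -> R) (Z : nat -> T -> R) :=
  [/\ forall k, L4 (Z k),
     forall k, exists m (p b : nat -> R), partition_of_unit m p /\
       forall w, Z k w = \sum_(l < m) b l * (W (p l.+1) w - W (p l) w) &
     forall e, 0 < e -> exists N, forall k, (N <= k)%N ->
       [/\ integ (fun w => (V w - Z k w) ^+ 2), mean (fun w => (V w - Z k w) ^+ 2) <= e &
       mean (fun w => Z k w ^+ 4) <= 6 * (65 * (4 * M * (t'' - t'))) ^+ 2]].

Lemma wiener_increment_approx (f : R -> R) (M t' t'' : R) (X' X'' : {RV P >-> R}) :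
  measurable_fun (`[0, 1]%classic : set R) f ->
  0 < M -> (forall x, 0 <= x <= 1 -> f x ^+ 2 <= M) ->
  0 <= t' -> t' < t'' -> t'' <= 1 ->
  wiener_integral W f t' X' -> wiener_integral W f t'' X'' ->
  exists Z, wiener_step_approx t' t'' M (fun w => X'' w - X' w) Z.
Proof.
move=> mf M0 fM t'0 t't'' t''1 [e' [on' F' E']] [e'' [on'' F'' E'']].
have t'1 : t' <= 1 by exact: le_trans (ltW t't'') t''1.
pose Z k w := step_integral (fun s => W s : T -> R) (e'' k) w -
  step_integral (fun s => W s : T -> R) (e' k) w.
have ref k := step_sub_refine (on'' k) (on' k) t''1 t'1.
have mstep (e : step_fun R) : measurable_fun setT (step_integral (fun s => W s : T -> R) e).
  apply: measurable_sum => j.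
  by apply: measurable_funM => //; exact: measurable_funB.
exists Z; split.
- move=> k; have [m [p [b [pp bE]]]] := ref k.
  have [L _ _] := bm_lincomb b pp.
  by apply: eq_L4 L => w; rewrite /Z !step_integral_sum bE.
- move=> k; have [m [p [b [pp bE]]]] := ref k.
  by exists m, p, b; split => // w; rewrite /Z !step_integral_sum bE.
move=> e e0.
(* If both approximation errors are below this tolerance, [step_sub_energy] gives
   [2 * (1 / 2 + 1 / 2 + 1) = 4] times [M * (t'' - t')]. *)
have h0 : 0 < M * (t'' - t') / 2 by rewrite divr_gt0// mulr_gt0// subr_gt0.
have [N1 H1] := cvge0_le F' h0; have [N2 H2] := cvge0_le F'' h0.
have e4 : 0 < e / 4 by rewrite divr_gt0.
have [N3 H3] := cvge0_le E' e4; have [N4 H4] := cvge0_le E'' e4.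
exists (maxn (maxn N1 N2) (maxn N3 N4)) => k.
rewrite !geq_max => /andP[/andP[k1 k2] /andP[k3 k4]].
have Isq (X : {RV P >-> R}) e1 :
    ('E_P[fun w => ((X w - step_integral (fun s => W s : T -> R) e1 w) ^+ 2)%R] <= (e / 4)%:E)%E ->
    integ (fun w => (X w - step_integral (fun s => W s : T -> R) e1 w) ^+ 2) /\
    mean (fun w => (X w - step_integral (fun s => W s : T -> R) e1 w) ^+ 2) <= e / 4.
  rewrite unlock => h.
  have I : integ (fun w => (X w - step_integral (fun s => W s : T -> R) e1 w) ^+ 2).
    apply: integ_lty; last exact: le_lt_trans h (ltry _).
      by apply: measurable_funX; apply: measurable_funB => //; exact: measurable_funP.
    by move=> w; exact: sqr_ge0.
  by split => //; rewrite -lee_fin -integ_mean.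
have [I3 {}H3] := Isq _ _ (H3 k k3); have [I4 {}H4] := Isq _ _ (H4 k k4).
have bd w : (X'' w - X' w - Z k w) ^+ 2 <=
    2 * (X' w - step_integral (fun s => W s : T -> R) (e' k) w) ^+ 2 +
    2 * (X'' w - step_integral (fun s => W s : T -> R) (e'' k) w) ^+ 2.
  rewrite /Z; move: (step_integral _ _ w) (step_integral _ _ w) => u v.
  by have := sqr_ge0 (X'' w - u + (X' w - v)); nra.
have IB : integ (fun w => 2 * (X' w - step_integral (fun s => W s : T -> R) (e' k) w) ^+ 2 +
    2 * (X'' w - step_integral (fun s => W s : T -> R) (e'' k) w) ^+ 2).
  by apply: integD; exact: integZ.
have IV : integ (fun w => (X'' w - X' w - Z k w) ^+ 2).
  apply: integ_le IB; last by move=> w; rewrite ger0_norm ?sqr_ge0.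
  apply: measurable_funX; apply: measurable_funB; last exact: measurable_funB.
  by apply: measurable_funB; exact: measurable_funP.
split => //.
  apply: le_trans (le_mean IV IB bd) _.
  rewrite meanD; [|exact: integZ|exact: integZ].
  by rewrite !meanZ//; lra.
have [m [p [b [pp bE]]]] := ref k.
have [_ _ M4] := bm_lincomb b pp.
rewrite (eq_mean _ (g := fun w => (\sum_(l < m) b l * (W (p l.+1) w - W (p l) w)) ^+ 4)); last first.
  by move=> w; rewrite /Z !step_integral_sum bE.
apply: le_trans M4 _; rewrite ler_wpM2l//.
have S0 : 0 <= \sum_(l < m) b l ^+ 2 * (p l.+1 - p l).
  by apply: sumr_ge0 => l _; case: pp => _ pm _; rewrite mulr_ge0 ?sqr_ge0// subr_ge0 pm.
have S1 : \sum_(l < m) b l ^+ 2 * (p l.+1 - p l) <= 4 * M * (t'' - t').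
  rewrite -lee_fin.
  apply: le_trans (step_sub_energy mf fM t'0 (ltW t't'') t''1 (on' k) (on'' k) pp bE) _.
  apply: (@le_trans _ _ (2%:E * ((M * (t'' - t') / 2)%:E + (M * (t'' - t') / 2)%:E +
     (M * (t'' - t'))%:E)))%E.
    by rewrite lee_pmul2l// leeD2r// leeD//; [exact: H2|exact: H1].
  by rewrite -!EFinD -EFinM lee_fin; lra.
have t0 : 0 <= 4 * M * (t'' - t') by exact: le_trans S1.
have A : 65 * (\sum_(l < m) b l ^+ 2 * (p l.+1 - p l)) <= 65 * (4 * M * (t'' - t')).
  by rewrite ler_pM2l.
have B : 0 <= 65 * (\sum_(l < m) b l ^+ 2 * (p l.+1 - p l)) by rewrite mulr_ge0.
by rewrite ler_sqr ?nnegrE// (le_trans B A).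
Qed.

Lemma wiener_increment_L4 (t' t'' M : R) (V : T -> R) Z : measurable_fun setT V ->
  wiener_step_approx t' t'' M V Z ->
  L4 V /\ mean (fun w => V w ^+ 4) <= 6 * (65 * (4 * M * (t'' - t'))) ^+ 2.
Proof.
move=> mV [LZ _ cvgZ].
have IV : integ (fun w => V w ^+ 2).
  have [N /(_ N (leqnn _))[I _ _]] := cvgZ 1 ltr01.
  apply: (@integ_le _ _ _ _ _ (fun w => 2 * (V w - Z N w) ^+ 2 + 2 * Z N w ^+ 2)).
  - exact: measurable_funX.
  - move=> w; rewrite ger0_norm ?sqr_ge0//.
    by have := sqr_ge0 (V w - 2 * Z N w); nra.
  - by apply: integD; apply: integZ => //; exact: L4_sq.
apply: (L4_limit mV IV LZ) => e e0.
by have [N /(_ N (leqnn _))[I Me M4]] := cvgZ e e0; exists N.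
Qed.

End Brownian.

(** * The increments of the signal in the two models *)

Section Signal.
Context d (T : measurableType d) (R : realType) (P : probability T R).
Variables (W : R -> {RV P >-> R}) (eps : nat -> nat -> {RV P >-> R}).
Hypothesis hW : brownian_motion W.
Hypothesis heps : noise W eps.
Local Notation mean := (mean P).
Local Notation integ := (integ P).
Local Notation L4 := (L4 P).

Let GW : set (set T) :=
  \bigcup_(i in (`[0, 1]%classic : set R)) preimage_set_system [set: T] (W i : T -> R) measurable.
Local Notation TW := (g_sigma_algebraType GW).

Let noise_vec n (j : 'I_n) : T -> R := eps n j.+1.

Let W_meas t : 0 <= t <= 1 -> measurable_fun [set: TW] (W t : TW -> R).
Proof.
move=> t01 _ B mB; apply: sub_sigma_algebra.
by exists t; [rewrite /= in_itv|exists B].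
Qed.

Lemma bm_sq_indep n (V : T -> R) : (16 < n)%N -> measurable_fun setT V ->
  measurable_fun [set: TW] (V : TW -> R) -> sq_indep P (@noise_vec n) V.
Proof.
move=> n16 mV mVW.
apply: (indep_systems_sq_indep _ mV (noise_indep_bm heps n16)).
- by move=> j; exact: measurable_funP.
- by move=> B mB; rewrite -[V @^-1` B]setTI; exact: mVW.
move=> B mB.
pose GE : set (set T) := \bigcup_(i in [set i | (0 < i <= n)%N])
  preimage_set_system [set: T] (eps n i : T -> R) measurable.
suff : measurable (\bigcap_(j in [set: 'I_n]) (@noise_vec n j @^-1` B j) :
  set (g_sigma_algebraType GE)) by [].
apply: fin_bigcap_measurable => // j _; apply: sub_sigma_algebra.
by exists j.+1; [rewrite /= ltn_ord|exists (B j) => //; rewrite setTI].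
Qed.

(** The common interface of the two models. Linear combinations are required because the
    coefficients of the noise in the cross term are such combinations of the increments. *)
Definition signal n (Z : nat -> T -> R) (K : R) : Prop :=
  [/\ forall i, (0 < i < n)%N -> L4 (Z i),
      forall i, (0 < i < n)%N -> mean (fun w => Z i w ^+ 4) <= K &
      forall a : nat -> R, sq_indep P (@noise_vec n)
        (fun w => \sum_(i < n.-1) a i * Z i.+1 w)].

Lemma sqr_sum_le m (F : 'I_m -> R) : (\sum_i F i) ^+ 2 <= m%:R * \sum_i F i ^+ 2.
Proof.
elim: m F => [|m IH] F; first by rewrite !big_ord0 expr0n mul0r.
case: m IH F => [|m] IH F; first by rewrite !big_ord1 mul1r.
rewrite !(big_ord_recr m.+1) /=.
have := IH (fun i => F (widen_ord (leqnSn m.+1) i)).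
move: (\sum_(i < m.+1) F _) (\sum_(i < m.+1) F _ ^+ 2) (F ord_max) => S Q x.
rewrite -[m.+2%:R]natr1.
have m0 : 0 < m.+1%:R :> R by rewrite ltr0n.
have : 0 <= (S - m.+1%:R * x) ^+ 2 / m.+1%:R by rewrite divr_ge0 ?sqr_ge0.
rewrite (_ : _ / _ = S ^+ 2 / m.+1%:R - 2 * S * x + m.+1%:R * x ^+ 2); last first.
  by field; rewrite gt_eqF.
move=> A B; have : S ^+ 2 / m.+1%:R <= Q by rewrite ler_pdivrMr// mulrC.
by move: A B; move: (S ^+ 2 / _) => y; nra.
Qed.

(** W starts at 0 only almost surely, so the moments are carried over from the increment between 0
    and [t] by equality of integrals. *)
Lemma bm_L4 t : 0 <= t <= 1 -> L4 (W t) /\ mean (fun w => W t w ^+ 4) <= 65 ^+ 2.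
Proof.
move=> /andP[t0 t1].
have [L _ _ M4] := bm_increment hW (lexx 0) t0 t1.
have m1 : measurable_fun setT (fun w => W t w ^+ 4).
  by apply: measurable_funX; exact: measurable_funP.
have E : (\int[P]_w (W t w ^+ 4)%:E = \int[P]_w ((W t w - W 0 w) ^+ 4)%:E)%E.
  apply: ge0_ae_eq_integral => //.
  - exact/measurable_EFinP.
  - by apply/measurable_EFinP/measurable_funX/measurable_funB; exact: measurable_funP.
  - by move=> w _; rewrite lee_fin pow4_ge0.
  - by move=> w _; rewrite lee_fin pow4_ge0.
  - apply: filterS (bm_start hW) => w W0 _.
    by rewrite W0 subr0.
have I : integ (fun w => W t w ^+ 4).
  apply: integ_lty => //; first by move=> w; exact: pow4_ge0.
  by rewrite E integ_mean ?ltry//; case: L.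
split; first by split => //; exact: measurable_funP.
rewrite -lee_fin -integ_mean// E integ_mean; last by case: L.
rewrite lee_fin; apply: le_trans M4 _; rewrite subr0 exprMn ler_piMr//.
by rewrite exprn_ile1.
Qed.

(** The approximating combinations are measurable for the sigma-algebra of W, hence independent of
    the noise; [sq_indep_limit] extends this to the given versions [X]. *)
Lemma wiener_signal n (f : R -> R) (M : R) (X : nat -> {RV P >-> R}) :
  (16 < n)%N ->
  measurable_fun (`[0, 1]%classic : set R) f ->
  0 < M -> (forall x, 0 <= x <= 1 -> f x ^+ 2 <= M) ->
  (forall i, (0 < i <= n)%N -> wiener_integral W f (i%:R / n%:R) (X i)) ->
  signal n (fun i w => X i.+1 w - X i w) (6 * (65 * (4 * M / n%:R)) ^+ 2).
Proof.
move=> n16 mf M0 fM WX.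
have n0 : 0 < n%:R :> R by rewrite ltr0n; exact: leq_trans n16.
have frac01 i : (i <= n)%N -> 0 <= (i%:R / n%:R : R) <= 1.
  by move=> i_n; rewrite divr_ge0//= ler_pdivrMr// mul1r ler_nat.
have ap i : (0 < i < n)%N -> exists Z, wiener_step_approx W (i%:R / n%:R) (i.+1%:R / n%:R)
    M (fun w => X i.+1 w - X i w) Z.
  move=> /andP[i0 i_n].
  have /andP[a0 _] := frac01 i (ltnW i_n); have /andP[_ b1] := frac01 _ i_n.
  apply: (wiener_increment_approx hW mf M0 fM a0 _ b1).
  - by rewrite ltr_pM2r ?invr_gt0// ltr_nat.
  - by apply: WX; rewrite i0 ltnW.
  - exact: WX.
have mX i : measurable_fun setT (fun w => X i.+1 w - X i w).
  by apply: measurable_funB; exact: measurable_funP.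
have hE i : i.+1%:R / n%:R - i%:R / n%:R = n%:R^-1 :> R.
  by rewrite -natr1; field; rewrite gt_eqF.
have L i : (0 < i < n)%N -> L4 (fun w => X i.+1 w - X i w) /\
    mean (fun w => (X i.+1 w - X i w) ^+ 4) <= 6 * (65 * (4 * M / n%:R)) ^+ 2.
  move=> /ap[Z hZ]; have := wiener_increment_L4 (mX i) hZ.
  by rewrite hE.
split; [by move=> i /L[]|by move=> i /L[]|move=> a].
have {}ap (i : 'I_n.-1) : exists Z, wiener_step_approx W (i.+1%:R / n%:R) (i.+2%:R / n%:R)
    M (fun w => X i.+2 w - X i.+1 w) Z.
  by apply: ap; have := ltn_ord i; lia.
have [Z HZ] := choice ap.
pose Vn k w := \sum_(i < n.-1) a i * Z i k w.
have LZ k i : L4 (Z i k) by case: (HZ i).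
have LV : L4 (fun w => \sum_(i < n.-1) a i * (X i.+2 w - X i.+1 w)).
  apply: L4_sum => i _; apply: L4Z.
  have hi : (0 < i.+1 < n)%N by have := ltn_ord i; lia.
  by case: (L _ hi).
have LVn k : L4 (Vn k) by apply: L4_sum => i _; exact: L4Z.
apply: (@sq_indep_limit _ _ _ _ _ _ _ _ Vn).
- by move=> j; exact: measurable_funP.
- exact: L4_measurable LV.
- exact: L4_sq.
- by move=> k; exact: L4_sq.
- by move=> k; exact: L4_measurable (LVn k).
- move=> e e0.
  (* The factor that Cauchy-Schwarz costs when the increments are combined with coefficients [a];
     the summand 1 keeps it positive. *)
  pose A := 1 + n.-1%:R * \sum_(i < n.-1) a i ^+ 2.
  have A0 : 0 < A.
    by rewrite /A ltr_wpDr// mulr_ge0// sumr_ge0// => i _; exact: sqr_ge0.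
  have eA : 0 < e / A by rewrite divr_gt0.
  have near (i : 'I_n.-1) : exists N, forall k, (N <= k)%N ->
      integ (fun w => (X i.+2 w - X i.+1 w - Z i k w) ^+ 2) /\
      mean (fun w => (X i.+2 w - X i.+1 w - Z i k w) ^+ 2) <= e / A.
    case: (HZ i) => _ _ /(_ _ eA)[N HN]; exists N => k /HN[I m _].
    by [].
  have [N HN] := choice near.
  pose k := (\max_(i < n.-1) N i)%N.
  have Nk (i : 'I_n.-1) : (N i <= k)%N by exact: leq_bigmax.
  have LD (i : 'I_n.-1) : L4 (fun w => X i.+2 w - X i.+1 w - Z i k w).
    apply: L4B => //; have hi : (0 < i.+1 < n)%N by have := ltn_ord i; lia.
    by case: (L _ hi).
  exists k; split.
    by apply: L4_sq; exact: L4B.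
  have bd w : (\sum_(i < n.-1) a i * (X i.+2 w - X i.+1 w) - Vn k w) ^+ 2 <=
      \sum_(i < n.-1) (n.-1%:R * a i ^+ 2) * (X i.+2 w - X i.+1 w - Z i k w) ^+ 2.
    rewrite /Vn -sumrB; under eq_bigr do rewrite -mulrBr.
    apply: le_trans (sqr_sum_le _) _; rewrite mulr_sumr; apply: ler_sum => i _.
    by rewrite exprMn mulrA.
  apply: le_trans (le_mean _ _ bd) _.
  - by apply: L4_sq; exact: L4B.
  - by apply: integ_sum => i _; apply: integZ; exact: L4_sq.
  rewrite mean_sum; last by move=> i _; apply: integZ; exact: L4_sq.
  apply: (@le_trans _ _ (\sum_(i < n.-1) (n.-1%:R * a i ^+ 2) * (e / A))).
    apply: ler_sum => i _; rewrite meanZ; last exact: L4_sq.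
    apply: ler_wpM2l; first by apply: mulr_ge0 => //; exact: sqr_ge0.
    by case: (HN i k (Nk i)).
  rewrite -mulr_suml -mulr_sumr mulrA ler_pdivrMr// mulrC ler_wpM2l ?(ltW e0)//.
  by rewrite /A lerDr.
move=> k; apply: bm_sq_indep => //; first exact: L4_measurable (LVn k).
apply: measurable_sum => i; apply: measurable_funM => //.
have [_ /(_ k)[m [p [b [pp ZE]]]] _] := HZ i.
rewrite (_ : Z i k = fun w => \sum_(l < m) b l * (W (p l.+1) w - W (p l) w)); last exact/funext.
apply: (@eq_measurable_fun _ _ TW _ _ (fun w => \sum_(l < m)
  if l \in 'I_m then b l * (W (p l.+1) w - W (p l) w) else 0)).
  by move=> w _; apply: eq_bigr.
case: pp => p0 pm p1.
have mono u v : (u <= v)%N -> (v <= m)%N -> p u <= p v.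
  elim: v => [|v IH]; first by rewrite leqn0 => /eqP ->.
  rewrite leq_eqVlt => /orP[/eqP -> //|uv vm].
  by apply: (le_trans (IH uv (ltnW vm))); exact: pm.
have p01 u : (u <= m)%N -> 0 <= p u <= 1.
  by move=> um; rewrite (le_trans p0 (mono 0%N u _ um))//= (le_trans (mono u m um _) p1).
apply: measurable_sum => l /=.
apply: measurable_funM => //; apply: measurable_funB; apply: W_meas; apply: p01.
  exact: ltn_ord.
exact: ltnW (ltn_ord l).
Qed.

(** The increment of [sg * W] is the old value of [sg] times the increment of W plus the increment
    of [sg] times the new value of W. The first has fourth moment of order [n ^ -2], the second of
    order [rho]. *)
Lemma bm_signal n (sg : R -> R) (M rho : R) : (16 < n)%N ->
  0 <= M -> (forall x, 0 <= x <= 1 -> sg x ^+ 2 <= M) ->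
  (forall i, (0 < i < n)%N -> (sg (i.+1%:R / n%:R) - sg (i%:R / n%:R)) ^+ 4 <= rho) ->
  signal n (fun i w => sg (i.+1%:R / n%:R) * W (i.+1%:R / n%:R) w
      - sg (i%:R / n%:R) * W (i%:R / n%:R) w)
    (8 * 65 ^+ 2 * (M ^+ 2 / n%:R ^+ 2 + rho)).
Proof.
move=> n16 M0 sM sr.
have n0 : 0 < n%:R :> R by rewrite ltr0n; exact: leq_trans n16.
have frac01 i : (i <= n)%N -> 0 <= (i%:R / n%:R : R) <= 1.
  by move=> i_n; rewrite divr_ge0//= ler_pdivrMr// mul1r ler_nat.
have L i : (i < n)%N -> L4 (fun w => sg (i.+1%:R / n%:R) * W (i.+1%:R / n%:R) w
      - sg (i%:R / n%:R) * W (i%:R / n%:R) w).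
  move=> i_n; apply: L4B; apply: L4Z.
    by case: (bm_L4 (frac01 _ i_n)).
  by case: (bm_L4 (frac01 _ (ltnW i_n))).
split.
- by move=> i /andP[_ i_n]; exact: L.
- move=> i /andP[i0 i_n].
  have /andP[a0 a1] := frac01 _ (ltnW i_n); have /andP[b0 b1] := frac01 _ i_n.
  have ab : i%:R / n%:R <= i.+1%:R / n%:R :> R by rewrite ler_pM2r ?invr_gt0// ler_nat.
  have [Ld _ _ Md] := bm_increment hW a0 ab b1.
  have [LW MW] := bm_L4 (frac01 _ i_n).
  set s1 := sg (i.+1%:R / n%:R); set s0 := sg (i%:R / n%:R).
  have bd w : (s1 * W (i.+1%:R / n%:R) w - s0 * W (i%:R / n%:R) w) ^+ 4 <=
      8 * s0 ^+ 4 * (W (i.+1%:R / n%:R) w - W (i%:R / n%:R) w) ^+ 4 +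
      8 * (s1 - s0) ^+ 4 * W (i.+1%:R / n%:R) w ^+ 4.
    have := pow4D_le (s0 * (W (i.+1%:R / n%:R) w - W (i%:R / n%:R) w))
      ((s1 - s0) * W (i.+1%:R / n%:R) w).
    rewrite !exprMn (_ : s0 * _ + _ = s1 * W (i.+1%:R / n%:R) w - s0 * W (i%:R / n%:R) w).
      by rewrite mulrDr !mulrA.
    by ring.
  have [_ I1] := L i i_n; have [_ Id] := Ld; have [_ IW] := LW.
  apply: le_trans (le_mean I1 _ bd) _; first by apply: integD; exact: integZ.
  rewrite meanD; [|exact: integZ|exact: integZ].
  rewrite !meanZ//.
  have s04 : s0 ^+ 4 <= M ^+ 2.
    rewrite -[4%N]/(2 * 2)%N exprM ler_sqr ?nnegrE ?sqr_ge0//.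
    by apply: sM; rewrite a0.
  have hE : i.+1%:R / n%:R - i%:R / n%:R = n%:R^-1 :> R.
    by rewrite -natr1; field; rewrite gt_eqF.
  rewrite hE in Md.
  have q0 : 0 <= mean (fun w => (W (i.+1%:R / n%:R) w - W (i%:R / n%:R) w) ^+ 4).
    by apply: mean_ge0 => w; exact: pow4_ge0.
  have q1 : 0 <= mean (fun w => W (i.+1%:R / n%:R) w ^+ 4).
    by apply: mean_ge0 => w; exact: pow4_ge0.
  have A : s0 ^+ 4 * mean (fun w => (W (i.+1%:R / n%:R) w - W (i%:R / n%:R) w) ^+ 4) <=
      M ^+ 2 * (65 * n%:R^-1) ^+ 2.
    by apply: ler_pM => //; exact: pow4_ge0.
  have B : (s1 - s0) ^+ 4 * mean (fun w => W (i.+1%:R / n%:R) w ^+ 4) <= rho * 65 ^+ 2.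
    by apply: ler_pM => //; [exact: pow4_ge0|apply: sr; rewrite i0].
  have -> : 8 * 65 ^+ 2 * (M ^+ 2 / n%:R ^+ 2 + rho) =
    8 * (M ^+ 2 * (65 * n%:R^-1) ^+ 2) + 8 * (rho * 65 ^+ 2).
    by field; rewrite gt_eqF.
  by rewrite -2!(mulrA 8) lerD// ler_pM2l.
- move=> a; apply: bm_sq_indep => //.
    have LS : L4 (fun w => \sum_(i < n.-1) a i * (sg (i.+2%:R / n%:R) * W (i.+2%:R / n%:R) w
      - sg (i.+1%:R / n%:R) * W (i.+1%:R / n%:R) w)).
      by apply: L4_sum => i _; apply: L4Z; apply: L; have := ltn_ord i; lia.
    exact: L4_measurable LS.
  apply: measurable_sum => i; apply: measurable_funM => //.
  by apply: measurable_funB; apply: measurable_funM => //; apply: W_meas; apply: frac01;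
    have := ltn_ord i; lia.
Qed.

Lemma observations_signal n (M : model) (s2 t2 : R -> R) (Y : nat -> T -> R) (smax rho : R) :
  (16 < n)%N -> observations W eps M n s2 t2 Y ->
  0 < smax -> measurable_fun (`[0, 1]%classic : set R) s2 ->
  (forall x, 0 <= x <= 1 -> 0 <= s2 x <= smax) -> 0 <= rho ->
  (M = ModelII -> forall i, (0 < i < n)%N ->
     (Num.sqrt (s2 (i.+1%:R / n%:R)) - Num.sqrt (s2 (i%:R / n%:R))) ^+ 4 <= rho) ->
  exists Z, signal n Z (96 * 65 ^+ 2 * (smax ^+ 2 / n%:R ^+ 2 + rho)) /\
    forall i w, (0 < i < n)%N -> Y i.+1 w - Y i w = Z i w +
      (Num.sqrt (t2 (i.+1%:R / n%:R)) * eps n i.+1 w - Num.sqrt (t2 (i%:R / n%:R)) * eps n i w).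
Proof.
move=> n16 obs smax0 ms2 s2b rho0 hrho.
have n0 : 0 < n%:R :> R by rewrite ltr0n; exact: leq_trans n16.
have sq x : 0 <= x <= 1 -> Num.sqrt (s2 x) ^+ 2 <= smax.
  by move=> /s2b/andP[a b]; rewrite sqr_sqrtr.
have K0 : 0 <= smax ^+ 2 / n%:R ^+ 2 by rewrite divr_ge0 ?sqr_ge0.
have weaken Z K : signal n Z K -> K <= 96 * 65 ^+ 2 * (smax ^+ 2 / n%:R ^+ 2 + rho) ->
    signal n Z (96 * 65 ^+ 2 * (smax ^+ 2 / n%:R ^+ 2 + rho)).
  by case=> a b c h; split => // i hi; exact: le_trans (b i hi) h.
case: M obs hrho => obs hrho.
  have WX i : exists X : {RV P >-> R}, (0 < i <= n)%N ->
      wiener_integral W (fun x => Num.sqrt (s2 x)) (i%:R / n%:R) X /\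
      forall w, Y i w = X w + Num.sqrt (t2 (i%:R / n%:R)) * eps n i w.
    (* A total family is needed for [choice]; [W 0] is a default value outside the range of
       observations. *)
    have [hi|hi] := boolP (0 < i <= n)%N; last by exists (W 0).
    by have [X h1 h2] := obs i hi; exists X.
  have [X HX] := choice WX.
  exists (fun i w => X i.+1 w - X i w); split.
    apply: weaken (wiener_signal n16 _ smax0 sq (fun i hi => proj1 (HX i hi))) _.
      apply: (measurableT_comp _ ms2); apply: continuous_measurable_fun.
      exact: sqrt_continuous.
    (* The constant of Model (I), [6 * 4 ^ 2 = 96], exceeds the 8 of Model (II) and serves both. *)
    have -> : 6 * (65 * (4 * smax / n%:R)) ^+ 2 = 96 * 65 ^+ 2 * (smax ^+ 2 / n%:R ^+ 2).
      by field; rewrite gt_eqF.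
    by rewrite ler_pM2l ?lerDl// mulr_gt0// exprn_gt0.
  move=> i w /andP[i0 i_n].
  have [_ ->] := HX i.+1 i_n; have hi : (0 < i <= n)%N by rewrite i0 ltnW.
  by have [_ ->] := HX i hi; ring.
exists (fun i w => Num.sqrt (s2 (i.+1%:R / n%:R)) * W (i.+1%:R / n%:R) w
      - Num.sqrt (s2 (i%:R / n%:R)) * W (i%:R / n%:R) w); split.
  apply: weaken (bm_signal n16 (ltW smax0) sq (hrho erefl)) _.
  by apply: ler_wpM2r; [exact: addr_ge0|lra].
move=> i w /andP[i0 i_n]; rewrite (obs i.+1 i_n) (obs i); last by rewrite i0 ltnW.
by ring.
Qed.

End Signal.

(** * Elementary inequalities for sines, cosines and power sums *)

Section Elementary.
Context {R : realType}.
Implicit Types (x y z s : R).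

Lemma sin_mvt z : 0 < z -> exists2 c, 0 < c < z & sin z = z * cos c.
Proof.
move=> z0.
have [c cz E] := MVT z0 (fun x _ => is_derive_sin x)
  (continuous_subspaceT (@continuous_sin R)).
exists c; first by move: cz; rewrite in_itv.
by move: E; rewrite sin0 !subr0 mulrC.
Qed.

Lemma norm_sin_le z : `|sin z| <= `|z|.
Proof.
wlog z0 : z / 0 <= z.
  move=> H; have [z0|/ltW z0] := leP 0 z; first exact: H.
  by have := H (- z); rewrite sinN !normrN oppr_ge0; exact.
move: z0; rewrite le_eqVlt => /orP[/eqP <-|z0]; first by rewrite sin0 normr0.
have [c _ ->] := sin_mvt z0.
by rewrite normrM ler_piMr// cos_max.
Qed.

(** A weak form of Jordan's inequality. Up to 1 the mean value theorem gives [sin z >= z * cos 1];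
    beyond 1 the sine is at least [sin 1 >= cos 1], and [z <= pi / 2 < 2]. *)
Lemma sin_ge_lin z : 0 <= z <= pi / 2 -> cos 1 / 2 * z <= sin z.
Proof.
move=> /andP[+ zpi]; rewrite le_eqVlt => /orP[/eqP <-|z0].
  by rewrite mulr0 sin0.
have c1 : 0 < cos 1 :> R by exact: cos1_gt0.
have pi1 := pihalf_ge1 R.
have pi2 := pi_ge2 R.
have mono_cos x : 0 < x < 1 -> cos 1 <= cos x :> R.
  move=> /andP[x0 x1]; apply/ltW; rewrite ltr_cos// in_itv/=; lra.
have small x : 0 < x -> x <= 1 -> cos 1 * x <= sin x.
  move=> x0 x1; have [c /andP[c0 cx] ->] := sin_mvt x0.
  rewrite mulrC ler_wpM2l//; first exact: ltW.
  by apply: mono_cos; rewrite c0 (lt_le_trans cx x1).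
have [z1|z1] := leP z 1; first by have := small z z0 z1; nra.
have := small 1 ltr01 (lexx 1).
have : sin 1 < sin z.
  by rewrite ltr_sin// in_itv/=; lra.
have := pihalf_lt2 R; nra.
Qed.

Lemma cos_sub_le x y : `|cos x - cos y| <= `|x - y|.
Proof.
have -> : cos x - cos y = - (2 * sin ((x + y) / 2) * sin ((x - y) / 2)).
  have -> : cos x = cos ((x + y) / 2 + (x - y) / 2) by congr cos; field.
  have -> : cos y = cos ((x + y) / 2 - (x - y) / 2) by congr cos; field.
  by rewrite cosD cosB; ring.
rewrite normrN !normrM (ger0_norm (ler0n R 2)).
have := norm_sin_le ((x - y) / 2); rewrite normrM (ger0_norm (_ : 0 <= 2^-1)) ?invr_ge0//.
have := sin_max ((x + y) / 2); have := normr_ge0 (sin ((x + y) / 2)).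
have := normr_ge0 (sin ((x - y) / 2)); nra.
Qed.

(** Interpolates between the Lipschitz bound, used when [|x - y| < 1], and the trivial bound 2. *)
Lemma cos_sub_holder x y (g : R) : 0 <= g <= 1 ->
  `|cos x - cos y| <= 2 * `|x - y| `^ g.
Proof.
move=> /andP[g0 g1]; set z := `|x - y|; have z0 : 0 <= z by exact: normr_ge0.
have [z1|z1] := leP 1 z.
  apply: (@le_trans _ _ 2).
    apply: le_trans (ler_normB _ _) _.
    by have := cos_max x; have := cos_max y; lra.
  rewrite ler_peMr//.
  by have := ler_powR z1 g0; rewrite powRr0.
apply: le_trans (cos_sub_le x y) _; rewrite -/z.
have zg : 0 <= z `^ g by exact: powR_ge0.
move: z0; rewrite le_eqVlt => /orP[/eqP <-|z0]; first by rewrite mulr_ge0 ?powR_ge0.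
have : z <= z `^ g by apply: ger1_powR => //; rewrite z0 ltW.
lra.
Qed.

(** The discrete counterpart of integrating a power: the quotient of the two powers is the
    exponential of [p * ln ((i + 1) / i)], and this logarithm is at least [1 / (i + 1)]. *)
Lemma powRN_telescope (i : nat) (p : R) : 0 < p -> (0 < i)%N ->
  p * i.+1%:R `^ (- (1 + p)) <= i%:R `^ (- p) - i.+1%:R `^ (- p).
Proof.
move=> p0 i0.
have a0 : 0 < i%:R :> R by rewrite ltr0n.
have b0 : 0 < i.+1%:R :> R by rewrite ltr0n.
have pw x r : 0 < x -> x `^ r = expR (r * ln x) by move=> x0; rewrite /powR gt_eqF.
have -> : i.+1%:R `^ (- (1 + p)) = i.+1%:R `^ (- p) / i.+1%:R :> R.
  rewrite !pw// (_ : - (1 + p) * ln i.+1%:R = - p * ln i.+1%:R + - ln i.+1%:R); last by ring.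
  by rewrite expRD expRN lnK.
have -> : i%:R `^ (- p) = i.+1%:R `^ (- p) * expR (p * (ln i.+1%:R - ln i%:R)) :> R.
  by rewrite !pw// -expRD; congr expR; ring.
have H : i.+1%:R^-1 <= ln i.+1%:R - ln i%:R :> R.
  have : ln (1 + (- i.+1%:R^-1)) <= - i.+1%:R^-1 :> R.
    by apply: le_ln1Dx; rewrite ltrN2 invf_lt1// ltr1n.
  have -> : 1 + - i.+1%:R^-1 = i%:R / i.+1%:R :> R.
    by rewrite -natr1; field; rewrite natr1 gt_eqF.
  by rewrite ln_div ?posrE//; move: (ln _) (ln _) (_^-1) => u v t; lra.
have := expR_ge1Dx (p * (ln i.+1%:R - ln i%:R)); set E := expR _ => HE.
have c0 : 0 < i.+1%:R `^ (- p) :> R by exact: powR_gt0.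
have : p * i.+1%:R^-1 <= p * (ln i.+1%:R - ln i%:R) by rewrite ler_wpM2l// ltW.
move: HE; set L := p * (ln _ - _) => HE HL.
have -> : p * (i.+1%:R `^ (- p) / i.+1%:R) = i.+1%:R `^ (- p) * (p * i.+1%:R^-1) by ring.
rewrite -{3}[_ `^ _]mulr1 -mulrBr ler_wpM2l ?(ltW c0)//; apply: le_trans HL _; lra.
Qed.

Lemma sum_powRN_le (m : nat) s : 1 < s ->
  \sum_(1 <= i < m.+1) i%:R `^ (- s) <= 1 + (s - 1)^-1.
Proof.
move=> s1; have p0 : 0 < s - 1 by rewrite subr_gt0.
suff H k : \sum_(1 <= i < k.+2) i%:R `^ (- s) <= 1 + (s - 1)^-1 - (s - 1)^-1 * k.+1%:R `^ (- (s - 1)).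
  case: m => [|m]; first by rewrite big_geq// addr_ge0// invr_ge0 ltW.
  by apply: le_trans (H m) _; rewrite lerBlDr lerDl mulr_ge0 ?powR_ge0// invr_ge0 ltW.
elim: k => [|k IH].
  by rewrite big_nat1 !powR1 mulr1 addrK.
rewrite big_nat_recr//=.
have := powRN_telescope p0 (ltn0Sn k).
rewrite (_ : 1 + (s - 1) = s); last by ring.
move=> H; have : k.+2%:R `^ (- s) <= (s - 1)^-1 * (k.+1%:R `^ (- (s - 1)) - k.+2%:R `^ (- (s - 1))).
  by rewrite ler_pdivlMl.
by move: IH; lra.
Qed.

End Elementary.

(** * Cosine series *)

Section CosineSeries.
Context {R : realType}.
Local Notation mu := (@lebesgue_measure R).
(* Integration over [0, 1] as expectation under the uniform law. *)
Local Notation U := (uniform_prob (@ltr01 R)).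
Local Notation mean := (mean U).
Local Notation integ := (integ U).
Implicit Types (i j k N m : nat) (psi theta : nat -> R).

Lemma integral_unit (g : R -> \bar R) : measurable_fun setT g ->
  (forall x, 0 <= g x)%E ->
  (\int[U]_x g x = \int[mu]_(x in `[0%R, 1%R]) g x)%E.
Proof.
by move=> mg g0; rewrite integral_uniform// subr0 invr1 mul1e.
Qed.

Definition cosb (i : nat) (x : R) : R := cos (i%:R * pi * x).

Lemma continuous_cosb i : continuous (cosb i).
Proof.
move=> x; apply: continuous_comp; last exact: continuous_cos.
by apply: cvgM; [exact: cvg_cst|exact: cvg_id].
Qed.

Lemma measurable_cosb i (D : set R) : measurable_fun D (cosb i : R -> R).
Proof. by apply: measurable_funTS; apply: continuous_measurable_fun; exact: continuous_cosb. Qed.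

Lemma cosb_norm i x : `|cosb i x| <= 1. Proof. exact: cos_max. Qed.

Lemma integ_bounded_fun (f : R -> R) (c : R) : measurable_fun setT f ->
  (forall x, `|f x| <= c) -> integ f.
Proof. by move=> mf fc; apply: (@integ_le _ _ _ U f (fun=> c) mf fc); exact: integ_cst. Qed.

Lemma integ_cosb i : integ (cosb i).
Proof. by apply: integ_bounded_fun (cosb_norm i); exact: measurable_cosb. Qed.

Lemma mean_cosb i : mean (cosb i) = (i == 0)%:R.
Proof.
have [->|i0] := eqVneq i 0.
  by rewrite -[RHS](mean_cst U 1); apply: eq_mean => x; rewrite /cosb !mul0r cos0.
have ip : (i%:R * pi : R) != 0 by rewrite mulf_neq0 ?pnatr_eq0// gt_eqF ?pi_gt0.
(* A primitive of 1 plus the cosine: the added constant makes the integrand nonnegative, as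
   [integral_unit] requires. *)
pose F (x : R) := x + (i%:R * pi)^-1 * sin (i%:R * pi * x).
pose f (x : R) := 1 + cosb i x.
have F1 (x : R) : is_derive x (1 : R) F (f x).
  rewrite /f /cosb.
  have -> : 1 + cos (i%:R * pi * x) =
      1 + (i%:R * pi)^-1 *: (cos (i%:R * pi * x) * (i%:R * pi)).
    congr (_ + _); rewrite -[RHS]/((i%:R * pi)^-1 * (cos (i%:R * pi * x) * (i%:R * pi))).
    by rewrite mulrCA mulVf ?mulr1.
  apply: is_deriveD; apply: is_deriveZ.
  apply: (@is_derive1_comp _ sin (fun y => i%:R * pi * y)).
  have H0 := is_deriveZ (i%:R * pi) (is_derive_id x (1 : R)).
  rewrite -[X in is_derive _ _ _ X]mulr1; exact: H0.
have cf : {within `[0, 1], continuous f}.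
  apply: continuous_subspaceT => x; apply: cvgD; first exact: cvg_cst.
  exact: continuous_cosb.
have cF : continuous F.
  by move=> x; apply: differentiable_continuous; apply/derivable1_diffP; case: (F1 x).
have dF : derivable_oo_LRcontinuous F 0 1.
  split.
  - by move=> x _; case: (F1 x).
  - by apply: cvg_at_right_filter; exact: cF.
  - by apply: cvg_at_left_filter; exact: cF.
have dFf : {in `]0, 1[, derive1 F =1 f}.
  by move=> x _; rewrite derive1E; have F1x := F1 x; rewrite derive_val.
have H := continuous_FTC2 ltr01 cf dF dFf.
have If : integ f by apply: integD; [exact: integ_cst|exact: integ_cosb].
have f0 x : 0 <= f x.
  by have := cosb_norm i x; rewrite ler_norml /f => /andP[]; lra.
have mf : measurable_fun setT (EFin \o f).
  by apply/measurable_EFinP; exact: integ_measurable If.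
have : (\int[U]_x (f x)%:E = 1%:E)%E.
  rewrite integral_unit//.
  rewrite H.
  rewrite /F !mulr0 !mulr1 sin0 mulr0 addr0 sin_natpi mulr0 addr0.
  by rewrite -EFinB subr0.
rewrite integ_mean// => -[]; rewrite /f meanD; [|exact: integ_cst|exact: integ_cosb].
by rewrite mean_cst => h; apply: (@addrI _ 1); rewrite addr0 -[RHS]h.
Qed.

Lemma cosbM i j x : (j <= i)%N ->
  cosb i x * cosb j x = (cosb (i - j) x + cosb (i + j) x) / 2.
Proof.
move=> ji; rewrite /cosb cos_cos -mulrBl -mulrDl -mulrBl -mulrDl.
by rewrite natrB// natrD.
Qed.

Lemma integ_cosbM i j : integ (fun x => cosb i x * cosb j x).
Proof.
apply: (@integ_bounded_fun _ 1).
  by apply: measurable_funM; exact: measurable_cosb.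
by move=> x; rewrite normrM -[leRHS]mulr1 ler_pM// cosb_norm.
Qed.

Lemma mean_cosbM i j : mean (fun x => cosb i x * cosb j x) =
  (i == j)%:R * (if i == 0%N then 1 else 2^-1).
Proof.
wlog ji : i j / (j <= i)%N.
  move=> H; have [ji|/ltnW ij] := leqP j i; first exact: H.
  transitivity (mean (fun x => cosb j x * cosb i x)).
    by apply: eq_mean => x; rewrite mulrC.
  by rewrite H// eq_sym; have [->|] := eqVneq i j; rewrite ?mul0r.
transitivity (mean (fun x => 2^-1 * (cosb (i - j) x + cosb (i + j) x))).
  by apply: eq_mean => x; rewrite cosbM// mulrC.
rewrite meanZ; last by apply: integD; exact: integ_cosb.
rewrite meanD; [|exact: integ_cosb|exact: integ_cosb].
rewrite !mean_cosb; have [->|ij] := eqVneq i j.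
  rewrite subnn addnn double_eq0 mul1r eqxx; case: (j == 0%N) => /=; last by rewrite addr0 mulr1.
  by field.
rewrite subn_eq0 leqNgt ltn_neqAle eq_sym ij ji /= add0r addn_eq0.
by case: (i =P 0%N) ij ji => [-> |]; rewrite ?mul0r ?mulr0//; case: j => //=; rewrite ?mul0r ?mulr0.
Qed.

Definition cos_coef theta i : R := if i == 0%N then theta 0%N else 2 * theta i.

Lemma cosine_sumE theta m x :
  cosine_sum theta m x = \sum_(i < m.+1) cos_coef theta i * cosb i x.
Proof.
rewrite /cosine_sum big_ord_recl /= /cosb !mul0r cos0 mulr1; congr (_ + _).
rewrite big_add1 big_mkord /= mulr_sumr; apply: eq_bigr => i _.
by rewrite /cos_coef /= mulrA.
Qed.

Lemma cosine_sumB theta psi m x :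
  cosine_sum theta m x - cosine_sum psi m x = cosine_sum (fun i => theta i - psi i) m x.
Proof.
rewrite /cosine_sum; under [in RHS]eq_bigr do rewrite mulrBl.
by rewrite sumrB; ring.
Qed.

Lemma measurable_cosine_sum theta m (D : set R) :
  measurable_fun D (cosine_sum theta m : R -> R).
Proof.
rewrite (_ : cosine_sum theta m = fun x => \sum_(i < m.+1) cos_coef theta i * cosb i x).
  by apply: measurable_sum => i; apply: measurable_funM => //; exact: measurable_cosb.
by apply/funext => x; rewrite cosine_sumE.
Qed.

Lemma cosine_sum_bounded theta m :
  exists c, forall x, `|cosine_sum theta m x| <= c.
Proof.
exists (\sum_(i < m.+1) `|cos_coef theta i|) => x; rewrite cosine_sumE.
apply: le_trans (ler_norm_sum _ _ _) _; apply: ler_sum => i _.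
by rewrite normrM ler_piMr// cosb_norm.
Qed.

Lemma integ_cosine_sum_sq theta m : integ (fun x => cosine_sum theta m x ^+ 2).
Proof.
have [c hc] := cosine_sum_bounded theta m.
apply: (@integ_bounded_fun _ (c ^+ 2)).
  by apply: measurable_funX; exact: measurable_cosine_sum.
move=> x; rewrite normrX ler_sqr ?nnegrE//.
by apply: le_trans (hc x).
Qed.

(** The factor 2 in the series compensates the mean 1/2 of a squared cosine, so that [theta k] is
    the integral against [cosb k] for every [k], including 0. *)
Lemma mean_cosine_sum_cosb theta m k : (k <= m)%N ->
  mean (fun x => cosine_sum theta m x * cosb k x) = theta k.
Proof.
move=> km.
transitivity (mean (fun x => \sum_(i < m.+1) cos_coef theta i * (cosb i x * cosb k x))).
  apply: eq_mean => x; rewrite cosine_sumE mulr_suml.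
  by apply: eq_bigr => i _; rewrite mulrA.
rewrite mean_sum; last by move=> i _; exact/integZ/integ_cosbM.
have km1 : (k < m.+1)%N by [].
rewrite (bigD1 (Ordinal km1))//= big1 ?addr0.
  rewrite meanZ; last exact: integ_cosbM.
  rewrite mean_cosbM eqxx mul1r /cos_coef; case: eqP => [->|_]; first by rewrite mulr1.
  by field.
move=> i ik; rewrite meanZ; last exact: integ_cosbM.
by rewrite mean_cosbM (_ : (i == k :> nat) = false) ?mul0r ?mulr0//; apply/negbTE.
Qed.

Lemma mean_cosine_sum_sq theta m :
  mean (fun x => cosine_sum theta m x ^+ 2) =
  theta 0%N ^+ 2 + 2 * \sum_(1 <= i < m.+1) theta i ^+ 2.
Proof.
transitivity (mean (fun x => \sum_(i < m.+1) cos_coef theta i * (cosine_sum theta m x * cosb i x))).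
  apply: eq_mean => x; rewrite expr2 {2}cosine_sumE mulr_sumr.
  by apply: eq_bigr => i _; ring.
have I i : integ (fun x => cosine_sum theta m x * cosb i x).
  have [c hc] := cosine_sum_bounded theta m.
  apply: (@integ_bounded_fun _ c).
    by apply: measurable_funM; [exact: measurable_cosine_sum|exact: measurable_cosb].
  move=> x; rewrite normrM -[leRHS]mulr1 ler_pM//; exact: cosb_norm.
rewrite mean_sum; last by move=> i _; exact: integZ.
rewrite big_ord_recl /= meanZ// mean_cosine_sum_cosb// /cos_coef /= -expr2.
congr (_ + _); rewrite big_add1 big_mkord /= mulr_sumr; apply: eq_bigr => i _.
rewrite meanZ// mean_cosine_sum_cosb; first by rewrite expr2 mulrA.
by rewrite /= /bump /= add1n ltn_ord.
Qed.

End CosineSeries.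

(** * Means over the unit interval and Riemann sums *)

Section UnitInterval.
Context {R : realType}.
Local Notation mu := (@lebesgue_measure R).
Local Notation U := (uniform_prob (@ltr01 R)).
Local Notation mean := (mean U).
Local Notation integ := (integ U).

Lemma mean_unit_eq (f g : R -> R) : measurable_fun setT f -> measurable_fun setT g ->
  (forall x, 0 <= x <= 1 -> f x = g x) -> mean f = mean g.
Proof.
move=> mf mg fg; rewrite unlock; congr fine; apply: ae_eq_integral => //.
- exact/measurable_EFinP.
- exact/measurable_EFinP.
have m01 : measurable (`[0, 1]%classic : set R) by exact: measurable_itv.
exists (~` `[0, 1]%classic); split.
- exact: measurableC.
- rewrite -[LHS]/(uniform_prob (@ltr01 R) _) /uniform_prob integral_uniform_pdf.
  by rewrite setICl integral_set0.
- by move=> x /= h x01; apply: h => _; rewrite fg.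
Qed.

Lemma le_mean_unit (f g : R -> R) : integ f -> integ g ->
  (forall x, 0 <= x <= 1 -> f x <= g x) -> mean f <= mean g.
Proof.
move=> If Ig fg.
pose I : R -> R := \1_(`[0, 1]%classic).
have mI : measurable_fun setT I by apply: measurable_indic; exact: measurable_itv.
have I1 x : 0 <= x <= 1 -> I x = 1.
  by move=> h; rewrite /I indicE mem_set//= in_itv.
have I0 x : ~ (0 <= x <= 1) -> I x = 0.
  by move=> h; rewrite /I indicE memNset//= in_itv.
have mf := integ_measurable If; have mg := integ_measurable Ig.
have IfI (h : R -> R) : integ h -> integ (fun x => h x * I x).
  move=> Ih; apply: (integ_le _ _ (integ_norm Ih)).
    by apply: measurable_funM => //; exact: integ_measurable Ih.
  by move=> x; rewrite normrM ler_piMr// /I indicE; case: (_ \in _); rewrite /= ?normr0 ?normr1.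
rewrite (mean_unit_eq (g := fun x => f x * I x))//; [|exact: measurable_funM|by move=> x /I1 ->; rewrite mulr1].
rewrite (mean_unit_eq (f := g) (g := fun x => g x * I x))//; [|exact: measurable_funM|by move=> x /I1 ->; rewrite mulr1].
apply: le_mean; [exact: IfI|exact: IfI|move=> x].
have [h|h] := pselect (0 <= x <= 1); first by rewrite (I1 x h) !mulr1 fg.
by rewrite (I0 x h) !mulr0.
Qed.

Lemma mean_le_ind (a : R) : 0 <= a <= 1 -> mean (fun x => (x <= a)%R%:R) = a.
Proof.
move=> /andP[a0 a1].
have E : (fun x => (x <= a)%R%:R) = \1_(`]-oo, a]%classic) :> (R -> R).
  by apply/funext => x; rewrite indicE mem_setE in_itv.
have mA : measurable (`]-oo, a]%classic : set R) by exact: measurable_itv.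
have m1 : measurable_fun setT (\1_(`]-oo, a]%classic) : R -> R) by exact: measurable_indic.
have I : integ \1_(`]-oo, a]%classic).
  apply: (integ_bounded_fun (c := 1)) => // x.
  by rewrite indicE; case: (_ \in _); rewrite /= ?normr0 ?normr1.
apply: EFin_inj; rewrite E -integ_mean// integral_unit//; last first.
  exact/measurable_EFinP.
rewrite integral_indic//=.
rewrite (_ : _ `&` _ = `[0, a]%classic); last first.
  rewrite eqEsubset; split => x /=; rewrite !in_itv/=.
    by move=> [xa /andP[x0 _]]; rewrite x0.
  by move=> /andP[x0 xa]; split => //; rewrite x0 (le_trans xa a1).
rewrite lebesgue_measure_itv/= lte_fin.
move: a0; rewrite le_eqVlt => /orP[/eqP <-|->]; first by rewrite ltxx.
by rewrite -EFinB subr0.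
Qed.

Lemma measurable_le_ind (a : R) : measurable_fun setT (fun x : R => (x <= a)%R%:R : R).
Proof.
rewrite (_ : (fun x => (x <= a)%R%:R) = \1_(`]-oo, a]%classic)).
  by apply: measurable_indic; exact: measurable_itv.
by apply/funext => x; rewrite indicE mem_setE in_itv.
Qed.

(** The Riemann sum is the mean of the step function [S] with the value of [g] at the right end of
    each cell, which differs from [g] by at most [om] at each point. *)
Lemma riemann_sum (n : nat) (g : R -> R) (h : R -> R) (om : R) : (0 < n)%N ->
  integ h -> (forall x : R, 0 <= x <= 1 -> h x = g x) ->
  (forall x y : R, 0 <= x <= 1 -> 0 <= y <= 1 -> `|x - y| <= n%:R^-1 -> `|g x - g y| <= om) ->
  `|n%:R^-1 * \sum_(c < n) g (c.+1%:R / n%:R) - mean h| <= om.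
Proof.
move=> n0 Ih hg gom.
have nn0 : 0 < n%:R :> R by rewrite ltr0n.
have om0 : 0 <= om.
  by apply: le_trans (gom 0 0 _ _ _); rewrite ?lexx ?ler01 ?subrr ?normr0 ?invr_ge0 ?ler0n.
have frac01 i : (i <= n)%N -> 0 <= (i%:R / n%:R : R) <= 1.
  by move=> i_n; rewrite divr_ge0//= ler_pdivrMr// mul1r ler_nat.
(* The value 0 at [i = 0] puts the point 0 into the first cell, so that the functions [psi c] add up
   to 1 on all of the closed interval. *)
pose ind i (x : R) : R := if i == 0%N then 0 else (x <= i%:R / n%:R)%R%:R.
have mind i : measurable_fun setT (ind i).
  by rewrite /ind; case: eqP => _ //; exact: measurable_le_ind.
have Iind i : integ (ind i).
  apply: (integ_bounded_fun (c := 1)) => // x; rewrite /ind; case: eqP => _; first by rewrite normr0.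
  by case: (x <= _); rewrite /= ?normr0 ?normr1.
have Mind i : (i <= n)%N -> mean (ind i) = i%:R / n%:R.
  move=> i_n; rewrite /ind; case: eqP => [->|_]; first by rewrite mul0r mean_cst.
  exact/mean_le_ind/frac01.
pose psi (c : nat) x := ind c.+1 x - ind c x.
have Ipsi c : integ (psi c) by exact: integB.
pose S x := \sum_(c < n) g (c.+1%:R / n%:R) * psi c x.
have IS : integ S by apply: integ_sum => c _; exact: integZ.
have MS : mean S = n%:R^-1 * \sum_(c < n) g (c.+1%:R / n%:R).
  rewrite /S mean_sum; last by move=> c _; exact: integZ.
  rewrite mulr_sumr; apply: eq_bigr => c _; rewrite meanZ// mulrC; congr (_ * _).
  rewrite meanB// !Mind//; [|exact: ltnW (ltn_ord c)].
  by rewrite -natr1; field; rewrite gt_eqF.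
have bd x : 0 <= x <= 1 -> `|S x - h x| <= om.
  move=> x01; have /andP[x0 x1] := x01; rewrite hg//.
  have psi0 c : (c < n)%N -> 0 <= psi c x.
    move=> cn; rewrite /psi /ind /=; case: eqP => _; first by rewrite subr0 ler0n.
    have : (x <= c%:R / n%:R) ==> (x <= c.+1%:R / n%:R)%R.
      apply/implyP => h1; apply: le_trans h1 _.
      by rewrite ler_pM2r ?invr_gt0// ler_nat.
    by case: (x <= c%:R / n%:R); case: (x <= c.+1%:R / n%:R) => //=; rewrite ?subrr ?subr0.
  have psi1 c : (c < n)%N -> psi c x != 0 -> `|x - c.+1%:R / n%:R| <= n%:R^-1.
    move=> cn; rewrite /psi /ind /= => p0.
    have hE : c%:R / n%:R = c.+1%:R / n%:R - n%:R^-1 :> R.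
      by rewrite -natr1; field; rewrite gt_eqF.
    have [h1|h1] := leP x (c.+1%:R / n%:R); last first.
      have h2 : c%:R / n%:R < x by apply: le_lt_trans h1; rewrite ler_pM2r ?invr_gt0// ler_nat.
      by move: p0; rewrite !leNgt h1 h2 /= if_same subrr eqxx.
    have h2 : c%:R / n%:R <= x.
      have [c0|c0] := eqVneq c 0%N; first by rewrite c0 mul0r.
      case: (ltP x (c%:R / n%:R)) => // h2; move: p0.
      by rewrite h1 (negbTE c0) (ltW h2) subrr eqxx.
    by rewrite ler_norml; apply/andP; split; move: h1 h2; rewrite hE; lra.
  have psiS : \sum_(c < n) psi c x = 1.
    have tele m : \sum_(c < m) psi c x = ind m x.
      elim: m => [|m IH]; first by rewrite big_ord0 /ind.
      by rewrite big_ord_recr /= IH /psi addrC subrK.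
    by rewrite tele /ind gtn_eqF// divff ?gt_eqF// x1.
  have -> : S x - g x = \sum_(c < n) (g (c.+1%:R / n%:R) - g x) * psi c x.
    under [RHS]eq_bigr do rewrite mulrBl.
    by rewrite sumrB -mulr_sumr psiS mulr1.
  apply: le_trans (ler_norm_sum _ _ _) _.
  apply: (@le_trans _ _ (\sum_(c < n) om * psi c x)); last first.
    by rewrite -mulr_sumr psiS mulr1.
  apply: ler_sum => c _; rewrite normrM (ger0_norm (psi0 _ (ltn_ord c))).
  have [->|pn0] := eqVneq (psi c x) 0; first by rewrite !mulr0.
  rewrite ler_wpM2r ?psi0// distrC; apply: gom => //.
    by apply: frac01; exact: ltn_ord.
  exact: psi1 (ltn_ord c) pn0.
rewrite -MS -meanB// ler_norml; apply/andP; split.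
  rewrite -[leLHS](mean_cst U); apply: le_mean_unit; [exact: integ_cst|exact: integB|].
  by move=> x /bd; rewrite ler_norml => /andP[].
rewrite -[leRHS](mean_cst U); apply: le_mean_unit; [exact: integB|exact: integ_cst|].
by move=> x /bd; rewrite ler_norml => /andP[].
Qed.

End UnitInterval.

(** * Smoothness classes *)

Section SmoothClass.
Context {R : realType}.
Local Notation mu := (@lebesgue_measure R).
Local Notation U := (uniform_prob (@ltr01 R)).
Local Notation mean := (mean U).
Local Notation integ := (integ U).
Variables (a C : R) (f : R -> R) (theta : nat -> R) (b : R).
Hypothesis a0 : 0 < a.
Hypothesis C0 : 0 <= C.
Hypothesis mf : measurable_fun (`[0, 1]%classic : set R) f.
Hypothesis fb : forall x, 0 <= x <= 1 -> `|f x| <= b.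
Hypothesis ftheta : (\int[mu]_(x in `[0%R, 1%R])
  ((f x - cosine_sum theta m x) ^+ 2)%:E)%E @[m --> \oo] --> 0%E.
Hypothesis sumtheta :
  (\sum_(1 <= i <oo) (i%:R `^ (2 * a) * theta i ^+ 2)%:E <= C%:E)%E.

(** Nothing is known of [f] outside the unit interval, whereas means under the uniform law ask for
    measurability on the whole line. *)
Definition unit_ext (x : R) : R := if (0 <= x <= 1) then f x else 0.

Lemma measurable_unit_ext : measurable_fun setT unit_ext.
Proof.
have -> : unit_ext = f \_ `[0, 1]%classic.
  by apply/funext => x; rewrite patchE mem_setE in_itv.
by apply/measurable_restrict => //; rewrite setTI.
Qed.

Lemma unit_ext_bounded x : `|unit_ext x| <= b.
Proof.
rewrite /unit_ext; case: ifP => [/fb//|_]; rewrite normr0.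
by apply: le_trans (fb (x := 0) _); rewrite ?lexx ?ler01.
Qed.

Lemma integ_unit_ext_sub theta' m : integ (fun x => (unit_ext x - cosine_sum theta' m x) ^+ 2).
Proof.
have [c hc] := cosine_sum_bounded theta' m.
apply: (integ_bounded_fun (c := (b + c) ^+ 2)).
  apply: measurable_funX; apply: measurable_funB; first exact: measurable_unit_ext.
  exact: measurable_cosine_sum.
move=> x; rewrite normrX; have := unit_ext_bounded x; have := hc x.
have := ler_normB (unit_ext x) (cosine_sum theta' m x).
move: (`|_ - _|) (normr_ge0 (unit_ext x - cosine_sum theta' m x)).
move: `|_| `|_| => u v w w0 h1 h2 h3.
by rewrite ler_sqr ?nnegrE//; lra.
Qed.

Lemma integral_unit_ext_sub theta' m :
  (\int[mu]_(x in `[0%R, 1%R]) ((f x - cosine_sum theta' m x) ^+ 2)%:E =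
   (mean (fun x => (unit_ext x - cosine_sum theta' m x) ^+ 2))%:E)%E.
Proof.
have I := integ_unit_ext_sub theta' m.
rewrite -integ_mean// integral_unit.
- by apply: eq_integral => x; rewrite mem_setE in_itv/= /unit_ext => ->.
- by apply/measurable_EFinP; exact: integ_measurable I.
- by move=> x; rewrite lee_fin sqr_ge0.
Qed.

Lemma L2_approx (e : R) : 0 < e -> exists N, forall m, (N <= m)%N ->
  mean (fun x => (unit_ext x - cosine_sum theta m x) ^+ 2) <= e.
Proof.
move=> e0; move: ftheta => /fine_cvgP[_ cu].
have [N _ H] := cvgr_le _ cu e e0.
by exists N => m /H; rewrite /= integral_unit_ext_sub.
Qed.

Lemma sum_coef_le m : \sum_(1 <= i < m.+1) i%:R `^ (2 * a) * theta i ^+ 2 <= C.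
Proof.
rewrite -lee_fin; apply: le_trans sumtheta; rewrite -sumEFin.
apply: nneseries_lim_ge => i _ _.
by rewrite lee_fin mulr_ge0 ?powR_ge0 ?sqr_ge0.
Qed.

(** Integration against a bounded function is continuous in L^2, and the partial sums of order at
    least [k] have coefficient exactly [theta k]. *)
Lemma mean_unit_ext_cosb k : mean (fun x => unit_ext x * cosb k x) = theta k.
Proof.
have Ik (g : R -> R) c : measurable_fun setT g -> (forall x, `|g x| <= c) ->
    integ (fun x => g x * cosb k x).
  move=> mg gc; apply: (integ_bounded_fun (c := c)).
    by apply: measurable_funM => //; exact: measurable_cosb.
  move=> x; rewrite normrM -[leRHS]mulr1 ler_pM//; exact: cosb_norm.
apply/eqP; rewrite -subr_eq0 -normr_le0; apply/ler_addgt0Pr => e e0; rewrite add0r.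
have e2 : 0 < e ^+ 2 by rewrite exprn_gt0.
have [N HN] := L2_approx e2.
pose m := maxn N k; have := HN m (leq_maxl _ _).
have [c hc] := cosine_sum_bounded theta m.
rewrite -(mean_cosine_sum_cosb theta (leq_maxr N k)) -/m => H.
rewrite -meanB; [|exact: Ik measurable_unit_ext unit_ext_bounded|
  apply: (Ik _ c) => //; exact: measurable_cosine_sum].
have Isq := integ_unit_ext_sub theta m.
have ID : integ (fun x => unit_ext x * cosb k x - cosine_sum theta m x * cosb k x).
  apply: integB; first exact: Ik measurable_unit_ext unit_ext_bounded.
  by apply: (Ik _ c) => //; exact: measurable_cosine_sum.
have bd x : `|unit_ext x * cosb k x - cosine_sum theta m x * cosb k x| <=
    e / 2 + (2 * e)^-1 * (unit_ext x - cosine_sum theta m x) ^+ 2.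
  rewrite -mulrBl; set y := unit_ext x - _.
  apply: (@le_trans _ _ `|y|); first by rewrite normrM ler_piMr// cosb_norm.
  have : 0 <= (`|y| - e) ^+ 2 / (2 * e) by rewrite divr_ge0 ?sqr_ge0// mulr_ge0// ltW.
  rewrite (_ : _ / _ = e / 2 + (2 * e)^-1 * `|y| ^+ 2 - `|y|); last by field; rewrite gt_eqF.
  by rewrite real_normK ?num_real//; lra.
have B : mean (fun x => `|unit_ext x * cosb k x - cosine_sum theta m x * cosb k x|) <= e.
  apply: le_trans (le_mean (integ_norm ID) _ bd) _.
    by apply: integD; [exact: integ_cst|exact: integZ].
  rewrite meanD; [|exact: integ_cst|exact: integZ].
  rewrite mean_cst meanZ//.
  have : (2 * e)^-1 * mean (fun x => (unit_ext x - cosine_sum theta m x) ^+ 2) <= (2 * e)^-1 * e ^+ 2.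
    by rewrite ler_wpM2l// invr_ge0 mulr_ge0// ltW.
  rewrite (_ : (2 * e)^-1 * e ^+ 2 = e / 2); last by field; rewrite gt_eqF.
  by lra.
by apply: le_trans B; rewrite unlock; exact: le_normr_Rintegral.
Qed.

(** Parseval is only needed for the finite piece between [N] and a large [m], where
    [i ^ (2 * a) >= N ^ (2 * a)]; the remainder beyond [m] is small by L^2 convergence. *)
Lemma cosine_tail N : (0 < N)%N ->
  mean (fun x => (unit_ext x - cosine_sum theta N x) ^+ 2) <= 4 * C * N%:R `^ (- (2 * a)).
Proof.
move=> N0; apply/ler_addgt0Pr => e e0.
have e2 : 0 < e / 2 by rewrite divr_gt0.
have [N' HN'] := L2_approx e2.
pose m := maxn N' N; have Hm := HN' m (leq_maxl _ _).
have Nm : (N <= m)%N by exact: leq_maxr.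
pose th i := if (i <= N)%N then 0 else theta i.
have thE x : cosine_sum theta m x - cosine_sum theta N x = cosine_sum th m x.
  rewrite /cosine_sum /th /= (@big_cat_nat _ _ _ N.+1)//= mulrDr.
  rewrite [in RHS](@big_cat_nat _ _ _ N.+1)//= mulrDr.
  rewrite [X in _ = _ + (2 * X + _)]big_nat_cond [X in _ = _ + (2 * X + _)]big1; last first.
    by move=> i /andP[/andP[_ h] _]; rewrite -ltnS h mul0r.
  rewrite [X in _ = _ + (_ + 2 * X)]big_nat_cond [X in _ + (_ + 2 * X) - _ = _]big_nat_cond.
  rewrite [X in _ = _ + (_ + 2 * X)](eq_bigr (fun i => theta i * cos (i%:R * pi * x))).
    by ring.
  by move=> i /andP[/andP[h _] _]; rewrite leqNgt h.
have th_le : mean (fun x => cosine_sum th m x ^+ 2) <= 2 * C * N%:R `^ (- (2 * a)).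
  rewrite mean_cosine_sum_sq {1}/th /= expr0n add0r -mulrA ler_pM2l//.
  apply: (@le_trans _ _ (N%:R `^ (- (2 * a)) * \sum_(1 <= i < m.+1) i%:R `^ (2 * a) * theta i ^+ 2)).
    rewrite mulr_sumr; apply: ler_sum => i _; rewrite /th.
    case: ifPn => [_|]; first by rewrite expr0n; apply: mulr_ge0; [exact: powR_ge0|apply: mulr_ge0; [exact: powR_ge0|exact: sqr_ge0]].
    rewrite -ltnNge => Ni; rewrite mulrA ler_peMl ?sqr_ge0//.
    rewrite powRN mulrC ler_pdivlMr ?powR_gt0 ?ltr0n// mul1r.
    apply: ge0_ler_powR; rewrite ?nnegrE ?mulr_ge0 ?ler0n ?(ltW a0)//.
    by rewrite ler_nat ltnW.
  by rewrite mulrC ler_wpM2r ?powR_ge0// sum_coef_le.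
have bd x : (unit_ext x - cosine_sum theta N x) ^+ 2 <=
    2 * (unit_ext x - cosine_sum theta m x) ^+ 2 + 2 * cosine_sum th m x ^+ 2.
  rewrite -thE; move: (unit_ext x) (cosine_sum _ _ _) (cosine_sum _ _ _) => u v w.
  by have := sqr_ge0 (u - 2 * v + w); nra.
have I1 := integ_unit_ext_sub theta m; have I2 := integ_cosine_sum_sq th m.
apply: le_trans (le_mean (integ_unit_ext_sub theta N) _ bd) _.
  by apply: integD; exact: integZ.
rewrite meanD; [|exact: integZ|exact: integZ].
by rewrite !meanZ//; lra.
Qed.

(** Term [i] is of the order of [i ^ g * |theta i|], split as [i ^ a * |theta i|] times
    [i ^ (g - a)]. By Young's inequality the squares of the first factors are summed by the
    smoothness condition, those of the second because [2 * (a - g) > 1]. The bound does not depend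
    on [m]. *)
Lemma cosine_sum_holder (g : R) m x y : 0 <= g <= 1 -> 1 < 2 * a - 2 * g ->
  `|cosine_sum theta m x - cosine_sum theta m y| <=
  2 * pi * (C + (1 + (2 * a - 2 * g - 1)^-1)) * `|x - y| `^ g.
Proof.
move=> g01 ag; have /andP[g0 g1] := g01.
rewrite /cosine_sum opprD addrACA subrr add0r -mulrBr -sumrB.
rewrite normrM (ger0_norm (ler0n R 2)).
have p1 : 1 <= pi :> R by apply: le_trans (pi_ge2 R); rewrite ler1n.
have p0 : 0 <= pi :> R by exact: pi_ge0.
set h := `|x - y| `^ g; have h0 : 0 <= h by exact: powR_ge0.
have T i : (0 < i)%N -> `|theta i * cos (i%:R * pi * x) - theta i * cos (i%:R * pi * y)| <=
    pi * h * (i%:R `^ (2 * a) * theta i ^+ 2 + i%:R `^ (- (2 * a - 2 * g))).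
  move=> i0; rewrite -mulrBr normrM.
  have i0R : 0 < i%:R :> R by rewrite ltr0n.
  have cs := cos_sub_holder (i%:R * pi * x) (i%:R * pi * y) g01.
  rewrite -mulrBr normrM ger0_norm ?mulr_ge0// powRM ?mulr_ge0// powRM// in cs.
  rewrite -/h in cs.
  have pg : pi `^ g <= pi :> R by exact: ler1_powR.
  have ig0 : 0 <= i%:R `^ g :> R by exact: powR_ge0.
  have cs' : `|cos (i%:R * pi * x) - cos (i%:R * pi * y)| <= 2 * (i%:R `^ g * pi * h).
    apply: le_trans cs _; rewrite ler_pM2l// ler_wpM2r// ler_wpM2l//.
  apply: (@le_trans _ _ (`|theta i| * (2 * (i%:R `^ g * pi * h)))); first by rewrite ler_wpM2l.
  have ia : i%:R `^ g = i%:R `^ a * i%:R `^ (- (a - g)) :> R.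
    rewrite -powRD; first by congr (powR _ _); ring.
    by apply/implyP => _; rewrite gt_eqF.
  have ia2 : i%:R `^ (2 * a) = (i%:R `^ a) ^+ 2 :> R.
    by rewrite -powR_mulrn ?powR_ge0// -powRrM mulrC.
  have ig2 : i%:R `^ (- (2 * a - 2 * g)) = (i%:R `^ (- (a - g))) ^+ 2 :> R.
    by rewrite -powR_mulrn ?powR_ge0// -powRrM; congr (powR _ _); ring.
  rewrite ia ia2 ig2 -[theta i ^+ 2]real_normK ?num_real//.
  move: (i%:R `^ a) (i%:R `^ (- (a - g))) `|theta i| => u v t.
  have : 0 <= pi * h * (u * t - v) ^+ 2 by rewrite mulr_ge0 ?sqr_ge0// mulr_ge0.
  lra.
apply: (@le_trans _ _ (2 * (pi * h * (C + (1 + (2 * a - 2 * g - 1)^-1))))); last first.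
  by rewrite le_eqVlt; apply/orP; left; apply/eqP; ring.
rewrite ler_pM2l//; apply: le_trans (ler_norm_sum _ _ _) _.
apply: (@le_trans _ _ (\sum_(1 <= i < m.+1) pi * h *
    (i%:R `^ (2 * a) * theta i ^+ 2 + i%:R `^ (- (2 * a - 2 * g))))).
  rewrite big_nat_cond [leRHS]big_nat_cond; apply: ler_sum => i /andP[/andP[i0 _] _].
  exact: T.
rewrite -mulr_sumr ler_wpM2l ?mulr_ge0// big_split /= lerD//; first exact: sum_coef_le.
exact: sum_powRN_le.
Qed.

(** Chebyshev's inequality: if the error were at least [e] throughout the interval, its half []x, x
    + del / 2]] alone would contribute [e ^ 2 * del / 2]. *)
Lemma L2_close_point (e del x : R) m : 0 < e -> 0 < del -> 0 <= x -> x + del <= 1 ->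
  mean (fun x => (unit_ext x - cosine_sum theta m x) ^+ 2) < e ^+ 2 * (del / 2) ->
  exists x', [/\ x < x', x' < x + del & `|f x' - cosine_sum theta m x'| < e].
Proof.
move=> e0 d0 x0 xd H; apply: contrapT => N.
have far x' : x < x' -> x' < x + del -> e ^+ 2 <= (unit_ext x' - cosine_sum theta m x') ^+ 2.
  move=> h1 h2; have -> : unit_ext x' = f x'.
    by rewrite /unit_ext (ltW (le_lt_trans x0 h1)) (ltW (lt_le_trans h2 xd)).
  rewrite -[leRHS]real_normK ?num_real// ler_sqr ?nnegrE ?(ltW e0)//.
  by rewrite leNgt; apply/negP => h; apply: N; exists x'.
have I := integ_unit_ext_sub theta m.
pose ind (y : R) : R := (y <= x + del / 2)%R%:R - (y <= x)%R%:R.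
have d2 : 0 < del / 2 by rewrite divr_gt0.
have Iind (c : R) : integ (fun y => (y <= c)%R%:R).
  apply: (integ_bounded_fun (c := 1)); first exact: measurable_le_ind.
  by move=> y; case: (y <= _); rewrite /= ?normr0 ?normr1.
have : mean (fun y => e ^+ 2 * ind y) <=
    mean (fun x => (unit_ext x - cosine_sum theta m x) ^+ 2).
  apply: le_mean => //; first by apply: integZ; exact: integB.
  move=> y; rewrite /ind; have [h1|h1] := leP y (x + del / 2); last first.
    have h2 : x < y by lra.
    by rewrite [y <= x]leNgt h2 subrr mulr0 sqr_ge0.
  have [h2|h2] := leP y x; first by rewrite subrr mulr0 sqr_ge0.
  by rewrite subr0 mulr1 far//; lra.
rewrite meanZ; last exact: integB.
rewrite meanB// !mean_le_ind; [|lra|lra].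
rewrite (_ : x + del / 2 - x = del / 2) => [h|]; last by ring.
by have := le_lt_trans h H; rewrite ltxx.
Qed.

Hypothesis fc : {within `[0, 1], continuous f}.

(** The bound is uniform over partial sums and is carried to [f] without pointwise convergence: near
    [x] and [y] there are points where a partial sum is close to [f], and [f] is continuous. *)
Lemma smooth_holder (g x y : R) : 0 <= g <= 1 -> 1 < 2 * a - 2 * g ->
  0 <= x <= 1 -> 0 <= y <= 1 ->
  `|f x - f y| <= 2 * pi * (C + (1 + (2 * a - 2 * g - 1)^-1)) * `|x - y| `^ g.
Proof.
move=> g01 ag; wlog xy : x y / x < y => [H hx hy|].
  have [h|h|<-] := ltgtP x y; first exact: H.
    by rewrite distrC [`|x - y|]distrC; exact: H.
  rewrite !subrr normr0 mulr_ge0 ?powR_ge0// mulr_ge0 ?mulr_ge0 ?pi_ge0//.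
  by rewrite addr_ge0// addr_ge0// invr_ge0; lra.
move=> /andP[x0 x1] /andP[y0 y1]; set K := 2 * pi * _.
have K0 : 0 <= K.
  rewrite mulr_ge0 ?mulr_ge0 ?pi_ge0//.
  by rewrite addr_ge0// addr_ge0// invr_ge0; lra.
(* Four errors occur: moving [f] from [x] to [x'], replacing [f] by the partial sum at [x'], and the
   same two at [y]. *)
apply/ler_addgt0Pr => e' e'0; pose e := e' / 4.
have e0 : 0 < e by rewrite divr_gt0.
have near (z : R) : 0 <= z <= 1 -> exists2 d : R, 0 < d &
    forall z', 0 <= z' <= 1 -> `|z - z'| < d -> `|f z - f z'| < e.
  move=> z01; have zI : (`[0, 1]%classic : set R) z by rewrite /= in_itv.
  have /subspace_continuousP/(_ z zI)/cvgrPdist_lt/(_ e e0) := fc.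
  rewrite near_withinE => -[d /= d0 H]; exists d => // z' z'01 zz'.
  by apply: H => //; rewrite /= in_itv.
have [d1 d10 H1] := near x ltac:(by rewrite x0 x1).
have [d2 d20 H2] := near y ltac:(by rewrite y0 y1).
pose del := Num.min (Num.min d1 d2) ((y - x) / 2).
have del0 : 0 < del by rewrite !lt_min d10 d20 divr_gt0// subr_gt0.
have dd1 : del <= d1 by rewrite !ge_min lexx.
have dd2 : del <= d2 by rewrite !ge_min lexx orbT.
have dd3 : del <= (y - x) / 2 by rewrite !ge_min lexx orbT.
have r0 : 0 < e ^+ 2 * (del / 2 / 2) / 2 by rewrite divr_gt0// mulr_gt0 ?exprn_gt0// !divr_gt0.
have [m Hm] := L2_approx r0; have {Hm} := Hm m (leqnn _) => Hm.
have lt_r : mean (fun x => (unit_ext x - cosine_sum theta m x) ^+ 2) < e ^+ 2 * (del / 2 / 2).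
  by apply: le_lt_trans Hm _; rewrite ltr_pdivrMr// ltr_pMr ?ltr1n// mulr_gt0 ?exprn_gt0// !divr_gt0.
move: lt_r; set r := del / 2 => lt_r.
have rE : del = r * 2 by rewrite /r; field.
have r20 : 0 < r by rewrite divr_gt0.
(* [x'] is taken to the right of [x] and [y'] to the left of [y], each within a quarter of the gap,
   so that [|x' - y'| <= |x - y|]. *)
have [x' [xx' x'd fx']] := L2_close_point e0 r20 x0 ltac:(lra) lt_r.
have [y' [yy' y'd fy']] := L2_close_point (x := y - r) e0 r20 ltac:(lra) ltac:(lra) lt_r.
have B1 := H1 x' ltac:(lra) ltac:(rewrite ltr_norml; lra).
have B2 := H2 y' ltac:(lra) ltac:(rewrite ltr_norml; lra).
have B3 := cosine_sum_holder m x' y' g01 ag; rewrite -/K in B3.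
have B4 : K * `|x' - y'| `^ g <= K * `|x - y| `^ g.
  rewrite ler_wpM2l// ge0_ler_powR ?nnegrE ?(andP g01).1//.
  by rewrite ler0_norm ?(@ler0_norm _ (x - y)); lra.
have := le_trans B3 B4; move: (K * `|x - y| `^ g) => h.
have e'E : e' = e * 4 by rewrite /e; field.
move: B1 B2 fx' fy'; rewrite !ltr_norml !ler_norml e'E.
move: (f x) (f y) (f x') (f y') (cosine_sum _ _ _) (cosine_sum _ _ _) => *.
by apply/andP; split; lra.
Qed.

End SmoothClass.

(** * Risk of the estimated coefficients *)

Section RiskBound.
Context d (T : measurableType d) (R : realType) (P : probability T R).
Variable eps : nat -> nat -> {RV P >-> R}.
Local Notation mean := (mean P).
Local Notation integ := (integ P).
Local Notation L4 := (L4 P).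
Variables (n : nat) (Y Z : nat -> T -> R) (f tau : nat -> R).
Variables (L2 tmax kappa Jmax K q k4 m bias : R) (J : 'I_(n.-1) -> R).
Local Notation D := (@sine_entry R n).
Local Notation lam := (@eigval R n).
Local Notation G := (noise_mx n f tau).
Hypothesis n16 : (16 < n)%N.
Hypothesis f2 : forall c, (c <= n)%N -> f c ^+ 2 <= 2.
Hypothesis df2 : forall c, (c < n)%N -> (f c.+1 - f c) ^+ 2 <= L2.
Hypothesis tau2 : forall c, (0 < c <= n)%N -> tau c ^+ 2 <= tmax.
Hypothesis J0 : forall p, 0 <= J p <= Jmax.
Hypothesis Jk : forall p, J p * (4 * lam p.+1 + 2 * L2) <= kappa.
Hypothesis eL4 : forall j : 'I_n, L4 (eps n j.+1).
Hypothesis e0 : forall j : 'I_n, mean (eps n j.+1) = 0.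
Hypothesis e2 : forall j : 'I_n, mean (fun w => eps n j.+1 w ^+ 2) = 1.
Hypothesis e4 : forall j : 'I_n, mean (fun w => eps n j.+1 w ^+ 4) <= k4.
Hypothesis k41 : 1 <= k4.
Hypothesis eind : mutually_independent P (fun j : 'I_n => eps n j.+1).
Hypothesis sZ : signal eps n Z K.
Hypothesis q0 : 0 < q.
Hypothesis Kq : K <= q ^+ 2.
Hypothesis YE : forall i w, (0 < i < n)%N ->
  Y i.+1 w - Y i w = Z i w + (tau i.+1 * eps n i.+1 w - tau i * eps n i w).
Hypothesis mbias : `|\sum_(p < n.-1) J p * \sum_(c < n) G p c ^+ 2 - m| <= bias.

Let n1 : (1 < n)%N. Proof. by lia. Qed.
Let Jge0 p : 0 <= J p. Proof. by case/andP: (J0 p). Qed.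
Let Jmax0 : 0 <= Jmax.
Proof.
have n1' : (0 < n.-1)%N by lia.
by have /andP[] := J0 (Ordinal n1'); exact: le_trans.
Qed.

Let x (p : 'I_(n.-1)) w := \sum_(i < n.-1) D i.+1 p.+1 * (Z i.+1 w * f i.+1).
Let V (c : 'I_n) w := \sum_(p < n.-1) J p * x p w * G p c.
Let stat w := \sum_(p < n.-1) J p *
  (\sum_(i < n.-1) D i.+1 p.+1 * ((Y i.+2 w - Y i.+1 w) * f i.+1)) ^+ 2.
Let B (c e : 'I_n) := \sum_(p < n.-1) J p * G p c * G p e.

Let ZL4 (i : 'I_(n.-1)) : L4 (Z i.+1).
Proof. by have [H _ _] := sZ; apply: H; have := ltn_ord i; lia. Qed.

Let xL4 p : L4 (x p).
Proof.
by apply: L4_sum => i _; apply/L4Z; apply: (eq_L4 (f := fun w => f i.+1 * Z i.+1 w));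
  [move=> w; rewrite mulrC|apply/L4Z/ZL4].
Qed.

Let VL4 c : L4 (V c).
Proof.
apply: L4_sum => p _; apply: (eq_L4 (f := fun w => (J p * G p c) * x p w)).
  by move=> w; ring.
exact/L4Z/xL4.
Qed.

(** Young's inequality with parameter [q] deduces the second moment from the fourth; [q] stands for
    a bound on the square root of [K]. *)
Let Z2 (i : 'I_(n.-1)) : mean (fun w => Z i.+1 w ^+ 2) <= q.
Proof.
have [_ H _] := sZ.
have Z4 := le_trans (H i.+1 ltac:(have := ltn_ord i; lia)) Kq.
have q2 : 0 < 2 * q by rewrite mulr_gt0.
apply: (@le_trans _ _ (mean (fun w => (2 * q)^-1 * Z i.+1 w ^+ 4 + q / 2))).
  apply: le_mean; first exact/L4_sq/ZL4.
    by apply: integD; [apply/integZ; case: (ZL4 i)|exact: integ_cst].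
  move=> w; rewrite -subr_ge0.
  have -> : (2 * q)^-1 * Z i.+1 w ^+ 4 + q / 2 - Z i.+1 w ^+ 2 =
      (2 * q)^-1 * (Z i.+1 w ^+ 2 - q) ^+ 2 by field; rewrite gt_eqF.
  by apply: mulr_ge0; [rewrite invr_ge0 ltW|exact: sqr_ge0].
have I4 := (ZL4 i).2.
rewrite meanD; [|exact: integZ|exact: integ_cst]; rewrite mean_cst meanZ//.
have : (2 * q)^-1 * mean (fun w => Z i.+1 w ^+ 4) <= (2 * q)^-1 * q ^+ 2.
  by rewrite ler_wpM2l// invr_ge0 ltW.
have -> : (2 * q)^-1 * q ^+ 2 = q / 2 by field; rewrite gt_eqF.
lra.
Qed.

Let sum_x2 w : \sum_p J p * x p w ^+ 2 <= 2 * Jmax * \sum_(i < n.-1) Z i.+1 w ^+ 2.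
Proof.
apply: (@le_trans _ _ (Jmax * \sum_p x p w ^+ 2)).
  rewrite mulr_sumr; apply: ler_sum => p _.
  by rewrite ler_wpM2r ?sqr_ge0//; case/andP: (J0 p).
rewrite /x (sine_parsevalC n1) [2 * _]mulrC -mulrA ler_wpM2l// mulr_sumr.
apply: ler_sum => i _; rewrite exprMn mulrC ler_wpM2r ?sqr_ge0// f2//.
by have := ltn_ord i; lia.
Qed.

Let mean_S2 : mean (fun w => (\sum_p J p * x p w ^+ 2) ^+ 2) <=
  4 * Jmax ^+ 2 * n%:R ^+ 2 * K.
Proof.
have IZ : integ (fun w => 4 * Jmax ^+ 2 * n%:R * \sum_(i < n.-1) Z i.+1 w ^+ 4).
  by apply/integZ/integ_sum => i _; case: (ZL4 i).
have bd w : (\sum_p J p * x p w ^+ 2) ^+ 2 <=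
    4 * Jmax ^+ 2 * n%:R * \sum_(i < n.-1) Z i.+1 w ^+ 4.
  have S0 : 0 <= \sum_p J p * x p w ^+ 2.
    by apply: sumr_ge0 => p _; apply: mulr_ge0 => //; exact: sqr_ge0.
  have := sum_x2 w; set z := (X in _ <= _ * X) => h.
  have z0 : 0 <= z by apply: sumr_ge0 => i _; rewrite sqr_ge0.
  apply: (@le_trans _ _ ((2 * Jmax * z) ^+ 2)).
    by rewrite ler_sqr ?nnegrE// mulr_ge0// mulr_ge0.
  rewrite exprMn (_ : (2 * Jmax) ^+ 2 = 4 * Jmax ^+ 2); last by ring.
  rewrite -[leRHS]mulrA ler_wpM2l//; first by apply: mulr_ge0 => //; exact: sqr_ge0.
  apply: le_trans (sqr_sum_le _) _.
  under eq_bigr do rewrite -exprM.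
  apply: ler_wpM2r; last by rewrite ler_nat leq_pred.
  by apply: sumr_ge0 => i _; exact: pow4_ge0.
have mS : measurable_fun setT (fun w => (\sum_p J p * x p w ^+ 2) ^+ 2).
  apply: measurable_funX; apply: measurable_sum => p.
  by apply: measurable_funM => //; apply: measurable_funX; exact: L4_measurable (xL4 p).
apply: le_trans (le_mean _ IZ bd) _.
  by apply: (integ_le mS _ IZ) => w; rewrite ger0_norm ?sqr_ge0.
rewrite meanZ; last by apply: integ_sum => i _; case: (ZL4 i).
rewrite mean_sum; last by move=> i _; case: (ZL4 i).
rewrite (_ : 4 * Jmax ^+ 2 * n%:R ^+ 2 * K = 4 * Jmax ^+ 2 * n%:R * (n%:R * K)); last by ring.
apply: ler_wpM2l; first by apply: mulr_ge0 => //; apply: mulr_ge0 => //; exact: sqr_ge0.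
have [_ H _] := sZ.
apply: (@le_trans _ _ (\sum_(i < n.-1) K)).
  by apply: ler_sum => i _; apply: H; have := ltn_ord i; lia.
rewrite sumr_const card_ord -[leLHS]mulr_natl.
have K0 : 0 <= K.
  have n0' : (0 < n.-1)%N by lia.
  apply: le_trans (H 1%N ltac:(lia)); apply: mean_ge0 => w; exact: pow4_ge0.
by rewrite ler_wpM2r// ler_nat leq_pred.
Qed.

(** After exchanging sums, [V c + a * V e] is a deterministic linear combination of the increments
    of the signal. *)
Let V_indep c e (a : R) : sq_indep P (fun j : 'I_n => eps n j.+1) (fun w => V c w + a * V e w).
Proof.
have [_ _ H] := sZ.
have -> : (fun w => V c w + a * V e w) = fun w => \sum_(i < n.-1)
   (f i.+1 * \sum_(p < n.-1) J p * D i.+1 p.+1 * (G p c + a * G p e)) * Z i.+1 w.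
  apply/funext => w; rewrite /V mulr_sumr -big_split /=.
  transitivity (\sum_(p < n.-1) \sum_(i < n.-1)
      J p * D i.+1 p.+1 * (G p c + a * G p e) * (Z i.+1 w * f i.+1)).
    apply: eq_bigr => p _; rewrite /x.
    transitivity (J p * (G p c + a * G p e) * \sum_(i < n.-1) D i.+1 p.+1 * (Z i.+1 w * f i.+1)).
      by ring.
    by rewrite mulr_sumr; apply: eq_bigr => i _; ring.
  rewrite exchange_big /=; apply: eq_bigr => i _.
  by rewrite mulr_sumr mulr_suml; apply: eq_bigr => p _; ring.
exact: (H (fun i => f i.+1 * \sum_(p < n.-1) J p * D i.+1 p.+1 * (G p c + a * G p e))).
Qed.

Let tmax0 : 0 <= tmax.
Proof. by apply: le_trans (tau2 (c := 1) _); [exact: sqr_ge0|lia]. Qed.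

Let kappa0 : 0 <= kappa.
Proof.
have n1' : (0 < n.-1)%N by lia.
apply: le_trans (Jk (Ordinal n1')); rewrite mulr_ge0// addr_ge0// mulr_ge0// ?eigval_ge0//.
by apply: le_trans (df2 (c := 0) _); [exact: sqr_ge0|lia].
Qed.

Let cross_eq w : \sum_(p < n.-1) J p * x p w * (\sum_(c < n) G p c * eps n c.+1 w) =
  \sum_c V c w * eps n c.+1 w.
Proof.
under eq_bigr do rewrite mulr_sumr.
rewrite exchange_big; apply: eq_bigr => c _.
by rewrite /V mulr_suml; apply: eq_bigr => p _; ring.
Qed.

(** The operator bound [noise_mx_weighted_bound] holds for each outcome, with the signal as vector
    [a], and costs a single [Jmax]. In the application the result is of order [n ^ (-3/2)], with no
    logarithm left. *)
Let mean_K2 : mean (fun w => (\sum_c V c w * eps n c.+1 w) ^+ 2) <=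
  2 * tmax * kappa * Jmax * n%:R * q.
Proof.
rewrite (cross_term_sq (fun j => L4_measurable (eL4 j)) eL4 VL4 e0 e2 eind V_indep).
rewrite -mean_sum; last by move=> c _; exact/L4_sq/VL4.
have IZ : integ (fun w => \sum_(i < n.-1) Z i.+1 w ^+ 2).
  by apply: integ_sum => i _; exact/L4_sq/ZL4.
have bd w : \sum_(c < n) V c w ^+ 2 <= tmax * kappa * (2 * Jmax) * \sum_(i < n.-1) Z i.+1 w ^+ 2.
  apply: le_trans (noise_mx_weighted_bound n1 f2 df2 tau2 Jge0 Jk (fun p => x p w)) _.
  by rewrite -[leRHS]mulrA ler_wpM2l// mulr_ge0.
apply: le_trans (le_mean _ (integZ _ IZ) bd) _.
  by apply: integ_sum => c _; exact/L4_sq/VL4.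
rewrite meanZ// mean_sum; last by move=> i _; exact/L4_sq/ZL4.
rewrite (_ : 2 * tmax * kappa * Jmax * n%:R * q = tmax * kappa * (2 * Jmax) * (n%:R * q)); last by ring.
apply: ler_wpM2l; first by rewrite mulr_ge0 ?mulr_ge0.
apply: (@le_trans _ _ (\sum_(i < n.-1) q)); first by apply: ler_sum => i _; exact: Z2.
by rewrite sumr_const card_ord -[leLHS]mulr_natl ler_wpM2r ?(ltW q0)// ler_nat leq_pred.
Qed.

Let noise_eq w : \sum_(p < n.-1) J p * (\sum_(c < n) G p c * eps n c.+1 w) ^+ 2 =
  \sum_c \sum_e B c e * (eps n c.+1 w * eps n e.+1 w).
Proof.
under eq_bigr => p _.
  rewrite expr2 mulr_suml mulr_sumr.
  under eq_bigr do rewrite mulr_sumr mulr_sumr.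
  over.
rewrite exchange_big /=; apply: eq_bigr => c _.
rewrite exchange_big /=; apply: eq_bigr => e _.
by rewrite /B mulr_suml; apply: eq_bigr => p _; ring.
Qed.

Let trace_eq : \sum_(p < n.-1) J p * \sum_(c < n) G p c ^+ 2 = \sum_c B c c.
Proof.
under eq_bigr do rewrite mulr_sumr.
rewrite exchange_big; apply: eq_bigr => c _; apply: eq_bigr => p _.
by rewrite expr2 mulrA.
Qed.

Let noise w := \sum_c \sum_e B c e * (eps n c.+1 w * eps n e.+1 w) - \sum_c B c c.

Let mean_N2 : mean (fun w => noise w ^+ 2) <= 2 * k4 * ((tmax * kappa) ^+ 2 * n%:R).
Proof.
have me j := L4_measurable (eL4 j).
have wi := mutually_independent_weighted me eind.
have Bs c e : B c e = B e c by apply: eq_bigr => p _; ring.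
have H := @quad_form_variance _ _ _ P _ _ eL4 wi e0 (fun=> 1) k4 (fun=> ler01)
  ltac:(by move=> j; rewrite e2) k41 ltac:(by move=> j; rewrite expr1n mulr1) B Bs.
apply: (@le_trans _ _ (2 * k4 * \sum_i \sum_j B i j ^+ 2 * (1 * 1))).
  apply: le_trans H; rewrite le_eqVlt; apply/orP; left; apply/eqP; apply: eq_mean => w.
  by rewrite /noise; congr ((_ - _) ^+ 2); apply: eq_bigr => c _; rewrite e2 mulr1.
rewrite ler_wpM2l//; first by rewrite mulr_ge0// (le_trans ler01).
apply: le_trans (noise_form_frobenius n1 f2 df2 tau2 Jge0 Jk).
by apply: ler_sum => c _; apply: ler_sum => e _; rewrite !mulr1.
Qed.

Let stat_eq w : stat w - m = \sum_p J p * x p w ^+ 2 + 2 * (\sum_c V c w * eps n c.+1 w)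
  + noise w + (\sum_c B c c - m).
Proof.
suff -> : stat w = \sum_p J p * x p w ^+ 2 + 2 * (\sum_c V c w * eps n c.+1 w) +
    \sum_c \sum_e B c e * (eps n c.+1 w * eps n e.+1 w) by rewrite /noise; ring.
rewrite -noise_eq -cross_eq mulr_sumr -!big_split /=; apply: eq_bigr => p _.
have -> : \sum_(i < n.-1) D i.+1 p.+1 * ((Y i.+2 w - Y i.+1 w) * f i.+1) =
   x p w + \sum_(c < n) G p c * eps n c.+1 w.
  rewrite -(sine_transform_noise n1 f tau (fun j => eps n j w)) /x -big_split /=.
  apply: eq_bigr => i _; rewrite YE; last by rewrite /= -ltn_predRL.
  by ring.
by ring.
Qed.

Let measurable_stat : measurable_fun setT stat.
Proof.
rewrite (_ : stat = fun w => \sum_p J p * x p w ^+ 2 + 2 * (\sum_c V c w * eps n c.+1 w)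
  + noise w + \sum_c B c c).
  have mx p := L4_measurable (xL4 p); have mV c := L4_measurable (VL4 c).
  repeat apply: measurable_funD => //.
  - by apply: measurable_sum => p; apply: measurable_funM => //; exact: measurable_funX.
  - apply: measurable_funM => //; apply: measurable_sum => c; exact: measurable_funM.
  - apply: measurable_sum => c; apply: measurable_sum => e.
    by apply: measurable_funM => //; exact: measurable_funM.
by apply/funext => w; rewrite -[LHS](subrK m) stat_eq; ring.
Qed.

(** The error is the sum of the signal, cross, centred noise and bias terms, and the square of four
    summands costs a factor 4. With [Jmax] of order log^2 n / n, [kappa] of order 1 / n, [K] of
    order 1 / (n log^4 n) and [bias] of order n^(-1/2), every term is O(1 / n). *)
Lemma stat_risk : [/\ measurable_fun setT stat,
  integ (fun w => (stat w - m) ^+ 2) &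
  mean (fun w => (stat w - m) ^+ 2) <=
  4 * (4 * Jmax ^+ 2 * n%:R ^+ 2 * K + 4 * (2 * tmax * kappa * Jmax * n%:R * q)
    + 2 * k4 * ((tmax * kappa) ^+ 2 * n%:R) + bias ^+ 2)].
Proof.
have mx p := L4_measurable (xL4 p); have mV c := L4_measurable (VL4 c).
have IS : integ (fun w => (\sum_p J p * x p w ^+ 2) ^+ 2).
  apply: (eq_integ (f := fun w => \sum_p \sum_s J p * J s * (x p w * x p w * x s w * x s w))).
    move=> w; rewrite expr2 mulr_suml; apply: eq_bigr => p _.
    by rewrite mulr_sumr; apply: eq_bigr => s _; ring.
  apply: integ_sum => p _; apply: integ_sum => s _; apply: integZ; exact: L4_prod4.
have IK : integ (fun w => (\sum_c V c w * eps n c.+1 w) ^+ 2).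
  apply: (eq_integ (f := fun w => \sum_c \sum_e V c w * eps n c.+1 w * V e w * eps n e.+1 w)).
    move=> w; rewrite expr2 mulr_suml; apply: eq_bigr => p _.
    by rewrite mulr_sumr; apply: eq_bigr => s _; ring.
  by apply: integ_sum => c _; apply: integ_sum => e _; exact: L4_prod4.
have IN : integ (fun w => noise w ^+ 2) by exact: integ_quad_form_sq.
pose g w := 4 * ((\sum_p J p * x p w ^+ 2) ^+ 2 + 4 * (\sum_c V c w * eps n c.+1 w) ^+ 2
  + noise w ^+ 2 + bias ^+ 2).
have bd w : (stat w - m) ^+ 2 <= g w.
  rewrite stat_eq /g.
  have : (\sum_c B c c - m) ^+ 2 <= bias ^+ 2.
    rewrite -[leLHS]real_normK ?num_real// ler_sqr ?nnegrE//; first by rewrite -trace_eq.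
    exact: le_trans mbias.
  move: (\sum_p _) (\sum_c _) (noise w) (_ - m) => a2 a1 a3 a4 h.
  have := sqr_ge0 (a1 - 2 * a2); have := sqr_ge0 (a1 - a3); have := sqr_ge0 (a1 - a4).
  have := sqr_ge0 (2 * a2 - a3); have := sqr_ge0 (2 * a2 - a4); have := sqr_ge0 (a3 - a4).
  lra.
have Ig : integ g.
  apply: integZ; apply: integD; last exact: integ_cst.
  by apply: integD => //; apply: integD => //; exact: integZ.
have If : integ (fun w => (stat w - m) ^+ 2).
  apply: (integ_le _ _ Ig).
    apply: measurable_funX; apply: measurable_funB => //; exact: measurable_stat.
  by move=> w; rewrite ger0_norm ?sqr_ge0.
split=> //.
apply: le_trans (le_mean If Ig bd) _.
have I1 := integZ 4 IK; have I2 := integD IS I1; have I3 := integD I2 IN.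
have I4 := integD I3 (integ_cst P (bias ^+ 2)).
rewrite /g meanZ// meanD//; last exact: integ_cst.
rewrite mean_cst meanD// meanD// meanZ//.
have := mean_S2; have := mean_K2; have := mean_N2; lra.
Qed.

End RiskBound.

(** * The weights and basis functions of the estimator *)

Section Estimator.
Context {R : realType}.
Implicit Types n k p : nat.
Local Notation D := (@sine_entry R).
Local Notation lam := (@eigval R).

Definition inv_weight n p : R :=
  if (Num.truncn ((n%:R : R) / log2 n%:R) <= p.+1)%N
  then (n%:R - n%:R / log2 n%:R)^-1 * (eigval n p.+1)^-1 else 0.

Lemma t_hatE n (Y : nat -> R) k : t_hat n Y k =
  \sum_(p < n.-1) inv_weight n p *
    (\sum_(i < n.-1) D n i.+1 p.+1 * ((Y i.+2 - Y i.+1) * basis_fun k (i.+1%:R / n%:R))) ^+ 2.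
Proof.
rewrite /t_hat -mulmxA -[_ *m increments n Y k]trmxK trmx_mul trmxK.
set v := (increments n Y k)^T *m sine_mx n.
rewrite mxE; apply: eq_bigr => p _; rewrite /weight_mx mul_mx_diag !mxE.
rewrite -/(inv_weight n p) mulrC mulrA -expr2 mulrC; congr (_ * _ ^+ 2).
by apply: eq_bigr => i _; rewrite !mxE mulrC.
Qed.

(** The role of [n > 16]: n / log n is then at most n / 4, which keeps the normalization n - n / log
    n of order n. *)
Lemma log2_ge4 n : (16 < n)%N -> 4 <= log2 n%:R :> R.
Proof.
move=> n16; have l2 : 0 < ln 2 :> R by apply: ln_gt0; rewrite ltr1n.
rewrite /log2 ler_pdivlMr//.
have -> : 4 * ln 2 = ln (16%:R : R).
  by rewrite (_ : 16%:R = 2 ^+ 4 :> R) ?lnXn// ?mulr_natl//; rewrite -natrX.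
by rewrite ler_ln ?posrE ?ltr0n ?ler_nat//; lia.
Qed.

Lemma basis_fun_sq k (x : R) : basis_fun k x ^+ 2 = 1 + (k != 0)%:R * cosb k x.
Proof.
rewrite /basis_fun /cosb; case: eqP => _ /=; first by rewrite mul0r addr0 expr1n.
rewrite exprMn sqr_sqrtr// mul1r.
rewrite [in RHS](_ : k%:R * pi * x = 2 * (k%:R * pi * x / 2)); last by field.
by rewrite cosD1.
Qed.

Lemma basis_fun_sq_le2 k (x : R) : basis_fun k x ^+ 2 <= 2.
Proof.
rewrite basis_fun_sq; have := cosb_norm k x; rewrite ler_norml => /andP[_ h].
by case: (k != 0); rewrite /= ?mul1r ?mul0r; lra.
Qed.

Lemma basis_fun_diff_sq k (x y : R) :
  (basis_fun k x - basis_fun k y) ^+ 2 <= 8 * k%:R ^+ 2 * (x - y) ^+ 2.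
Proof.
rewrite /basis_fun; case: eqP => [->|_]; first by rewrite subrr !expr0n mulr0 mul0r.
rewrite -mulrBr exprMn sqr_sqrtr//.
rewrite (_ : 8 * k%:R ^+ 2 * _ = 2 * (4 * (k%:R * (x - y)) ^+ 2)); last by ring.
rewrite ler_pM2l// -[leLHS]real_normK ?num_real//.
have := cos_sub_le (k%:R * pi * x / 2) (k%:R * pi * y / 2).
rewrite (_ : k%:R * pi * x / 2 - _ = pi / 2 * (k%:R * (x - y))); last by field.
move=> h; apply: (@le_trans _ _ (`|pi / 2 * (k%:R * (x - y))| ^+ 2)).
  by rewrite ler_sqr ?nnegrE.
rewrite real_normK ?num_real// [leLHS]exprMn ler_wpM2r ?sqr_ge0//.
have := pihalf_02 R => /andP[]; have := pi_gt0 R; nra.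
Qed.

Section Weights.
Variable n : nat.
Hypothesis n16 : (16 < n)%N.
Local Notation L := (log2 n%:R : R).
Hypothesis Ln : 2 * L <= n%:R.
Local Notation w := ((n%:R - n%:R / L)^-1 : R).
Local Notation p0 := (Num.truncn ((n%:R : R) / L)).

(** The product of the bound 2 / n on the normalization and the inverse of the lower bound cos(1)^2
    / (4 log^2 n) on the retained eigenvalues, freed from n and log n. *)
Definition weight_const : R := 8 / cos 1 ^+ 2.
Lemma weight_const_gt0 : 0 < weight_const.
Proof. by rewrite divr_gt0// exprn_gt0// cos1_gt0. Qed.

Let L4 : 4 <= L. Proof. exact: log2_ge4. Qed.
Let L0 : 0 < L. Proof. by have := L4; lra. Qed.
Let n0 : 0 < n%:R :> R. Proof. by rewrite ltr0n; lia. Qed.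
Let nL : n%:R / L <= n%:R / 4. Proof. by rewrite ler_pM2l// lef_pV2 ?posrE. Qed.
Let w_gt0 : 0 < w. Proof. by rewrite invr_gt0; have := nL; have := n0; lra. Qed.

Lemma weight_le : w <= 2 / n%:R.
Proof.
have h : n%:R / 2 <= n%:R - n%:R / L by have := nL; have := n0; lra.
have h0 : 0 < n%:R / 2 :> R by rewrite divr_gt0.
rewrite (_ : 2 / n%:R = (n%:R / 2)^-1); last by rewrite invf_div.
have := lt_le_trans h0 h; move: h; move: (n%:R - _) => y h y0.
by rewrite lef_pV2 ?posrE.
Qed.

Let p0_bounds : p0%:R <= n%:R / L < p0.+1%:R.
Proof. by apply: truncn_itv; rewrite divr_ge0// ltW. Qed.

Let p0_half : n%:R / L <= 2 * p0%:R.
Proof.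
have /andP[_] := p0_bounds; rewrite -natr1.
have : 2 <= n%:R / L by rewrite ler_pdivlMr.
lra.
Qed.

Lemma cutoff_bounds : (0 < p0 <= n)%N.
Proof.
apply/andP; split.
  rewrite -(ltr0n R); have := p0_half; have : 2 <= n%:R / L by rewrite ler_pdivlMr.
  lra.
rewrite -(ler_nat R); have /andP[h _] := p0_bounds; have := nL; have := n0; lra.
Qed.

(** There are [n - p0] retained frequencies while the estimator is normalized by [n - n / L]; the
    integer part makes them differ by at most 1. *)
Lemma weight_count : `|w * (n - p0)%:R - 1| <= w.
Proof.
have /andP[_ pn] := cutoff_bounds; have /andP[h1 h2] := p0_bounds.
rewrite natrB// (_ : _ - 1 = w * (n%:R / L - p0%:R)); last first.
  have : n%:R - n%:R / L != 0 by rewrite gt_eqF// -invr_gt0.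
  move: (n%:R / L) => y hy; have := mulVf hy; move: (n%:R - y)^-1 => v hv.
  rewrite -[X in _ - X = _]hv; ring.
have y0 : 0 <= n%:R / L - p0%:R by rewrite subr_ge0.
have y1 : n%:R / L - p0%:R <= 1 by move: h2; rewrite -natr1; lra.
move: y0 y1 (ltW w_gt0); move: (_ - p0%:R) w => y v y0 y1 v0.
by rewrite ger0_norm ?ler_piMr ?mulr_ge0.
Qed.

(** The cut-off satisfies [p0 >= n / (2 * L)], so the angle in the eigenvalue is at least
    [1 / (2 * L)], and [sin_ge_lin] applies. *)
Let lam_low (p : 'I_(n.-1)) : (p0 <= p.+1)%N -> cos 1 ^+ 2 / (4 * L ^+ 2) <= lam n p.+1.
Proof.
move=> hp; have c1 := cos1_gt0 R; have pn := ltn_ord p.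
have pn' : p.+1%:R <= n%:R :> R by rewrite ler_nat; apply: leq_trans pn _; exact: leq_pred.
have pi2 := pi_ge2 R.
set z : R := p.+1%:R * pi / (2 * n%:R).
have z0 : (2 * L)^-1 <= z.
  apply: (@le_trans _ _ (p.+1%:R / n%:R)).
    rewrite ler_pdivlMr// invfM -mulrA [L^-1 * _]mulrC.
    have : p0%:R <= p.+1%:R :> R by rewrite ler_nat.
    have := p0_half; lra.
  rewrite /z ler_pdivrMr// (_ : p.+1%:R * pi / (2 * n%:R) * n%:R = p.+1%:R * (pi / 2)).
    by rewrite ler_peMr// ler_pdivlMr// mul1r.
  by field; rewrite gt_eqF.
have Li : 0 < (2 * L)^-1 by rewrite invr_gt0 mulr_gt0.
have z1 : 0 <= z <= pi / 2.
  rewrite (ltW (lt_le_trans Li z0))/= /z invfM mulrA ler_pdivrMr//.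
  rewrite [pi / 2 * _]mulrC mulrA ler_pM2r ?invr_gt0// ler_pM2r ?pi_gt0//.
have S := sin_ge_lin z1.
rewrite /eigval -/z.
have -> : cos 1 ^+ 2 / (4 * L ^+ 2) = 4 * (cos 1 / 2 * (2 * L)^-1) ^+ 2 by field; rewrite gt_eqF.
rewrite ler_pM2l// ler_sqr ?nnegrE.
- by apply: le_trans S; rewrite ler_pM2l// divr_gt0.
- by rewrite mulr_ge0 ?ltW// divr_gt0.
- apply: le_trans S; have /andP[z2 _] := z1; apply: mulr_ge0 => //.
  by rewrite divr_ge0// ltW.
Qed.

Let low_gt0 : 0 < cos 1 ^+ 2 / (4 * L ^+ 2).
Proof.
apply: divr_gt0; first by rewrite exprn_gt0 ?cos1_gt0.
by apply: mulr_gt0 => //; rewrite exprn_gt0.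
Qed.

Lemma inv_weight_bounds (p : 'I_(n.-1)) : 0 <= inv_weight n p <= weight_const * L ^+ 2 / n%:R.
Proof.
rewrite /inv_weight; case: ifP => hp; last first.
  by rewrite lexx /=; exact: divr_ge0 (mulr_ge0 (ltW weight_const_gt0) (sqr_ge0 _)) (ltW n0).
have low := lam_low hp.
have l0 := low_gt0; have lam0 := lt_le_trans l0 low.
apply/andP; split.
  by apply: mulr_ge0; [exact: ltW w_gt0|rewrite invr_ge0 ltW].
rewrite (_ : weight_const * L ^+ 2 / n%:R = (2 / n%:R) * (cos 1 ^+ 2 / (4 * L ^+ 2))^-1).
  apply: ler_pM; [exact: ltW w_gt0|by rewrite invr_ge0 ltW|exact: weight_le|].
  by rewrite lef_pV2 ?posrE.
by rewrite /weight_const; field; rewrite !gt_eqF ?cos1_gt0.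
Qed.

Lemma inv_weight_eigval (p : 'I_(n.-1)) :
  inv_weight n p * lam n p.+1 = if (p0 <= p.+1)%N then w else 0.
Proof.
rewrite /inv_weight; case: ifP => hp; last by rewrite mul0r.
by rewrite -mulrA mulVf ?mulr1// gt_eqF//; apply: lt_le_trans (lam_low hp); exact: low_gt0.
Qed.

(** The eigenvalue cancels against the weight and leaves [4 * w <= 8 / n]. In the second part the
    factor [L ^ 2] of the weight meets [k ^ 2 / n ^ 2], and [(k * L) ^ 2 <= n] removes both. *)
Lemma inv_weight_energy k (p : 'I_(n.-1)) : (k%:R * L) ^+ 2 <= n%:R ->
  inv_weight n p * (4 * lam n p.+1 + 2 * (8 * k%:R ^+ 2 / n%:R ^+ 2)) <=
  (8 + 16 * weight_const) / n%:R.
Proof.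
move=> kL; have /andP[J0 J1] := inv_weight_bounds p.
rewrite mulrDr mulrCA inv_weight_eigval [leRHS]mulrDl lerD//.
  apply: (@le_trans _ _ (4 * w)); first by rewrite ler_pM2l//; case: ifP; rewrite ?lexx ?(ltW w_gt0).
  have := weight_le; lra.
apply: (@le_trans _ _ (weight_const * L ^+ 2 / n%:R * (2 * (8 * k%:R ^+ 2 / n%:R ^+ 2)))).
  by rewrite ler_wpM2r// mulr_ge0// divr_ge0 ?mulr_ge0 ?sqr_ge0.
rewrite (_ : _ * _ = 16 * weight_const / n%:R * ((k%:R * L) ^+ 2 / n%:R ^+ 2)); last by field; rewrite gt_eqF.
have c0 : 0 <= 16 * weight_const / n%:R by exact: divr_ge0 (mulr_ge0 (ler0n _ _) (ltW weight_const_gt0)) (ltW n0).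
apply: ler_piMr => //; rewrite ler_pdivrMr ?exprn_gt0// mul1r.
by apply: le_trans kL _; rewrite expr2 ler_peMr ?(ltW n0)// ler1n (leq_trans _ n16).
Qed.

End Weights.
End Estimator.

(** * Moments of the noise *)

Section Noise.
Context d (T : measurableType d) (R : realType) (P : probability T R).
Variables (W : R -> {RV P >-> R}) (eps : nat -> nat -> {RV P >-> R}).
Hypothesis heps : noise W eps.

Lemma noise_moments : exists k4 : R, 1 <= k4 /\ forall n, (16 < n)%N ->
  [/\ forall j : 'I_n, L4 P (eps n j.+1),
      forall j : 'I_n, mean P (eps n j.+1) = 0,
      forall j : 'I_n, mean P (fun w => eps n j.+1 w ^+ 2) = 1 &
      forall j : 'I_n, mean P (fun w => eps n j.+1 w ^+ 4) <= k4].
Proof.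
(* All noise variables share one law, so the first variable at the smallest admissible sample size,
   17, gives the fourth moment of all. The maximum with 1 serves the condition [1 <= kappa] of
   [quad_form_variance]. *)
exists (Num.max 1 (mean P (fun w => eps 17%N 1%N w ^+ 4))); split; first by rewrite le_max lexx.
move=> n n16; have jn (j : 'I_n) : (0 < j.+1 <= n)%N by exact: ltn_ord.
have me i : measurable_fun setT (eps n i) by exact: measurable_funPT.
split=> [j|j|j|j].
- split=> //; apply: integ_lty.
  + exact: measurable_funX.
  + by move=> w; exact: pow4_ge0.
  + by have := noise_fourth heps n16 (jn j); rewrite unlock.
- by have := noise_mean heps n16 (jn j); rewrite unlock [in X in _ -> X]unlock /Rintegral => ->.
- by have := noise_var heps n16 (jn j); rewrite unlock [in X in _ -> X]unlock /Rintegral => ->.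
- rewrite le_max; apply/orP; right; rewrite unlock /Rintegral le_eqVlt.
  apply/orP; left; apply/eqP; congr fine.
  have E (X : {RV P >-> R}) : (\int[P]_w (X w ^+ 4)%:E =
      \int[distribution P X]_x (x ^+ 4)%:E)%E.
    rewrite [RHS]ge0_integral_distribution//.
      by apply/measurable_EFinP; exact: measurable_funX.
    by move=> x; rewrite lee_fin pow4_ge0.
  rewrite !E; apply: eq_measure_integral => A mA _.
  exact: (noise_law heps n16 (isT : (16 < 17)%N) (jn j) (isT : (0 < 1 <= 17)%N)).
Qed.

End Noise.

Lemma grid01 {R : realType} n c : (c <= n)%N -> 0 <= (c%:R / n%:R : R) <= 1.
Proof.
case: n => [_|n cn]; first by rewrite invr0 mulr0 lexx ler01.
by rewrite divr_ge0//= ler_pdivrMr// mul1r ler_nat.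
Qed.

(** * Bias of one estimated coefficient *)

Section PerCoefficient.
Context {R : realType}.
Local Notation U := (uniform_prob (@ltr01 R)).
Variables (t2 : R -> R) (tmax H : R) (n k : nat).
Hypothesis mt2 : measurable_fun (`[0, 1]%classic : set R) t2.
Hypothesis t2b : forall x : R, 0 <= x <= 1 -> 0 <= t2 x <= tmax.
Hypothesis t2h : forall x y : R, 0 <= x <= 1 -> 0 <= y <= 1 ->
  `|t2 x - t2 y| <= H * `|x - y| `^ (1 / 2).
Hypothesis H0 : 0 <= H.
Hypothesis n16 : (16 < n)%N.
Hypothesis Ln : 2 * log2 n%:R <= n%:R :> R.
Hypothesis kL : (k%:R * log2 n%:R) ^+ 2 <= n%:R :> R.
Local Notation L := (log2 n%:R : R).

Definition coef_mean : R := mean U (fun x => unit_ext t2 x * basis_fun k x ^+ 2).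

Let tau (c : nat) : R := Num.sqrt (t2 (c%:R / n%:R)).
Let f (c : nat) : R := basis_fun k (c%:R / n%:R).
Let L2 : R := 8 * k%:R ^+ 2 / n%:R ^+ 2.
Let n0 : 0 < n%:R :> R. Proof. by rewrite ltr0n; lia. Qed.
Let tmax0 : 0 <= tmax.
Proof. by have /andP[] := t2b (x := 0) ltac:(by rewrite lexx ler01); exact: le_trans. Qed.

Lemma grid_f2 c : (c <= n)%N -> f c ^+ 2 <= 2.
Proof. by move=> _; exact: basis_fun_sq_le2. Qed.

Lemma grid_df2 c : (c < n)%N -> (f c.+1 - f c) ^+ 2 <= L2.
Proof.
move=> _; apply: le_trans (basis_fun_diff_sq _ _ _) _.
by rewrite /L2 -mulrBl -natrB// subSnn mul1r exprVn.
Qed.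

Lemma grid_tau_sq c : (c <= n)%N -> tau c ^+ 2 = t2 (c%:R / n%:R).
Proof. by move=> cn; rewrite /tau sqr_sqrtr//; case/andP: (t2b (grid01 cn)). Qed.

Lemma grid_tau2 c : (0 < c <= n)%N -> tau c ^+ 2 <= tmax.
Proof. by move=> /andP[_ cn]; rewrite grid_tau_sq//; case/andP: (t2b (grid01 cn)). Qed.

Definition bias_const : R := tmax * (12 + 16 * weight_const) + 2 * H + 4 * tmax.

Let rt : R := (Num.sqrt n%:R)^-1.
Let rt0 : 0 < rt. Proof. by rewrite invr_gt0 sqrtr_gt0. Qed.
Let rt2 : rt ^+ 2 = n%:R^-1. Proof. by rewrite exprVn sqr_sqrtr// ltW. Qed.
Let rt1 : rt <= 1.
Proof.
have n1 : 1 <= n%:R :> R by rewrite ler1n (leq_trans _ n16).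
by rewrite invf_le1 ?sqrtr_gt0// -[leLHS](sqrtr1 R) ler_sqrt.
Qed.
Let kn : k%:R / n%:R <= rt.
Proof.
have L4 := @log2_ge4 R _ n16.
have k0 : 0 <= k%:R :> R by [].
have : (k%:R / n%:R) ^+ 2 <= rt ^+ 2.
  rewrite exprMn rt2 exprVn ler_pdivrMr ?exprn_gt0// expr2 mulrA mulVf ?gt_eqF// mul1r.
  apply: le_trans kL; rewrite exprMn ler_peMr ?sqr_ge0//.
  by rewrite expr2; nra.
by rewrite ler_sqr ?nnegrE ?divr_ge0// ltW.
Qed.

(** Over a cell of length 1 / n the Hoelder exponent 1/2 lets [t2] vary by [H * n ^ (-1/2)], and the
    squared basis function varies by at most [pi * k / n <= 4 * n ^ (-1/2)]. *)
Lemma riemann_bias :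
  `|n%:R^-1 * \sum_(c < n) tau c.+1 ^+ 2 * f c.+1 ^+ 2 - coef_mean| <= (2 * H + 4 * tmax) * rt.
Proof.
pose g (x : R) := t2 x * basis_fun k x ^+ 2.
rewrite (eq_bigr (fun c : 'I_n => g (c.+1%:R / n%:R))); last first.
  by move=> c _; rewrite grid_tau_sq// ltn_ord.
have mb : measurable_fun setT (fun x : R => basis_fun k x ^+ 2).
  under eq_fun do rewrite basis_fun_sq.
  by apply: measurable_funD => //; apply: measurable_funM => //; exact: measurable_cosb.
have ub := unit_ext_bounded (f := t2) (b := tmax)
  ltac:(by move=> x /t2b /andP[h1 h2]; rewrite ger0_norm).
apply: riemann_sum; first by lia.
- apply: (integ_bounded_fun (c := tmax * 2)).
    by apply: measurable_funM => //; exact: measurable_unit_ext.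
  move=> x; rewrite normrM ler_pM//.
  by rewrite ger0_norm ?sqr_ge0// basis_fun_sq_le2.
- by move=> x x01; rewrite /unit_ext x01.
move=> x y x01 y01 xy; rewrite /g.
have -> : t2 x * basis_fun k x ^+ 2 - t2 y * basis_fun k y ^+ 2 =
   (t2 x - t2 y) * basis_fun k x ^+ 2 + t2 y * (basis_fun k x ^+ 2 - basis_fun k y ^+ 2) by ring.
apply: le_trans (ler_normD _ _) _; rewrite [leRHS]mulrDl lerD//.
  rewrite normrM [2 * H]mulrC -mulrA [2 * rt]mulrC mulrA ler_pM//.
    apply: le_trans (t2h x01 y01) _; rewrite ler_wpM2l//.
    rewrite div1r powR12_sqrt// /rt -sqrtrV ?(ltW n0)//.
    by rewrite ler_sqrt// ?invr_ge0 ?(ltW n0).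
  by rewrite ger0_norm ?sqr_ge0// basis_fun_sq_le2.
have /andP[ty0 ty1] := t2b y01.
rewrite normrM (ger0_norm ty0) [4 * _]mulrC -mulrA ler_pM//.
rewrite !basis_fun_sq opprD addrACA subrr add0r -mulrBr normrM.
apply: (@le_trans _ _ `|cosb k x - cosb k y|).
  by rewrite ler_piMl//; case: (k != 0); rewrite /= ?normr1 ?normr0.
apply: le_trans (cos_sub_le _ _) _; rewrite -mulrBr normrM normrM.
rewrite (ger0_norm (pi_ge0 R)) (ger0_norm (ler0n R k)).
apply: (@le_trans _ _ (k%:R * pi * n%:R^-1)).
  by rewrite ler_wpM2l// mulr_ge0// pi_ge0.
have := pi_ge0 R; have /andP[_ p2] := pihalf_02 R; have p4 : pi <= 4 :> R by move: p2; lra.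
rewrite mulrAC => p0; rewrite mulrC; apply: ler_pM => //.
Qed.

(** [noise_bias] is applied with [eta = n ^ (-1/2)], which balances the energy term [eta * n * w]
    against the term in [1 / eta], itself of order [(k * L) ^ 2 / (n ^ 2 * eta)]. The 12 in
    [bias_const] is made of three contributions of 4. *)
Lemma t_hat_bias :
  `|\sum_(p < n.-1) inv_weight n p * \sum_(c < n) noise_mx n f tau p c ^+ 2 - coef_mean|
  <= bias_const * rt.
Proof.
set S := \sum_(p < _) _.
rewrite (_ : S - coef_mean = (S - n%:R^-1 * \sum_(c < n) tau c.+1 ^+ 2 * f c.+1 ^+ 2) +
  (n%:R^-1 * \sum_(c < n) tau c.+1 ^+ 2 * f c.+1 ^+ 2 - coef_mean)); last by rewrite addrA subrK.
apply: le_trans (ler_normD _ _) _.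
have n1 : (1 < n)%N by lia.
have w0 : 0 <= (n%:R - n%:R / L)^-1.
  rewrite invr_ge0; have L4 := @log2_ge4 R _ n16.
  have L0 : 0 < L by lra.
  by rewrite subr_ge0 ler_pdivrMr// ler_peMr ?(ltW n0)//; lra.
have := noise_bias n1 grid_f2 grid_df2 grid_tau2 (cutoff_bounds n16 Ln) w0
  (inv_weight_bounds n16 Ln) (inv_weight_eigval n16 Ln) rt0.
rewrite -/S; move=> h1; have h2 := riemann_bias.
rewrite /bias_const -addrA mulrDl; apply: lerD h2; apply: le_trans h1 _.
rewrite -[leRHS]mulrA ler_wpM2l//.
have w1 := weight_le n16 Ln; have w2 := weight_count n16 Ln.
have c0 := @weight_const_gt0 R.
have X0 : (1 + rt^-1) * L2 * (weight_const * L ^+ 2 / n%:R) * n%:R <= 16 * weight_const * rt.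
  have -> : (1 + rt^-1) * L2 * (weight_const * L ^+ 2 / n%:R) * n%:R =
      8 * weight_const * (1 + rt^-1) * ((k%:R * L) ^+ 2 / n%:R ^+ 2).
    by rewrite /L2; field; rewrite !gt_eqF.
  have Y0 : (k%:R * L) ^+ 2 / n%:R ^+ 2 <= rt ^+ 2.
    by rewrite rt2 ler_pdivrMr ?exprn_gt0// (_ : _^-1 * _ = n%:R)//; field; rewrite gt_eqF.
  have Z0 : 0 <= 8 * weight_const * (1 + rt^-1).
    by apply: mulr_ge0; [exact: mulr_ge0 (ler0n _ _) (ltW c0)|rewrite addr_ge0// invr_ge0 ltW].
  apply: le_trans (ler_wpM2l Z0 Y0) _.
  have -> : 8 * weight_const * (1 + rt^-1) * rt ^+ 2 = 8 * weight_const * (rt ^+ 2 + rt) by field; rewrite gt_eqF.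
  have : 0 <= weight_const * (rt - rt ^+ 2).
    by rewrite mulr_ge0 ?(ltW c0)// subr_ge0 expr2 ler_piMl ?(ltW rt0).
  lra.
have nw : n%:R * (n%:R - n%:R / L)^-1 <= 2.
  by rewrite mulrC -ler_pdivlMr.
have sn : Num.sqrt n%:R = n%:R * rt :> R.
  by rewrite /rt -[X in _ = X * _](sqr_sqrtr (ltW n0)) expr2 mulfK// gt_eqF// sqrtr_gt0.
have wr : (n%:R - n%:R / L)^-1 <= 2 * rt.
  apply: le_trans w1 _; rewrite -rt2 ler_pM2l// expr2.
  by have := rt0; have := rt1; nra.
rewrite sn; set v := (n%:R - n%:R / L)^-1 in w0 w2 nw wr *.
have n1r : n%:R * rt * v <= 2 * rt.
  by rewrite mulrAC ler_wpM2r ?(ltW rt0).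
rewrite (_ : n%:R * (2 * rt * v + (1 + rt^-1) * L2 * (weight_const * L ^+ 2 / n%:R)) =
  2 * (n%:R * rt * v) + (1 + rt^-1) * L2 * (weight_const * L ^+ 2 / n%:R) * n%:R); last by ring.
rewrite [v * (n%:R * rt)]mulrC; move: X0 w2 wr n1r.
move: (`|_ - 1|) (_ * n%:R) (n%:R * rt * v) => a b e.
by have := rt0; lra.
Qed.

End PerCoefficient.

(** * Risk of one estimated coefficient *)

Section CoefficientRisk.
Context d (T : measurableType d) (R : realType) (P : probability T R).
Variables (W : R -> {RV P >-> R}) (eps : nat -> nat -> {RV P >-> R}).
Hypothesis heps : noise W eps.
Variables (tmax H k4 cq : R).
Hypothesis H0 : 0 <= H.
Hypothesis k41 : 1 <= k4.
Hypothesis cq0 : 0 < cq.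

Definition kappa_const : R := 8 + 16 * weight_const.

Definition risk_const : R :=
  4 * (4 * weight_const ^+ 2 * cq ^+ 2 + 8 * tmax * kappa_const * weight_const * cq
    + 2 * k4 * (tmax * kappa_const) ^+ 2 + bias_const tmax H ^+ 2).

(** The bound required on [K] is the one for which [Jmax ^ 2 * n ^ 2 * K], with its factor log^4 n,
    is of order 1 / n. *)
Lemma t_hat_risk (n k : nat) (t2 : R -> R) (Y Z : nat -> T -> R) (K : R) :
  measurable_fun (`[0, 1]%classic : set R) t2 ->
  (forall x : R, 0 <= x <= 1 -> 0 <= t2 x <= tmax) ->
  (forall x y : R, 0 <= x <= 1 -> 0 <= y <= 1 ->
    `|t2 x - t2 y| <= H * `|x - y| `^ (1 / 2)) ->
  (16 < n)%N -> 2 * log2 n%:R <= n%:R :> R ->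
  (k%:R * log2 n%:R) ^+ 2 <= n%:R :> R ->
  [/\ forall j : 'I_n, L4 P (eps n j.+1),
      forall j : 'I_n, mean P (eps n j.+1) = 0,
      forall j : 'I_n, mean P (fun w => eps n j.+1 w ^+ 2) = 1 &
      forall j : 'I_n, mean P (fun w => eps n j.+1 w ^+ 4) <= k4] ->
  signal eps n Z K ->
  K <= (cq / (Num.sqrt n%:R * log2 n%:R ^+ 2)) ^+ 2 ->
  (forall i w, (0 < i < n)%N -> Y i.+1 w - Y i w = Z i w +
    (Num.sqrt (t2 (i.+1%:R / n%:R)) * eps n i.+1 w - Num.sqrt (t2 (i%:R / n%:R)) * eps n i w)) ->
  [/\ measurable_fun setT (fun w => t_hat n (Y^~ w) k),
      integ P (fun w => (t_hat n (Y^~ w) k - coef_mean t2 k) ^+ 2) &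
      mean P (fun w => (t_hat n (Y^~ w) k - coef_mean t2 k) ^+ 2) <= risk_const / n%:R].
Proof.
move=> mt2 t2b t2h n16 Ln kL [eL4 e0 e2 e4] sZ Kq YE.
have n0 : 0 < n%:R :> R by rewrite ltr0n; lia.
have L40 := @log2_ge4 R _ n16; have L0 : 0 < log2 n%:R :> R by lra.
have r0 : 0 < Num.sqrt n%:R :> R by rewrite sqrtr_gt0.
have q0 : 0 < cq / (Num.sqrt n%:R * log2 n%:R ^+ 2).
  by rewrite divr_gt0// mulr_gt0// exprn_gt0.
have Jk (p : 'I_(n.-1)) : inv_weight n p * (4 * eigval n p.+1 + 2 * (8 * k%:R ^+ 2 / n%:R ^+ 2)) <=
  kappa_const / n%:R := inv_weight_energy n16 Ln p kL.
have tE w : t_hat n (Y^~ w) k = \sum_(p < n.-1) inv_weight n p *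
   (\sum_(i < n.-1) sine_entry n i.+1 p.+1 *
     ((Y i.+2 w - Y i.+1 w) * basis_fun k (i.+1%:R / n%:R))) ^+ 2 by rewrite t_hatE.
have mB := t_hat_bias mt2 t2b t2h H0 n16 Ln kL.
have df2 := @grid_df2 R n k.
have tau2 := @grid_tau2 R t2 tmax n t2b.
have ei := noise_indep heps n16.
have [ms I B] := stat_risk n16 (@grid_f2 R n k) df2 tau2 (inv_weight_bounds n16 Ln) Jk eL4 e0 e2 e4 k41
  ei sZ q0 Kq YE mB.
have tEf : (fun w => t_hat n (Y^~ w) k) = fun w => \sum_(p < n.-1) inv_weight n p *
   (\sum_(i < n.-1) sine_entry n i.+1 p.+1 *
     ((Y i.+2 w - Y i.+1 w) * basis_fun k (i.+1%:R / n%:R))) ^+ 2.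
  by apply/funext => w; exact: tE.
split; first by rewrite tEf.
  by apply: eq_integ I => w; rewrite tE.
apply: (@le_trans _ _ (mean P (fun w => (\sum_(p < n.-1) inv_weight n p *
   (\sum_(i < n.-1) sine_entry n i.+1 p.+1 *
     ((Y i.+2 w - Y i.+1 w) * basis_fun k (i.+1%:R / n%:R))) ^+ 2 - coef_mean t2 k) ^+ 2))).
  by rewrite le_eqVlt; apply/orP; left; apply/eqP/eq_mean => w; rewrite tE.
apply: le_trans B _; rewrite /risk_const -[leRHS]mulrA ler_pM2l// [leRHS]mulrDl.
rewrite [X in _ <= X + _]mulrDl [X in _ <= X + _ + _]mulrDl.
set rt := Num.sqrt n%:R in r0 q0 Kq *; set l := log2 n%:R in L0 L40 Kq q0 *.
have nE : n%:R = rt ^+ 2 :> R by rewrite sqr_sqrtr// ltW.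
have rt1 : rt^-1 <= 1.
  have n1 : 1 <= n%:R :> R by rewrite ler1n (leq_trans _ n16).
  by rewrite invf_le1// -[leLHS](sqrtr1 R) ler_sqrt.
have tm0 : 0 <= tmax by have /andP[] := t2b 0 ltac:(by rewrite lexx ler01); exact: le_trans.
have cJ0 : 0 < weight_const :> R by exact: weight_const_gt0.
have ck0 : 0 <= kappa_const by rewrite addr_ge0// mulr_ge0// ltW.
repeat apply: lerD.
- apply: le_trans (ler_wpM2l _ Kq) _.
    by apply: mulr_ge0; [apply: mulr_ge0 => //|]; exact: sqr_ge0.
  rewrite nE le_eqVlt; apply/orP; left; apply/eqP.
  by field; rewrite !gt_eqF.
- have X0 : 0 <= 8 * tmax * kappa_const * weight_const * cq by rewrite mulr_ge0 ?(ltW cq0)// mulr_ge0 ?(ltW cJ0)// mulr_ge0// mulr_ge0.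
  apply: le_trans (_ : 8 * tmax * kappa_const * weight_const * cq / n%:R * rt^-1 <= _).
    rewrite nE le_eqVlt; apply/orP; left; apply/eqP.
    by field; rewrite !gt_eqF.
  by apply: ler_piMr => //; rewrite divr_ge0// ltW.
- rewrite le_eqVlt; apply/orP; left; apply/eqP.
  by field; rewrite gt_eqF.
- rewrite nE le_eqVlt; apply/orP; left; apply/eqP.
  by field; rewrite !gt_eqF.
Qed.


End CoefficientRisk.

(** Integrals of nonnegative functions are suprema over simple functions below them, so comparison
    needs no measurability. The integrated squared error can thus be bounded outcome by outcome. *)
Lemma ge0_le_integralT d (T : measurableType d) (R : realType)
    (mu : {measure set T -> \bar R}) (f g : T -> \bar R) :
  (forall x, 0 <= f x)%E -> (forall x, f x <= g x)%E ->
  (\int[mu]_x f x <= \int[mu]_x g x)%E.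
Proof.
move=> f0 fg; have g0 x : (0 <= g x)%E by exact: le_trans (fg x).
rewrite !ge0_integralTE//; apply: ereal_sup_le => _ [h hf <-]; exists h => // x.
exact: le_trans (hf x) (fg x).
Qed.

(** * From the coefficients to the integrated risk *)

Section CoefMean.
Context {R : realType}.
Local Notation U := (uniform_prob (@ltr01 R)).
Variables (a C b : R) (f : R -> R) (theta : nat -> R).
Hypothesis a0 : 0 < a.
Hypothesis mf : measurable_fun (`[0, 1]%classic : set R) f.
Hypothesis fb : forall x : R, 0 <= x <= 1 -> `|f x| <= b.
Hypothesis ftheta : (\int[@lebesgue_measure R]_(x in `[0%R, 1%R])
  ((f x - cosine_sum theta m x) ^+ 2)%:E)%E @[m --> \oo] --> 0%E.

Lemma coef_meanE k : coef_mean f k = theta 0%N + (k != 0%N)%:R * theta k.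
Proof.
have I j : integ U (fun x => unit_ext f x * cosb j x).
  apply: (integ_bounded_fun (c := b * 1)).
    by apply: measurable_funM; [exact: measurable_unit_ext|exact: measurable_cosb].
  move=> x; rewrite normrM; apply: ler_pM => //; last exact: cosb_norm.
  exact: unit_ext_bounded.
rewrite -(mean_unit_ext_cosb mf fb ftheta 0) -(mean_unit_ext_cosb mf fb ftheta k).
rewrite -meanZ; last exact: I.
rewrite -meanD; [|exact: I|exact: integZ].
apply: eq_mean => x; rewrite basis_fun_sq {2}/cosb !mul0r cos0.
by ring.
Qed.

Hypothesis sumtheta :
  (\sum_(1 <= i <oo) (i%:R `^ (2 * a) * theta i ^+ 2)%:E <= C%:E)%E.
Variable N : nat.
Hypothesis N0 : (0 < N)%N.

(** The error splits into the tail of the cosine series and a cosine sum in the coefficient errors.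
    Each coefficient with [i >= 1] is a difference of two targets, so the error of [t_hat] at 0
    occurs [N] times more. *)
Lemma ise_le n (Y : nat -> R) :
  (\int[@lebesgue_measure R]_(t in `[0%R, 1%R]) ((tau2hat n Y N t - f t) ^+ 2)%:E <=
   (8 * C * N%:R `^ (- (2 * a)) + (2 * (t_hat n Y 0 - coef_mean f 0) ^+ 2 +
     8 * \sum_(1 <= i < N.+1) ((t_hat n Y i - coef_mean f i) ^+ 2 +
        (t_hat n Y 0 - coef_mean f 0) ^+ 2)))%:E)%E.
Proof.
pose phi i := if i == 0%N then t_hat n Y 0 else t_hat n Y i - t_hat n Y 0.
have E t : tau2hat n Y N t = cosine_sum phi N t.
  rewrite /tau2hat /cosine_sum /phi /=; congr (_ + 2 * _).
  rewrite big_nat_cond [RHS]big_nat_cond; apply: eq_bigr => i /andP[/andP[i0 _] _].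
  by rewrite gtn_eqF.
under eq_integral do rewrite E -sqrrN opprB.
rewrite (integral_unit_ext_sub mf fb) lee_fin.
pose psi i := theta i - phi i.
have bd x : (unit_ext f x - cosine_sum phi N x) ^+ 2 <=
   2 * (unit_ext f x - cosine_sum theta N x) ^+ 2 + 2 * cosine_sum psi N x ^+ 2.
  rewrite /psi -cosine_sumB.
  move: (unit_ext f x) (cosine_sum _ _ _) (cosine_sum _ _ _) => u v w.
  have := sqr_ge0 ((u - v) - (v - w)); lra.
have I1 := integ_unit_ext_sub mf fb theta N; have I2 := integ_cosine_sum_sq psi N.
apply: le_trans (le_mean (integ_unit_ext_sub mf fb phi N) _ bd) _.
  by apply: integD; exact: integZ.
rewrite meanD; [|exact: integZ|exact: integZ].
rewrite !meanZ//; apply: lerD.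
  have := cosine_tail a0 mf fb ftheta sumtheta N0; lra.
rewrite mean_cosine_sum_sq mulrDr; apply: lerD.
  rewrite coef_meanE /= mul0r addr0 /psi /phi /=.
  move: (theta 0%N) (t_hat _ _ _) => u v; lra.
rewrite mulrA (_ : 8 = 2 * 2 * 2 :> R); last by ring.
rewrite -[leRHS]mulrA ler_pM2l// mulr_sumr.
rewrite big_nat_cond [leRHS]big_nat_cond; apply: ler_sum => i /andP[/andP[i0 _] _].
rewrite !coef_meanE /psi /phi gtn_eqF//= mul0r addr0 mul1r.
move: (theta i) (theta 0%N) (t_hat _ _ _) (t_hat _ _ _) => u v w z.
have := sqr_ge0 ((z - (v + u)) + (w - v)); lra.
Qed.

Lemma mise_le d (T : measurableType d) (P : probability T R) n (Y : nat -> T -> R) (r : R) :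
  (forall k, (k <= N)%N ->
    integ P (fun w => (t_hat n (Y^~ w) k - coef_mean f k) ^+ 2) /\
    mean P (fun w => (t_hat n (Y^~ w) k - coef_mean f k) ^+ 2) <= r) ->
  (mise P n Y N f <= (8 * C * N%:R `^ (- (2 * a)) + (2 + 16 * N%:R) * r)%:E)%E.
Proof.
move=> H; pose D k w := (t_hat n (Y^~ w) k - coef_mean f k) ^+ 2.
pose h w := 8 * C * N%:R `^ (- (2 * a)) + (2 * D 0%N w +
     8 * \sum_(1 <= i < N.+1) (D i w + D 0%N w)).
have ID k : (k <= N)%N -> integ P (D k) by move=> /H[].
have MD k : (k <= N)%N -> mean P (D k) <= r by move=> /H[].
have IS : integ P (fun w => \sum_(i < N) (D i.+1 w + D 0%N w)).
  by apply: integ_sum => i _; apply: integD; apply: ID => //; exact: ltn_ord.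
have SE w : \sum_(1 <= i < N.+1) (D i w + D 0%N w) = \sum_(i < N) (D i.+1 w + D 0%N w).
  by rewrite big_add1 big_mkord.
pose h' w := 8 * C * N%:R `^ (- (2 * a)) + (2 * D 0%N w + 8 * \sum_(i < N) (D i.+1 w + D 0%N w)).
have I0 := integZ 2 (ID 0%N (leq0n _)); have I1 := integZ 8 IS.
have I2 := integD I0 I1; have Ih' : integ P h' := integD (integ_cst P _) I2.
have : (mise P n Y N f <= \int[P]_w (h' w)%:E)%E.
  rewrite /mise; apply: ge0_le_integralT.
    by move=> w; apply: integral_ge0 => t _; rewrite lee_fin sqr_ge0.
  move=> w; apply: le_trans (ise_le n (Y^~ w)) _.
  by rewrite lee_fin /h' -SE.
rewrite integ_mean// => h1; apply: le_trans h1 _; rewrite lee_fin.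
rewrite /h' meanD//; last exact: integ_cst.
rewrite mean_cst lerD2l meanD// meanZ//; last exact: ID.
rewrite meanZ// mean_sum; last first.
  by move=> i _; apply: integD; apply: ID => //; exact: ltn_ord.
rewrite [leRHS]mulrDl; apply: lerD; first by rewrite ler_pM2l// MD.
rewrite (_ : 16 * N%:R * r = 8 * \sum_(i < N) (r + r)); last first.
  by rewrite sumr_const card_ord -mulr_natl; ring.
rewrite ler_pM2l//; apply: ler_sum => i _.
rewrite meanD; [|apply: ID; exact: ltn_ord|exact: ID].
by apply: lerD; apply: MD => //; exact: ltn_ord.
Qed.

End CoefMean.

(** * Rates *)

Section Asymptotics.
Context {R : realType}.
Implicit Types (p K A e : R).

Lemma powR_eventually_ge p K : 0 < p -> \forall n \near \oo, K <= n%:R `^ p.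
Proof.
move=> p0; near=> n.
apply: (@le_trans _ _ ((`|K| `^ p^-1) `^ p)).
  by rewrite -powRrM mulVf ?gt_eqF// powRr1// ler_norm.
apply: ge0_ler_powR; rewrite ?nnegrE ?powR_ge0 ?(ltW p0)//.
by near: n; exact: nbhs_infty_ger.
Unshelve. all: by end_near. Qed.

(** Sublinearity of [ln] at [n ^ (p / 2)] spends half of the exponent; the other half absorbs [K]
    and the constants. *)
Lemma log2_eventually_le p K : 0 < p -> 0 <= K ->
  \forall n \near \oo, K * log2 n%:R <= n%:R `^ p.
Proof.
move=> p0 K0; pose c : R := (p / 2 * ln 2)^-1.
have l2 : 0 < ln 2 :> R by apply: ln_gt0; rewrite ltr1n.
have p20 : 0 < p / 2 by rewrite divr_gt0.
near=> n.
have n0 : 0 < n%:R :> R by rewrite ltr0n; near: n; exact: nbhs_infty_gt.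
have h1 : log2 n%:R <= c * n%:R `^ (p / 2).
  rewrite /log2 /c ler_pdivrMr//.
  rewrite [leRHS](_ : _ = n%:R `^ (p / 2) / (p / 2)); last first.
    by field; rewrite !gt_eqF.
  rewrite ler_pdivlMr// mulrC -ln_powR.
  by apply/ltW/ln_sublinear; exact: powR_gt0.
have h2 : K * c <= n%:R `^ (p / 2) by near: n; exact: powR_eventually_ge.
apply: le_trans (ler_wpM2l K0 h1) _; rewrite mulrA.
apply: le_trans (ler_wpM2r (powR_ge0 _ _) h2) _.
rewrite -powRD; last by apply/implyP => _; rewrite gt_eqF.
by rewrite (_ : p / 2 + p / 2 = p)//; field.
Unshelve. all: by end_near. Qed.

(** The fourth power of [n ^ -(1 / 4 + e)] is [1 / n] times [n ^ (-4 * e)], and the surplus beats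
    [A * log2 n ^ 4]. The condition [e <= 1 / 4] lets this rate dominate the Brownian contribution
    [n ^ -2]. *)
Lemma holder_increment_rate (n : nat) A e : (16 < n)%N -> 0 <= A -> 0 < e <= 1 / 4 ->
  (1 + A) * log2 n%:R <= n%:R `^ e ->
  n%:R^-1 ^+ 2 <= (n%:R^-1 `^ (1 / 4 + e)) ^+ 4 /\
  A * (n%:R^-1 `^ (1 / 4 + e)) ^+ 4 <= (1 / (Num.sqrt n%:R * log2 n%:R ^+ 2)) ^+ 2.
Proof.
move=> n16 A0 /andP[e0 e1] AL.
have n0 : 0 < n%:R :> R by rewrite ltr0n; lia.
have L0 : 0 < log2 n%:R :> R by have := @log2_ge4 R _ n16; lra.
have v0 : 0 < n%:R^-1 :> R by rewrite invr_gt0.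
have v1 : n%:R^-1 <= 1 :> R by rewrite invf_le1// ler1n; lia.
set v := n%:R^-1 in v0 v1 *; set u := v `^ e.
have u0 : 0 < u by exact: powR_gt0.
have E : (v `^ (1 / 4 + e)) ^+ 4 = v * u ^+ 4.
  rewrite powRD; last by apply/implyP => _; rewrite gt_eqF.
  rewrite exprMn; congr (_ * _).
  rewrite -powR_mulrn ?powR_ge0// -powRrM (_ : 1 / 4 * 4%:R = 1) ?powRr1 ?ltW//.
  by field.
rewrite E; split.
  rewrite expr2 ler_pM2l//.
  rewrite -powR_mulrn ?powR_ge0// -powRrM -[leLHS](powRr1 (ltW v0)).
  rewrite /powR gt_eqF// ler_expR ler_wnM2r ?ln_le0//.
  by rewrite mulrC; lra.
have uE : u = (n%:R `^ e)^-1 by rewrite /u /v -powR_inv1 ?ltW// -powRrM mulN1r powRN.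
have h : (1 + A) * log2 n%:R * u <= 1.
  by rewrite uE ler_pdivrMr ?powR_gt0// mul1r.
set l := log2 n%:R in L0 h AL *.
have h4 : A * (l * u) ^+ 4 <= 1.
  apply: (@le_trans _ _ (((1 + A) * l * u) ^+ 4)).
    rewrite -[(1 + A) * l * u]mulrA [leRHS]exprMn ler_wpM2r ?pow4_ge0//.
    apply: (@le_trans _ _ (1 + A)); first lra.
    by apply: ler_eXnr => //; lra.
  by apply: exprn_ile1 => //; rewrite mulr_ge0 ?(ltW u0)// mulr_ge0 ?(ltW L0)// addr_ge0.
rewrite expr_div_n expr1n exprMn sqr_sqrtr ?(ltW n0)// -exprM /= ler_pdivlMr; last first.
  by rewrite mulr_gt0// exprn_gt0.
rewrite (_ : A * _ * _ = A * (l * u) ^+ 4)// /v; by field; rewrite gt_eqF.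
Qed.

End Asymptotics.

(** Away from 0 the square root is Lipschitz, so Hoelder continuity passes from sigma^2 to sigma. *)
Lemma sqrt_diff_pow4 (R : realType) (m x y : R) : 0 < m -> m <= x -> m <= y ->
  (Num.sqrt x - Num.sqrt y) ^+ 4 <= (x - y) ^+ 4 / m ^+ 2.
Proof.
move=> m0 mx my; have x0 := le_trans (ltW m0) mx; have y0 := le_trans (ltW m0) my.
have -> : x - y = (Num.sqrt x - Num.sqrt y) * (Num.sqrt x + Num.sqrt y).
  by rewrite -subr_sqr !sqr_sqrtr.
rewrite exprMn.
rewrite -mulrA ler_peMr ?pow4_ge0// ler_pdivlMr ?exprn_gt0// mul1r.
rewrite (_ : 4 = 2 * 2)%N// exprM ler_sqr ?nnegrE ?sqr_ge0 ?(ltW m0)//.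
rewrite -[leLHS](sqr_sqrtr (ltW m0)) ler_sqr ?nnegrE ?addr_ge0//.
by apply: (@le_trans _ _ (Num.sqrt x)); [rewrite ler_sqrt|rewrite lerDl].
Qed.

Lemma risk_const_ge0 (R : realType) (tmax H k4 cq : R) : 0 <= tmax -> 0 <= k4 -> 0 <= cq ->
  0 <= risk_const tmax H k4 cq.
Proof.
move=> t0 k40 q0; have cJ0 : 0 < weight_const :> R by exact: weight_const_gt0.
have ck0 : 0 <= kappa_const R by rewrite addr_ge0// mulr_ge0// ltW.
rewrite mulr_ge0// !addr_ge0//.
- by rewrite mulr_ge0 ?sqr_ge0// mulr_ge0// sqr_ge0.
- by rewrite mulr_ge0// mulr_ge0 ?(ltW cJ0)// mulr_ge0// mulr_ge0.
- by rewrite mulr_ge0 ?sqr_ge0// mulr_ge0.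
- exact: sqr_ge0.
Qed.

(** * The uniform bound over the smoothness classes *)

Section UniformBound.
Context (R : realType) (d : measure_display) (T : measurableType d)
  (P : probability T R) (W : R -> {RV P >-> R}) (eps : nat -> nat -> {RV P >-> R}).
Hypotheses (hW : brownian_motion W) (heps : noise W eps).
Variables (smin smax tmin tmax : R).
Hypotheses (hsmin : 0 < smin) (hsmax : smin < smax) (htmin : 0 < tmin) (htmax : tmin < tmax).
Variables (alpha beta Q Qbar : R).
Hypotheses (hbeta : 1 < beta) (hQ : 0 < Q) (hQbar : 0 < Qbar).
Variable M : model.
Hypothesis hM : (M = ModelI /\ 1 / 2 < alpha) \/ (M = ModelII /\ 3 / 4 < alpha).
Local Notation S := (smooth_class_b alpha Q smin smax).
Local Notation U := (smooth_class_b beta Qbar tmin tmax).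

Lemma smooth_class_b_holder (a C l u g : R) (f : R -> R) : 0 < a -> 0 <= C -> 0 <= l ->
  0 <= g <= 1 -> 1 < 2 * a - 2 * g -> smooth_class_b a C l u f ->
  forall x y : R, 0 <= x <= 1 -> 0 <= y <= 1 ->
  `|f x - f y| <= 2 * pi * (C + (1 + (2 * a - 2 * g - 1)^-1)) * `|x - y| `^ g.
Proof.
move=> a0 C0 l0 g01 ag [[mf _ [theta [ftheta sumtheta]]] fc fb] x y x01 y01.
have fb' z : 0 <= z <= 1 -> `|f z| <= u.
  by move=> /fb /andP[h1 h2]; rewrite ger0_norm// (le_trans l0).
exact: (smooth_holder C0 mf fb' ftheta sumtheta fc g01 ag x01 y01).
Qed.

(** The threshold on [n] is chosen before [N], so that the bound can be used along any sequence; the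
    growth of [N] enters only through [(N * log2 n) ^ 2 <= n], which then holds for all [k <= N]. *)
Lemma sup_mise_bound : exists C0 : R, 0 <= C0 /\ \forall n \near \oo,
  forall N, (0 < N)%N -> (N%:R * log2 n%:R) ^+ 2 <= n%:R :> R ->
  (sup_mise W eps M S U n N <=
   (C0 * (N%:R `^ (- (2 * beta)) + N%:R * n%:R^-1))%:E)%E.
Proof.
have [k4 [k41 mom]] := noise_moments heps.
have smax0 : 0 < smax by exact: lt_trans hsmax.
have tmax0 : 0 < tmax by exact: lt_trans htmax.
have alpha0 : 0 < alpha by case: hM => -[_]; lra.
have beta0 : 0 < beta by apply: lt_trans hbeta.
have [e [e0 e1 ea]] : exists e : R, [/\ 0 < e, e <= 1 / 4 &
    M = ModelII -> 1 < 2 * alpha - 2 * (1 / 4 + e)].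
  case: hM => -[-> h]; first by exists (1 / 4); split=> //; lra.
  (* Half of the gap above 3/4 leaves [2 * alpha - 2 * (1 / 4 + e) >= alpha + 1 / 4 > 1], as the
     Hoelder bound requires. *)
  exists (Num.min (1 / 4) ((alpha - 3 / 4) / 2)); split.
  - by rewrite lt_min; apply/andP; split; lra.
  - by rewrite ge_min lexx.
  - have : Num.min (1 / 4) ((alpha - 3 / 4) / 2) <= (alpha - 3 / 4) / 2 by rewrite ge_min lexx orbT.
    by move=> h' _; lra.
pose g := 1 / 4 + e.
pose Hs := 2 * pi * (Q + (1 + (2 * alpha - 2 * g - 1)^-1)).
pose H := 2 * pi * (Qbar + (1 + (2 * beta - 2 * (1 / 2) - 1)^-1)).
have H0 : 0 <= H.
  rewrite mulr_ge0 ?mulr_ge0 ?pi_ge0// addr_ge0 ?(ltW hQbar)// addr_ge0// invr_ge0; move: hbeta; lra.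
pose r := Hs ^+ 4 / smin ^+ 2.
(* In Model (I) the sign of [Hs] is not controlled; the even power makes [r] nonnegative in both
   models. *)
have r0 : 0 <= r by rewrite mulr_ge0 ?pow4_ge0// invr_ge0 sqr_ge0.
pose A := 96 * 65 ^+ 2 * (smax ^+ 2 + r).
have A0 : 0 <= A by rewrite mulr_ge0// addr_ge0// sqr_ge0.
have [rc rcE] : exists rc, rc = risk_const tmax H k4 1 by eexists.
have rc0 : 0 <= rc by rewrite rcE; apply: risk_const_ge0; [exact: ltW|exact: le_trans k41|].
exists (8 * Qbar + 18 * rc); split.
  by rewrite addr_ge0// mulr_ge0// ltW.
have evL := @log2_eventually_le R 1 2 ltr01 (ler0n _ _).
have evA := log2_eventually_le e0 (addr_ge0 ler01 A0).
have e01 : 0 < e <= 1 / 4 by rewrite e0 e1.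
have g01 : 0 <= g <= 1 by apply/andP; split; rewrite /g; lra.
have h01 : 0 <= (1 / 2 : R) <= 1 by apply/andP; split; lra.
have b12 : 1 < 2 * beta - 2 * (1 / 2) by move: hbeta; lra.
near=> n.
have n16 : (16 < n)%N by near: n; exact: nbhs_infty_gt.
have n0 : 0 < n%:R :> R by rewrite ltr0n (leq_trans _ n16).
have Ln : 2 * log2 n%:R <= n%:R :> R.
  rewrite -[leRHS](powRr1 (ltW n0)).
  by near: n.
have AL : (1 + A) * log2 n%:R <= n%:R `^ e.
  by near: n.
move=> N N0 NL; apply: ge_ereal_sup => _ [s2 [t2 [Y [Ss Ut ob ->]]]].
have [rate1 rate2] := holder_increment_rate n16 A0 e01 AL.
have [[ms2 _ _] _ bs2] := Ss.
have [[mt2 _ [theta [ftheta sumtheta]]] ct2 bt2] := Ut.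
pose rho := r * (n%:R^-1 `^ g) ^+ 4.
have rho0 : 0 <= rho by rewrite mulr_ge0// pow4_ge0.
have incr : M = ModelII -> forall i, (0 < i < n)%N ->
     (Num.sqrt (s2 (i.+1%:R / n%:R)) - Num.sqrt (s2 (i%:R / n%:R))) ^+ 4 <= rho.
  move=> MII i /andP[i0 i_n].
  have hx := grid01 (R := R) i_n; have hy := grid01 (R := R) (ltnW i_n).
  have /andP[sx _] := bs2 _ hx; have /andP[sy _] := bs2 _ hy.
  apply: le_trans (sqrt_diff_pow4 hsmin sx sy) _.
  have -> : rho = Hs ^+ 4 * (n%:R^-1 `^ g) ^+ 4 / smin ^+ 2 by rewrite /rho /r mulrAC.
  rewrite ler_pM2r ?invr_gt0 ?exprn_gt0//.
  have := smooth_class_b_holder alpha0 (ltW hQ) (ltW hsmin) g01 (ea MII) Ss hx hy.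
  rewrite -/Hs -mulrBl -natrB// subSnn mul1r (@ger0_norm _ n%:R^-1) ?invr_ge0 ?(ltW n0)// => h.
  rewrite -exprMn (_ : 4 = 2 * 2)%N// !exprM.
  rewrite -[X in X ^+ 2 <= _]real_normK ?num_real//.
  by rewrite ler_sqr ?nnegrE ?sqr_ge0// ler_sqr ?nnegrE// (le_trans _ h).
have [Z [sZ YE]] := observations_signal hW heps n16 ob smax0 ms2
  (fun x x01 => ltac:(by have /andP[h1 h2] := bs2 x x01; rewrite h2 (le_trans (ltW hsmin) h1))) rho0 incr.
have t2b (x : R) : 0 <= x <= 1 -> 0 <= t2 x <= tmax.
  by move=> /bt2 /andP[h1 h2]; rewrite h2 (le_trans (ltW htmin) h1).
have t2b' (x : R) : 0 <= x <= 1 -> `|t2 x| <= tmax.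
  by move=> /t2b /andP[h1 h2]; rewrite ger0_norm.
have t2h := smooth_class_b_holder beta0 (ltW hQbar) (ltW htmin) h01 b12 Ut.
have Kq : 96 * 65 ^+ 2 * (smax ^+ 2 / n%:R ^+ 2 + rho) <=
    (1 / (Num.sqrt n%:R * log2 n%:R ^+ 2)) ^+ 2.
  apply: le_trans rate2; rewrite /A -[leRHS]mulrA ler_pM2l ?mulr_gt0// mulrDl lerD//.
  by rewrite -exprVn ler_wpM2l ?sqr_ge0.
apply: (le_trans (mise_le (r := rc / n%:R) beta0 mt2 t2b' ftheta sumtheta N0 _)).
  move=> k kN.
  have kL : (k%:R * log2 n%:R) ^+ 2 <= n%:R :> R.
    apply: le_trans NL; have L4 := @log2_ge4 R _ n16.
    have l0 : 0 <= log2 n%:R :> R by exact: le_trans L4.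
    have h : k%:R * log2 n%:R <= N%:R * log2 n%:R :> R by rewrite ler_wpM2r// ler_nat.
    have h0 : 0 <= k%:R * log2 n%:R :> R by rewrite mulr_ge0.
    by rewrite ler_sqr ?nnegrE// (le_trans h0 h).
  have [_ I B] := t_hat_risk heps H0 k41 ltr01 mt2 t2b t2h n16 Ln kL (mom n n16) sZ Kq YE.
  by rewrite rcE.
rewrite lee_fin mulrDr; apply: lerD.
  rewrite ler_wpM2r ?powR_ge0// lerDl mulr_ge0//.
have N1 : 1 <= N%:R :> R by rewrite ler1n.
rewrite !mulrA ler_pM2r ?invr_gt0//.
(* [N >= 1] turns [2 + 16 * N] into [18 * N]. *)
apply: (@le_trans _ _ (18 * N%:R * rc)); first by rewrite ler_wpM2r//; lra.
by rewrite mulrAC [leRHS]mulrDl lerDr mulr_ge0// mulr_ge0// ltW.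
Unshelve. all: by end_near. Qed.

End UniformBound.

Theorem theorem1 (R : realType) (d : measure_display) (T : measurableType d)
    (P : probability T R) (W : R -> {RV P >-> R})
    (eps : nat -> nat -> {RV P >-> R})
    (hW : brownian_motion W) (heps : noise W eps)
    (smin smax tmin tmax : R)
    (hsmin : 0 < smin) (hsmax : smin < smax)
    (htmin : 0 < tmin) (htmax : tmin < tmax)
    (alpha beta Q Qbar : R) (hbeta : 1 < beta) (hQ : 0 < Q) (hQbar : 0 < Qbar)
    (M : model)
    (hM : (M = ModelI /\ 1 / 2 < alpha) \/ (M = ModelII /\ 3 / 4 < alpha)) :
  let S := smooth_class_b alpha Q smin smax in
  let U := smooth_class_b beta Qbar tmin tmax in
  (forall N : nat -> nat,
     (forall n, (16 < n)%N -> (0 < N n)%N) ->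
     (fun n => (N n)%:R : R^o) =o_\oo
       (fun n => n%:R `^ (1 / 2) / log2 n%:R : R^o) ->
     ebigO (fun n => sup_mise W eps M S U n (N n))
       (fun n => (N n)%:R `^ (- (2 * beta)) + (N n)%:R * n%:R^-1))
  /\
  (forall Nstar : nat -> nat,
     (forall n, (16 < n)%N -> (0 < Nstar n)%N) ->
     (exists c1 c2 : R, [/\ 0 < c1, c1 <= c2 &
        \forall n \near \oo,
          c1 * n%:R `^ (1 / (2 * beta + 1)) <= (Nstar n)%:R
            <= c2 * n%:R `^ (1 / (2 * beta + 1))]) ->
     ebigO (fun n => sup_mise W eps M S U n (Nstar n))
       (fun n => n%:R `^ (- (2 * beta) / (2 * beta + 1)))).
Proof.
have [C0 [C00 bound]] :=
  sup_mise_bound hW heps hsmin hsmax htmin htmax hbeta hQ hQbar hM.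
move=> S U.
have part1 (N : nat -> nat) : (forall n, (16 < n)%N -> (0 < N n)%N) ->
    (fun n => (N n)%:R : R^o) =o_\oo (fun n => n%:R `^ (1 / 2) / log2 n%:R : R^o) ->
    \forall n \near \oo, (sup_mise W eps M S U n (N n) <=
      (C0 * ((N n)%:R `^ (- (2 * beta)) + (N n)%:R * n%:R^-1))%:E)%E.
  (* The little-o is used with constant 1: eventually [N * log2 n <= sqrt n], which is the condition
     of [sup_mise_bound]. *)
  move=> N0 /eqoP/(_ 1 ltr01) hN; near=> n.
  have n16 : (16 < n)%N by near: n; exact: nbhs_infty_gt.
  have h : `|(N n)%:R : R^o| <= 1 * `|n%:R `^ (1 / 2) / log2 n%:R : R^o| by near: n.
  have B : forall N, (0 < N)%N -> (N%:R * log2 n%:R) ^+ 2 <= n%:R :> R ->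
      (sup_mise W eps M S U n N <= (C0 * (N%:R `^ (- (2 * beta)) + N%:R * n%:R^-1))%:E)%E.
    by near: n.
  apply: B; first exact: N0.
  have L0 : 0 < log2 n%:R :> R by apply: lt_le_trans (@log2_ge4 R _ n16).
  have r0 : 0 <= n%:R `^ (1 / 2) :> R by exact: powR_ge0.
  have h' : (N n)%:R * log2 n%:R <= n%:R `^ (1 / 2) :> R.
    by move: h; rewrite mul1r normr_nat (ger0_norm (divr_ge0 r0 (ltW L0))) ler_pdivlMr.
  apply: (@le_trans _ _ ((n%:R `^ (1 / 2)) ^+ 2)).
    by rewrite ler_sqr ?nnegrE// mulr_ge0// ltW.
  by rewrite div1r powR12_sqrt// sqr_sqrtr.
split=> [N N0 hN|N N0 [c1 [c2 [c10 c12 hN]]]]; first by exists C0; exact: part1.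
(* This exponent satisfies [- 2 * beta * q = q - 1], so that the two terms of the bound have the
   same order. *)
pose q : R := 1 / (2 * beta + 1).
have b1 : 0 < 2 * beta + 1 by lra.
have q0 : 0 < q by rewrite divr_gt0.
(* The positive power of n left over absorbs the logarithm in the growth condition on [N]. *)
have q2 : 0 < 1 / 2 - q by rewrite subr_gt0 ltr_pdivrMr//; lra.
have qE : - (2 * beta) / (2 * beta + 1) = q - 1 by rewrite /q; field; rewrite gt_eqF.
have c20 : 0 < c2 by exact: lt_le_trans c12.
have oN : (fun n => (N n)%:R : R^o) =o_\oo (fun n => n%:R `^ (1 / 2) / log2 n%:R : R^o).
  apply/eqoP => e e0.
  have ev := log2_eventually_le q2 (ltW (divr_gt0 c20 e0)).
  near=> n.
  have n16 : (16 < n)%N by near: n; exact: nbhs_infty_gt.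
  have n0 : 0 < n%:R :> R by rewrite ltr0n (leq_trans _ n16).
  have L0 : 0 < log2 n%:R :> R by apply: lt_le_trans (@log2_ge4 R _ n16).
  have /andP[_ h] : c1 * n%:R `^ q <= (N n)%:R <= c2 * n%:R `^ q by near: n.
  have hL : c2 / e * log2 n%:R <= n%:R `^ (1 / 2 - q) by near: n.
  rewrite normr_nat (ger0_norm (divr_ge0 (powR_ge0 _ _) (ltW L0))).
  apply: le_trans h _; rewrite mulrA ler_pdivlMr//.
  rewrite (_ : n%:R `^ (1 / 2) = n%:R `^ q * n%:R `^ (1 / 2 - q)); last first.
    by rewrite -powRD ?subrKC//; apply/implyP => _; rewrite gt_eqF.
  rewrite (_ : c2 * _ * _ = e * (n%:R `^ q * (c2 / e * log2 n%:R))); last first.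
    by field; rewrite gt_eqF.
  by rewrite ler_pM2l// ler_wpM2l// powR_ge0.
exists (C0 * (c1 `^ (- (2 * beta)) + c2)).
have B := part1 N N0 oN; near=> n.
have n0 : 0 < n%:R :> R by rewrite ltr0n; near: n; exact: nbhs_infty_gt.
have /andP[h1 h2] : c1 * n%:R `^ q <= (N n)%:R <= c2 * n%:R `^ q by near: n.
have B' : (sup_mise W eps M S U n (N n) <=
      (C0 * ((N n)%:R `^ (- (2 * beta)) + (N n)%:R * n%:R^-1))%:E)%E by near: n.
(* The decreasing term uses the lower bound [c1] on [N], the increasing one the upper bound [c2]. *)
apply: le_trans B' _; rewrite lee_fin qE -[leRHS]mulrA ler_wpM2l// [leRHS]mulrDl; apply: lerD.
  have nq : 0 < c1 * n%:R `^ q by rewrite mulr_gt0// powR_gt0.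
  have -> : q - 1 = q * - (2 * beta) by rewrite /q; field; rewrite gt_eqF.
  rewrite powRrM -powRM ?(ltW c10) ?powR_ge0// !powRN.
  have N0' := lt_le_trans nq h1.
  rewrite lef_pV2 ?posrE ?powR_gt0//.
  by apply: ge0_ler_powR; rewrite ?nnegrE ?(ltW nq)//; lra.
rewrite ler_pdivrMr// -mulrA -[X in _ * (_ * X)](powRr1 (ltW n0)) -powRD ?subrK//.
by apply/implyP => _; rewrite gt_eqF.
Unshelve. all: by end_near. Qed.
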